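(* Let $1\le p<\infty$, $r,s\in\mathbb{N}$ with $s\le 2r$, and let $(G_n)_{n\in\mathbb{N}}$ be a family of linear sampling operators with nodes $X_n=(x_{k,n})_{k=1}^n$ and separation constant $\gamma\in(0,1]$ (see context). Suppose that there are constants $K_1,K_2,K_3>0$ such that $$K_2\|g\|_{\ell_p(X_n)}\le\|G_n(g)\|_p\le K_1\|g\|_{\ell_p(X_n)}\quad\text{for all } g\in L_p(\mathbb{T}),\ n\in\mathbb{N},$$ $$\|g-G_n(g)\|_p\le K_3n^{-s}\|g^{(s)}\|_p\quad\text{for all } g\in W_p^s(\mathbb{T}),\ n\in\mathbb{N}.$$ Let $f\in L_p(\mathbb{T})$. If $G_n(f)\in\mathcal{T}_n$ for all $n\in\mathbb{N}$ and there exists a constant $K>0$ such that $$\omega_s(f,h)_p\le K\,\omega_{s+1}(f,h)_p\quad\text{for all } h>0,$$ then for all $n\in\mathbb{N}$ $$\|f-G_n(f)\|_p\asymp\|f_{\gamma/n,\,r}-f\|_{\ell_p(X_n)}+\omega_s(f,1/n)_p,$$ where $\asymp$ is a two-sided inequality with positive constants depending only on $K$, $p$, $r$, and $s$ (the family $(G_n)$, and with it $\gamma,K_1,K_2,K_3$, being fixed).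
   Context: $\mathbb{T}=[0,1)$. For $1\le p<\infty$, $L_p(\mathbb{T})$ is the space of all 1-periodic measurable functions $f$, finite at every point, with $\|f\|_p=(\int_0^1|f(x)|^p\,dx)^{1/p}<\infty$; functions coinciding almost everywhere are not identified, so $f\in L_p(\mathbb{T})$ is given by its value at each point. For $s\in\mathbb{N}$, $f\in W_p^s(\mathbb{T})$ means that $f$ is 1-periodic, $f^{(s-1)}$ is absolutely continuous and $f^{(s)}\in L_p(\mathbb{T})$. For a set of $n$ points $X_n=(x_{k,n})_{k=1}^n$, $\|f\|_{\ell_p(X_n)}=\big(\frac1n\sum_{k=1}^n|f(x_{k,n})|^p\big)^{1/p}$. $\mathcal{T}_n$ is the set of all (1-periodic) trigonometric polynomials $\sum_{|\ell|\le n}c_\ell e^{2\pi i\ell x}$ of degree at most $n$. Modulus of smoothness: for $s\in\mathbb{N}$, $\delta>0$, $\omega_s(f,\delta)_p=\sup_{0<h<\delta}\|\Delta_h^sf\|_p$, where $\Delta_h^sf(x)=\sum_{\nu=0}^s\binom{s}{\nu}(-1)^\nu f(x+(s-\nu)h)$. Generalized Steklov average: for $r\in\mathbb{N}$, $\delta>0$ and integrable $f$, $$f_{\delta,r}(x)=(-1)^{r+1}\binom{2r}{r}^{-1}\frac2\delta\int_{-\delta/2}^{\delta/2}\sum_{\nu=0}^{r-1}(-1)^\nu\binom{2r}{\nu}f\Big(x+\frac{r-\nu}{r}t\Big)dt .$$ Sampling operators: for each $n\in\mathbb{N}$, $G_n(f)(x)=\sum_{k=1}^nf(x_{k,n})\varphi_{k,n}(x)$,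 where $\varphi_{k,n}\in L_p(\mathbb{T})$ are fixed 1-periodic functions and the nodes $X_n=(x_{k,n})_{k=1}^n$ satisfy $0\le x_{1,n}<x_{2,n}<\dots<x_{n,n}<1$. It is assumed that $\gamma\in(0,1]$ is such that $\min_{1\le k\le n}(x_{k+1,n}-x_{k,n})\ge\gamma/n$ for all $n\in\mathbb{N}$, where $x_{n+1,n}=1+x_{1,n}$. *)

(* Defs.v *)
From HB Require Import structures.
From mathcomp Require Import all_boot all_order all_algebra.
From mathcomp Require Import all_classical all_reals all_analysis.
From mathcomp Require Import complex.

Set Implicit Arguments.
Unset Strict Implicit.
Unset Printing Implicit Defensive.

Import Order.TTheory GRing.Theory Num.Theory.
Import numFieldNormedType.Exports.
Import Normc.

Local Open Scope classical_set_scope.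
Local Open Scope ring_scope.
Local Open Scope complex_scope.

(** Functions are complex-valued, since trigonometric polynomials are taken
    with complex coefficients; [R[i]] carries neither a measurable structure
    nor a derivative with respect to a real variable, so measurability,
    integrals and derivatives are taken on real and imaginary parts. *)

Section Spaces.
Context {R : realType}.
Implicit Types (f g : R -> R[i]) (p : R).

(** Measurability and integrals refer to the completed Lebesgue measure, so
    "measurable" means Lebesgue (not only Borel) measurable. *)
Definition leb := @completed_lebesgue_measure R.

Definition lebesgue_measurable (u : R -> R) : Prop :=
  measurable_fun (setT : set (caratheodory_type ((wlength idfun)^*)%mu)) u.

Definition periodic1 f : Prop := forall x : R, f (x + 1) = f x.

Definition Lp_norm p f : \bar R :=
  ((\int[leb]_(x in `[0%R, 1%R[) (normc (f x) `^ p)%:E) `^ p^-1)%E.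

Definition in_Lp p f : Prop :=
  [/\ periodic1 f,
      lebesgue_measurable (fun x => complex.Re (f x)),
      lebesgue_measurable (fun x => complex.Im (f x))
    & (Lp_norm p f < +oo)%E].

(** At points where the [k]-th derivative does not exist [derive1n] takes a
    default value; below this happens only on a null set. *)
Definition cderiven (k : nat) f : R -> R[i] := fun x =>
  derive1n k (fun y => complex.Re (f y)) x +i*
  derive1n k (fun y => complex.Im (f y)) x.

Definition cderivable f : Prop := forall x : R,
  derivable (fun y => complex.Re (f y)) x 1 /\
  derivable (fun y => complex.Im (f y)) x 1.

Definition abs_continuous (a b : R) f : Prop :=
  forall e : R, 0 < e -> exists2 d : R, 0 < d &
    forall (m : nat) (u v : 'I_m -> R),
      (forall i, a <= u i /\ u i <= v i /\ v i <= b) ->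
      trivIset setT (fun i => `]u i, v i[%classic) ->
      \sum_i (v i - u i) < d ->
      \sum_i normc (f (v i) - f (u i)) < e.

(** For a 1-periodic function, absolute continuity on the closed period
    [[0, 1]] is absolute continuity on every compact interval. *)
Definition in_W (s : nat) p f : Prop :=
  [/\ periodic1 f,
      (forall k, (k.+1 < s)%N -> cderivable (cderiven k f)),
      abs_continuous 0 1 (cderiven s.-1 f)
    & in_Lp p (cderiven s f)].

(** Nodes are indexed from 1: only [X 1, ..., X n] are used. *)
Definition lp_norm p (n : nat) (X : nat -> R) f : R :=
  (n%:R^-1 * \sum_(1 <= k < n.+1) normc (f (X k)) `^ p) `^ p^-1.

(** [e^{2 pi i l x}] *)
Definition trig_exp (l : int) (x : R) : R[i] :=
  cos (2 * pi * l%:~R * x) +i* sin (2 * pi * l%:~R * x).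

(** The frequency [l = j - n] runs over [-n, ..., n]. *)
Definition trig_poly (n : nat) f : Prop :=
  exists c : int -> R[i], forall x : R,
    f x = \sum_(j < (2 * n)%N.+1)
            c (j%:Z - n%:Z) * trig_exp (j%:Z - n%:Z) x.

Definition finite_diff (s : nat) (h : R) f : R -> R[i] := fun x =>
  \sum_(nu < s.+1)
    ('C(s, nu))%:R * (-1) ^+ nu * f (x + (s - nu)%N%:R * h).

Definition modulus (s : nat) p f (d : R) : \bar R :=
  ereal_sup [set Lp_norm p (finite_diff s h f) | h in `]0, d[].

Definition cintegral (a b : R) f : R[i] :=
  (\int[leb]_(t in `[a, b]) complex.Re (f t)) +i*
  (\int[leb]_(t in `[a, b]) complex.Im (f t)).

Definition steklov (d : R) (r : nat) f : R -> R[i] := fun x =>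
  (-1) ^+ r.+1 * ('C((2 * r)%N, r))%:R^-1 * (2 / d)%:C *
  cintegral (- (d / 2)) (d / 2) (fun t =>
    \sum_(nu < r) (-1) ^+ nu * ('C((2 * r)%N, nu))%:R *
                  f (x + (r - nu)%N%:R / r%:R * t)).

(** [X n k] is the node [x_{k,n}] and [phi n k] the function
    [phi_{k,n}], for [1 <= k <= n]. *)
Definition sampling (X : nat -> nat -> R) (phi : nat -> nat -> R -> R[i])
    (n : nat) f : R -> R[i] := fun x =>
  \sum_(1 <= k < n.+1) f (X n k) * phi n k x.

Definition ordered_nodes (n : nat) (X : nat -> R) : Prop :=
  [/\ 0 <= X 1%N,
      (forall k, (1 <= k < n)%N -> X k < X k.+1)
    & X n < 1].

(** [x_{k+1,n}], with the convention [x_{n+1,n} = 1 + x_{1,n}]. *)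
Definition next_node (n : nat) (X : nat -> R) (k : nat) : R :=
  if k == n then 1 + X 1%N else X k.+1.

Definition separated_nodes (gamma : R) (n : nat) (X : nat -> R) : Prop :=
  forall k, (1 <= k <= n)%N -> gamma / n%:R <= next_node n X k - X k.

End Spaces.

(* Main.v *)
Require Import Defs.
From mathcomp Require Import all_boot all_order all_algebra.
From mathcomp Require Import all_classical all_reals all_analysis.
From mathcomp Require Import measurable_realfun complex ring lra zify.

Import Order.TTheory GRing.Theory Num.Theory.
Import numFieldNormedType.Exports.
Import Normc.

Local Open Scope classical_set_scope.
Local Open Scope ring_scope.

(** Let [E] be the error [|f - G_n f|_p], [w] the modulus [omega_s(f, 1/n)_p],
    [st] the Steklov average at scale [gamma / n] and [L] the sampled norm of
    [st f - f].  Both estimates come from one smooth function [h] such that,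
    with constants depending on the fixed data only,
    - [|f - h|_p <= C w] and [|h^(s)|_p <= C n^s w]
      ([cnorm_sub_smooth], [cnorm_deriv_smooth]),
    - the sampled norms of [h - st h] and of [st f - st h] are at most [C w]
      ([sampled_smooth_sub], [sampled_steklov_sub]).
    The approximation hypothesis applied to [h] gives [|h - G_n h|_p <= C w].
    As [G_n] is linear, the upper sampling inequality bounds
    [|G_n (h - f)|_p] by the sampled norm of [h - f], and
    [h - f = (h - st h) + (st h - st f) + (st f - f)] bounds that by
    [C w + L]; the triangle inequality then gives [E <= C (w + L)].
    The same decompositions, with the lower sampling inequality, give
    [L <= C (w + E)], so that the lower estimate reduces to [w <= C E].

    That last inequality is [modulus_le_error].  Let [T = G_n f].  Bernstein's
    inequality makes a difference of [T] with step [t] smaller by a factor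
    [8 pi n t], so the [(s + 1)]-st modulus of [f] at [t] is at most
    [2^(s+1) E + 8 pi n t (2^s E + omega_s(f, t))].  For [t] a small multiple
    of [1 / n] the hypothesis [omega_s <= K omega_(s+1)] lets the last term be
    absorbed, and passing from [t] to [1 / n] costs a constant factor.

    The function [h] is a combination of [(s + 1)]-fold averages over windows
    of length at most [gamma / n], chosen so that [f - h] is an average of
    [s]-th differences of [f] ([jackson]).  Windows attached to the nodes are
    disjoint modulo 1 because the nodes are separated, so the sampled norm of a
    window average is at most a constant times an Lp norm ([lp_norm_smear]).
    The Steklov average is itself a combination of window averages, and
    [h - st h] is an average of [2r]-th differences of [h] ([sub_rsteklov]);
    since [s <= 2r], these are controlled by [s]-th differences of [f].

    Bernstein's inequality in Lp follows from a quadrature formula: the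
    derivative of a polynomial of degree [n] is a combination of [4n] of its
    translates, whose weights, built from Fejer's kernel, have total mass at
    most [4 pi n] ([bernstein_derivative]).

    As [f] is only Lebesgue measurable, all of this is carried out for a
    periodic Borel function equal to [f] almost everywhere.  The error, the
    modulus and every value of a Steklov average are the same for both; the
    values of [f] at the nodes enter only through [L] and [G_n (h - f)].
    Complex functions are treated through their real and imaginary parts. *)

(** * Lebesgue and Borel measurability *)

Section LebesgueMeasureLinks.
Context {R : realType}.
Notation mu := (@lebesgue_measure R).
Notation cara := (caratheodory_type ((@wlength R idfun)^*)%mu).

(** The identity, seen as a map from the line with its Caratheodory
    measurable sets to the Borel line: the image of the completed measure under
    it is Lebesgue measure. *)
Definition cara_borel (x : cara) : measurableTypeR R := x.

Lemma measurable_cara_borel : measurable_fun setT cara_borel.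
Proof.
move=> _ B mB; rewrite setTI; exact: sub_caratheodory.
Qed.

Lemma lebesgue_measurableW (u : R -> R) :
  measurable_fun setT u -> lebesgue_measurable u.
Proof.
by move=> mu_; exact: (measurableT_comp mu_ measurable_cara_borel).
Qed.

Lemma ge0_integral_leb (D : set R) (f : R -> \bar R) :
  measurable D -> measurable_fun D f -> (forall x, D x -> (0 <= f x)%E) ->
  (\int[leb]_(x in D) f x = \int[mu]_(x in D) f x)%E.
Proof.
move=> mD mf f0.
have := @ge0_integral_pushforward _ _ cara (measurableTypeR R) R cara_borel
  measurable_cara_borel leb D f mD mf.
move=> <-; last by move=> x /[!inE]; exact: f0.
apply: (@eq_measure_integral _ (measurableTypeR R) R D) => //.
exact: measurable_cara_borel.
Qed.

Lemma integral_leb (D : set R) (f : R -> \bar R) :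
  measurable D -> measurable_fun D f ->
  (\int[leb]_(x in D) f x = \int[mu]_(x in D) f x)%E.
Proof.
move=> mD mf; rewrite integralE [RHS]integralE; congr (_ - _)%E.
- by apply: ge0_integral_leb => //; exact: measurable_funepos.
- by apply: ge0_integral_leb => //; exact: measurable_funeneg.
Qed.

Definition affine (a c x : R) : R := a + c * x.

Lemma measurable_affine a c : measurable_fun setT (affine a c).
Proof. by apply: measurable_funD => //; exact: measurable_funM. Qed.

Lemma affine_preimage_itv_oc (a c x y : R) : 0 < c ->
  affine a c @^-1` `]x, y] = `](x - a) / c, (y - a) / c]%classic.
Proof.
move=> c0; apply/seteqP; split => t /=; rewrite !in_itv/= /affine;
  rewrite ltr_pdivrMr// ler_pdivlMr// => /andP[h1 h2]; apply/andP; split; lra.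
Qed.

(** By uniqueness of Lebesgue measure: both sides agree on half-open
    intervals. *)
Lemma lebesgue_measure_affine (a c : R) (A : set R) : 0 < c -> measurable A ->
  (mu A = c%:E * mu (affine a c @^-1` A))%E.
Proof.
move=> c0 mA.
have c0' : 0 <= c by exact: ltW.
pose aff := (affine a c : measurableTypeR R -> measurableTypeR R).
have maff : measurable_fun setT aff by exact: measurable_affine.
pose nu : {measure set (measurableTypeR R) -> \bar R} :=
  mscale (NngNum c0') (pushforward mu aff).
rewrite (@lebesgue_measure_unique R (nu maff)) // => _ [[x y] _ <-] /=.
rewrite /nu /= /mscale /= /pushforward affine_preimage_itv_oc//.
rewrite !lebesgue_measure_itv/= !lte_fin.
rewrite ltr_pM2r ?invr_gt0// ltrD2r; case: ifPn => h; last by rewrite mule0.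
by rewrite -!EFinB -EFinM; congr EFin; field; rewrite gt_eqF.
Qed.

Lemma ge0_integral_affine (a c : R) (f : R -> \bar R) (D : set R) : 0 < c ->
  measurable D -> measurable_fun D f -> (forall x, D x -> (0 <= f x)%E) ->
  (\int[mu]_(x in D) f x =
   c%:E * \int[mu]_(x in affine a c @^-1` D) f (affine a c x))%E.
Proof.
move=> c0 mD mf f0.
have c0' : 0 <= c by exact: ltW.
pose aff := (affine a c : measurableTypeR R -> measurableTypeR R).
have maff : measurable_fun setT aff by exact: measurable_affine.
rewrite -(@ge0_integral_pushforward _ _ _ _ R aff maff mu D f mD mf); last first.
  by move=> x /[!inE]; exact: f0.
pose nu : {measure set (measurableTypeR R) -> \bar R} :=
  mscale (NngNum c0') (pushforward mu aff).
rewrite (_ : integral mu D f = integral (nu maff) D f)%E; last first.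
  by apply: eq_measure_integral => A mA AD; exact: lebesgue_measure_affine.
by rewrite ge0_integral_mscale.
Qed.

Lemma null_affine (a c : R) (A : set R) : 0 < c -> measurable A -> mu A = 0%E ->
  mu (affine a c @^-1` A) = 0%E.
Proof.
move=> c0 mA; rewrite (@lebesgue_measure_affine a c) // => /eqP.
by rewrite mule_eq0 eqe gt_eqF //= => /eqP.
Qed.

(** The Caratheodory sets are the completion of the Borel sets. *)
Lemma lebesgue_measurable_set (A : set R) : measurable (A : set cara) ->
  exists B N : set R, [/\ measurable B, measurable N, mu N = 0%E &
     A `\` N = B `\` N].
Proof.
rewrite -[X in X A]completed_caratheodory_measurable g_sigma_completed_algebra_genE.
move=> [B mB [N' [N [mN N0 N'N]]] <-].
exists B, N; split => //.
apply/seteqP; split => x /= [h1 h2]; split => //; last by left.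
by case: h1 => // /N'N.
Qed.

(** The sets [u > q], [q] rational, are Borel up to countably many null sets;
    [v] is [u], replaced by 0 on the union [N] of these null sets. *)
Lemma borel_version (u : R -> R) : lebesgue_measurable u ->
  exists v : R -> R, measurable_fun setT v /\
    exists N : set R, [/\ measurable N, mu N = 0%E & forall x, ~ N x -> u x = v x].
Proof.
move=> mu_u.
have H (q : rat) : exists BN : set R * set R, [/\ measurable BN.1, measurable BN.2, mu BN.2 = 0%E &
     (u @^-1` `]ratr q, +oo[) `\` BN.2 = BN.1 `\` BN.2].
  have : measurable (u @^-1` `]ratr q, +oo[ : set cara).
    by rewrite -[X in measurable X]setTI; exact: mu_u.
  by move/lebesgue_measurable_set => [B [N [? ? ? ?]]]; exists (B, N).
have [BN HBN] := choice H.
pose N := \bigcup_q (BN q).2.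
have mN : measurable N.
  apply: bigcupT_measurable_rat => q; by case: (HBN q).
have N0 : mu N = 0%E.
  have : mu.-negligible N.
    pose F n := if pickle_inv n is Some q then (BN q).2 else set0.
    apply: (@negligibleS _ _ _ mu (\bigcup_n F n) N).
      by move=> x [q _ qx]; exists (pickle q); [by []|rewrite /F pickleK_inv].
    apply: negligible_bigcup => k; rewrite /F; case: (pickle_inv k) => [q|].
      have [_ mN2 N20 _] := HBN q.
      by exists (BN q).2; split; [exact: mN2|exact: N20|].
    exact: negligible_set0.
  by move/measure_negligible; exact.
exists (fun x => if x \in N then 0 else u x); split; last first.
  exists N; split => // x Nx; rewrite ifF//; apply/negbTE; by rewrite notin_setE.
set v := (fun x => _).
have mq (q : rat) : measurable (v @^-1` `]ratr q, +oo[).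
  have -> : v @^-1` `]ratr q, +oo[ = ((BN q).1 `\` N) `|` (if ratr q < 0 :> R then N else set0).
    have [_ _ _ E] := HBN q.
    apply/seteqP; split => x /=.
      rewrite in_itv/= andbT /v; case: ifPn => [xN h|]; first by right; rewrite h; rewrite inE in xN.
      rewrite notin_setE => xN qu; left; split => //.
      have : ((u @^-1` `]ratr q, +oo[) `\` (BN q).2) x.
        split; first by rewrite /= in_itv/= qu.
        by move=> h; apply: xN; exists q.
      by rewrite E => -[].
    rewrite in_itv/= andbT /v => -[[Bx xN]|].
      rewrite ifF; last by apply/negbTE; rewrite notin_setE.
      have : ((BN q).1 `\` (BN q).2) x by split => // h; apply: xN; exists q.
      by rewrite -E => -[] /=; rewrite in_itv/= andbT.
    by case: ifPn => // q0 xN; rewrite ifT // inE.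
  apply: measurableU; first by apply: measurableD => //; case: (HBN q).
  by case: ifPn.
apply: (measurability _ (RGenOInfty.measurableE R)) => //.
move=> _ [_ [x ->] <-]; rewrite setTI.
have -> : v @^-1` `]x, +oo[ = \bigcup_(q in [set q : rat | x < ratr q]) (v @^-1` `]ratr q, +oo[).
  apply/seteqP; split => y /=.
    rewrite in_itv/= andbT => xv.
    have [q] := rat_in_itvoo xv.
    rewrite in_itv/= => /andP[h1 h2]; exists q => //=; by rewrite in_itv/= h2.
  by move=> [q /= xq]; rewrite !in_itv/= !andbT; exact: lt_trans.
rewrite bigcup_mkcond; apply: bigcupT_measurable_rat => q.
by case: ifP.
Qed.

End LebesgueMeasureLinks.

(** * The Lp norm of complex functions *)

#[global] Arguments Normc.normc {R} x : simpl never.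

Section LpNorm.
Context {R : realType}.
Notation cara := (caratheodory_type ((@wlength R idfun)^*)%mu).
Implicit Types (f g : R -> R[i]) (p : R).

Definition lmeas f := lebesgue_measurable (fun x => complex.Re (f x)) /\
                      lebesgue_measurable (fun x => complex.Im (f x)).

Lemma ReD (a b : R[i]) : complex.Re (a + b) = complex.Re a + complex.Re b.
Proof. by case: a => ? ?; case: b. Qed.
Lemma ImD (a b : R[i]) : complex.Im (a + b) = complex.Im a + complex.Im b.
Proof. by case: a => ? ?; case: b. Qed.
Lemma ReM (a b : R[i]) : complex.Re (a * b) =
  complex.Re a * complex.Re b - complex.Im a * complex.Im b.
Proof. by case: a => ? ?; case: b. Qed.
Lemma ImM (a b : R[i]) : complex.Im (a * b) =
  complex.Re a * complex.Im b + complex.Im a * complex.Re b.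
Proof. by case: a => ? ?; case: b. Qed.

Lemma lmeasD f g : lmeas f -> lmeas g -> lmeas (fun x => f x + g x).
Proof.
move=> [f1 f2] [g1 g2]; split.
  rewrite (_ : (fun _ => _) = fun x => complex.Re (f x) + complex.Re (g x)).
    exact: measurable_funD.
  by apply/funext => x; rewrite ReD.
rewrite (_ : (fun _ => _) = fun x => complex.Im (f x) + complex.Im (g x)).
  exact: measurable_funD.
by apply/funext => x; rewrite ImD.
Qed.

Lemma lmeasZ (c : R[i]) f : lmeas f -> lmeas (fun x => c * f x).
Proof.
move=> [f1 f2]; split.
  rewrite (_ : (fun _ => _) = fun x => complex.Re c * complex.Re (f x) - complex.Im c * complex.Im (f x)).
    by apply: measurable_funB; apply: measurable_funM.
  by apply/funext => x; rewrite ReM.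
rewrite (_ : (fun _ => _) = fun x => complex.Re c * complex.Im (f x) + complex.Im c * complex.Re (f x)).
  by apply: measurable_funD; apply: measurable_funM.
by apply/funext => x; rewrite ImM.
Qed.

Lemma normcE_sqrt (z : R[i]) : normc z = Num.sqrt (complex.Re z ^+ 2 + complex.Im z ^+ 2).
Proof. by case: z. Qed.

Lemma normc_ge0 (z : R[i]) : 0 <= normc z.
Proof. by rewrite normcE_sqrt sqrtr_ge0. Qed.

Lemma measurable_normc d (T : measurableType d) (f : T -> R[i]) :
  measurable_fun setT (fun x => complex.Re (f x)) ->
  measurable_fun setT (fun x => complex.Im (f x)) ->
  measurable_fun setT (fun x => normc (f x)).
Proof.
move=> f1 f2; rewrite (_ : (fun _ => _) =
  fun x => Num.sqrt (complex.Re (f x) ^+ 2 + complex.Im (f x) ^+ 2)).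
  have ms : measurable_fun setT (@Num.sqrt R).
    apply: continuous_measurable_fun; exact: sqrt_continuous.
  apply: (measurableT_comp ms).
  by apply: measurable_funD; apply: measurable_funX.
by apply/funext => x; rewrite normcE_sqrt.
Qed.

Lemma measurable_normc_powR d (T : measurableType d) (f : T -> R[i]) p :
  measurable_fun setT (fun x => complex.Re (f x)) ->
  measurable_fun setT (fun x => complex.Im (f x)) ->
  measurable_fun setT (fun x => (normc (f x) `^ p)%:E).
Proof.
move=> f1 f2; apply/measurable_EFinP.
apply: (measurableT_comp (measurable_powR p)).
exact: measurable_normc.
Qed.

Lemma measurable_unit_leb : measurable (`[0%R, 1%R[ : set cara).
Proof. exact: sub_caratheodory. Qed.

Lemma Lp_norm_ge0 p f : (0 <= Lp_norm p f)%E.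
Proof. exact: poweR_ge0. Qed.

Lemma Lp_int_ge0 p f : (0 <= \int[leb]_(x in `[0%R, 1%R[) (normc (f x) `^ p)%:E)%E.
Proof. by apply: integral_ge0 => x _; rewrite lee_fin powR_ge0. Qed.

Lemma le_Lp_norm p f g : 0 < p -> lmeas f -> lmeas g ->
  (forall x, normc (f x) <= normc (g x)) -> (Lp_norm p f <= Lp_norm p g)%E.
Proof.
move=> p0 [f1 f2] [g1 g2] fg; rewrite /Lp_norm.
apply: gt0_ler_poweR; rewrite ?in_itv/= ?leey ?Lp_int_ge0 ?invr_ge0 ?(ltW p0)//.
apply: ge0_le_integral.
- exact: measurable_unit_leb.
- by move=> *; rewrite lee_fin powR_ge0.
- apply: measurable_funTS; exact: measurable_normc_powR.
- apply: measurable_funTS; exact: measurable_normc_powR.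
by move=> x _; rewrite lee_fin ge0_ler_powR ?nnegrE ?normc_ge0 ?(ltW p0).
Qed.

Lemma normc_real (a : R) : normc a%:C%C = `|a|.
Proof. by rewrite /normc /= expr0n /= addr0 sqrtr_sqr. Qed.

Lemma Lp_norm_real p (u : R -> R) : 0 < p ->
  Lp_norm p (fun x => (u x)%:C%C) =
  Lnorm (@completed_lebesgue_measure R) p%:E (EFin \o (u \_ `[0%R, 1%R[)).
Proof.
move=> p0; rewrite /Lp_norm unlock; congr (_ `^ _)%E.
rewrite [LHS]integral_mkcond; congr integral; apply/funext => x.
rewrite [LHS]patchE /= patchE; case: ifPn => _; first by rewrite normc_real.
by rewrite normr0 powR0// gt_eqF.
Qed.

Lemma lmeas_real (u : R -> R) : lebesgue_measurable u -> lmeas (fun x => (u x)%:C%C).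
Proof. by split => //=; exact: measurable_cst. Qed.

Lemma lmeas_normc f : lmeas f -> lebesgue_measurable (fun x => normc (f x)).
Proof. by move=> [? ?]; exact: measurable_normc. Qed.

Lemma normc_id f x : normc ((normc (f x))%:C)%C = normc (f x).
Proof. by rewrite normc_real ger0_norm// normc_ge0. Qed.

Lemma Lp_norm_normc p f : Lp_norm p (fun x => (normc (f x))%:C%C) = Lp_norm p f.
Proof.
rewrite /Lp_norm; congr (_ `^ _)%E; apply: eq_integral => x _.
by rewrite (@normc_id f x).
Qed.

(** Minkowski's inequality for the moduli, which are real functions. *)
Lemma Lp_norm_triangle p f g : 1 <= p -> lmeas f -> lmeas g ->
  (Lp_norm p (fun x => f x + g x)%R <= Lp_norm p f + Lp_norm p g)%E.
Proof.
move=> p1 mf mg; have p0 : 0 < p by exact: lt_le_trans p1.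
have mnf := lmeas_normc _ mf; have mng := lmeas_normc _ mg.
apply: (@le_trans _ _ (Lp_norm p (fun x => (normc (f x) + normc (g x))%:C%C))).
  apply: le_Lp_norm => //; first exact: lmeasD.
    by apply: lmeas_real; exact: measurable_funD.
  move=> x; rewrite normc_real ger0_norm ?addr_ge0 ?normc_ge0//.
  exact: le_normcD.
rewrite -(Lp_norm_normc p f) -(Lp_norm_normc p g) !Lp_norm_real//.
rewrite (_ : (fun x => normc (f x) + normc (g x)) \_ `[0%R, 1%R[ =
  ((fun x => normc (f x)) \_ `[0%R, 1%R[ \+ (fun x => normc (g x)) \_ `[0%R, 1%R[)); last first.
  by apply/funext => x /=; rewrite !patchE; case: ifP => //; rewrite addr0.
apply: (@minkowski_EFin _ cara R leb); last exact: p1.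
  apply/(measurable_restrictT _ measurable_unit_leb); exact: measurable_funTS.
apply/(measurable_restrictT _ measurable_unit_leb); exact: measurable_funTS.
Qed.

Lemma Lp_norm_scale p (c : R[i]) f : 0 < p -> lmeas f ->
  (Lp_norm p (fun x => c * f x)%R = (normc c)%:E * Lp_norm p f)%E.
Proof.
move=> p0 [mf1 mf2]; rewrite /Lp_norm.
rewrite (_ : (fun x => _) = (fun x => (normc c `^ p)%:E * (normc (f x) `^ p)%:E)%E); last first.
  by apply/funext => x; rewrite normcM powRM ?normc_ge0// EFinM.
rewrite ge0_integralZl.
- rewrite poweRM ?Lp_int_ge0 ?lee_fin ?powR_ge0//.
  by rewrite poweR_EFin -powRrM divff ?gt_eqF// powRr1// normc_ge0.
- exact: measurable_unit_leb.
- apply: measurable_funTS; exact: measurable_normc_powR.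
- by move=> *; rewrite lee_fin powR_ge0.
- by rewrite lee_fin powR_ge0.
Qed.

(** A real number, to compute with; it is the norm where [Lp] holds. *)
Definition cnorm p f : R := fine (Lp_norm p f).

Variant Lp p f : Prop := IsLp of lmeas f & (Lp_norm p f < +oo)%E.

Lemma cnorm_ge0 p f : 0 <= cnorm p f.
Proof. by rewrite fine_ge0// Lp_norm_ge0. Qed.

Lemma cnormE p f : Lp p f -> Lp_norm p f = (cnorm p f)%:E.
Proof.
by move=> [_ f1]; rewrite /cnorm fineK// ge0_fin_numE ?Lp_norm_ge0.
Qed.

Lemma LpE p f (M : R) : lmeas f -> (Lp_norm p f <= M%:E)%E -> Lp p f.
Proof. by move=> mf h; split => //; apply: le_lt_trans h _; exact: ltry. Qed.

Lemma cnorm_le p f (M : R) : (Lp_norm p f <= M%:E)%E -> cnorm p f <= M.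
Proof.
move=> h; rewrite -lee_fin /cnorm fineK//.
by rewrite ge0_fin_numE ?Lp_norm_ge0// (le_lt_trans h)// ltry.
Qed.

Lemma LpD p f g : 1 <= p -> Lp p f -> Lp p g -> Lp p (fun x => f x + g x).
Proof.
move=> p1 [mf f1] [mg g1]; split; first exact: lmeasD.
by apply: le_lt_trans (Lp_norm_triangle p f g p1 mf mg) _; rewrite lte_add_pinfty.
Qed.

Lemma cnormD p f g : 1 <= p -> Lp p f -> Lp p g ->
  cnorm p (fun x => f x + g x) <= cnorm p f + cnorm p g.
Proof.
move=> p1 Lf Lg; apply: cnorm_le; rewrite EFinD -!cnormE//.
by apply: Lp_norm_triangle => //; [case: Lf|case: Lg].
Qed.

Lemma LpZ p c f : 1 <= p -> Lp p f -> Lp p (fun x => c * f x).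
Proof.
move=> p1 Lf; case: (Lf) => mf _; have p0 : 0 < p by exact: lt_le_trans p1.
apply: (@LpE _ _ (normc c * cnorm p f)); first exact: lmeasZ.
by rewrite Lp_norm_scale// cnormE.
Qed.

Lemma cnormZ p c f : 1 <= p -> Lp p f ->
  cnorm p (fun x => c * f x) = normc c * cnorm p f.
Proof.
move=> p1 Lf; case: (Lf) => mf _; have p0 : 0 < p by exact: lt_le_trans p1.
by rewrite {1}/cnorm Lp_norm_scale// cnormE.
Qed.

Lemma normc_opp1 : normc (-1 : R[i]) = 1.
Proof. by rewrite normcN /normc /= expr0n /= addr0 expr1n sqrtr1. Qed.

Lemma LpN p f : 1 <= p -> Lp p f -> Lp p (fun x => - f x).
Proof.
move=> p1 Lf; rewrite (_ : (fun x => _) = fun x => -1 * f x); first exact: LpZ.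
by apply/funext => x; rewrite mulN1r.
Qed.

Lemma cnormN p f : 1 <= p -> Lp p f -> cnorm p (fun x => - f x) = cnorm p f.
Proof.
move=> p1 Lf; rewrite (_ : (fun x => _) = fun x => -1 * f x).
  by rewrite cnormZ// normc_opp1 mul1r.
by apply/funext => x; rewrite mulN1r.
Qed.

Lemma LpB p f g : 1 <= p -> Lp p f -> Lp p g -> Lp p (fun x => f x - g x).
Proof. by move=> p1 Lf Lg; apply: (LpD _ _ _ p1 Lf (LpN _ _ p1 Lg)). Qed.

Lemma cnormB p f g : 1 <= p -> Lp p f -> Lp p g ->
  cnorm p (fun x => f x - g x) <= cnorm p f + cnorm p g.
Proof.
move=> p1 Lf Lg; rewrite -(cnormN p g)//; apply: (cnormD _ _ _ p1 Lf (LpN _ _ p1 Lg)).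
Qed.

Lemma Lp0 p : 1 <= p -> Lp p (fun=> 0).
Proof.
move=> p1; have p0 : 0 < p by exact: lt_le_trans p1.
split; first by split => //=; exact: measurable_cst.
rewrite /Lp_norm (_ : (fun x => _) = cst 0%E); last first.
  by apply/funext => x /=; rewrite normc0 powR0// gt_eqF.
by rewrite integral0 poweR0r ?invr_eq0 ?gt_eqF.
Qed.

Lemma cnorm0 p : 1 <= p -> cnorm p (fun=> 0) = 0.
Proof.
move=> p1; have p0 : 0 < p by exact: lt_le_trans p1.
rewrite /cnorm /Lp_norm (_ : (fun x => _) = cst 0%E); last first.
  by apply/funext => x /=; rewrite normc0 powR0// gt_eqF.
by rewrite integral0 poweR0r ?invr_eq0 ?gt_eqF.
Qed.

Lemma Lp_sum p (I : Type) (r : seq I) (P : pred I) (F : I -> R -> R[i]) : 1 <= p ->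
  (forall i, P i -> Lp p (F i)) -> Lp p (fun x => \sum_(i <- r | P i) F i x).
Proof.
move=> p1 LF; elim: r => [|i r IH].
  by under eq_fun do rewrite big_nil; exact: Lp0.
under eq_fun do rewrite big_cons.
case: (boolP (P i)) => Pi; last exact: IH.
by apply: (LpD p (F i) _ p1 _ IH); exact: LF.
Qed.

Lemma cnorm_sum p (I : Type) (r : seq I) (P : pred I) (F : I -> R -> R[i]) : 1 <= p ->
  (forall i, P i -> Lp p (F i)) ->
  cnorm p (fun x => \sum_(i <- r | P i) F i x) <= \sum_(i <- r | P i) cnorm p (F i).
Proof.
move=> p1 LF; elim: r => [|i r IH].
  by under eq_fun do rewrite big_nil; rewrite big_nil cnorm0.
under eq_fun do rewrite big_cons.
rewrite big_cons; case: (boolP (P i)) => Pi; last exact: IH.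
apply: le_trans (cnormD p (F i) (fun x => \sum_(i <- r | P i) F i x) p1 _ _) _.
- exact: LF.
- exact: Lp_sum.
- by rewrite lerD2l.
Qed.

End LpNorm.

(** * Integrals over a period and window averages *)

Section PeriodIntegrals.
Context {R : realType}.
Notation mu := (@lebesgue_measure R).
Implicit Types (f : R -> \bar R) (a b c : R).

Lemma integral_shift f a x y : measurable_fun setT f -> (forall t, 0 <= f t)%E ->
  (\int[mu]_(t in `[x, y[) f (t + a)%R = \int[mu]_(t in `[(x + a)%R, (y + a)%R[) f t)%E.
Proof.
move=> mf f0.
rewrite [RHS](@ge0_integral_affine R a 1)//; last exact: measurable_funTS.
rewrite mul1e (_ : affine a 1 @^-1` `[x + a, y + a[ = `[x, y[%classic).
  by apply: eq_integral => t _; rewrite /affine mul1r addrC.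
by apply/seteqP; split => t /=; rewrite !in_itv/= /affine mul1r (addrC a) lerD2r ltrD2r.
Qed.

Lemma integral_split f a b c : a <= b -> b <= c ->
  measurable_fun setT f -> (forall t, 0 <= f t)%E ->
  (\int[mu]_(t in `[a, c[) f t =
   \int[mu]_(t in `[a, b[) f t + \int[mu]_(t in `[b, c[) f t)%E.
Proof.
move=> ab bc mf f0.
have -> : `[a, c[%classic = `[a, b[%classic `|` `[b, c[%classic.
  by apply: itv_bndbnd_setU; rewrite bnd_simp.
rewrite ge0_integral_setU//; first exact: measurable_funTS.
apply/disj_setPS => x /= []; rewrite !in_itv/= => /andP[_ h1] /andP[h2 _].
by move: (lt_le_trans h1 h2); rewrite ltxx.
Qed.

Lemma periodic_nat (T : Type) (f : R -> T) : (forall x, f (x + 1) = f x) ->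
  forall (n : nat) x, f (x + n%:R) = f x.
Proof.
move=> pf; elim => [|n IH] x; first by rewrite addr0.
by rewrite -addn1 natrD addrA pf IH.
Qed.

Lemma periodic_intz (T : Type) (f : R -> T) : (forall x, f (x + 1) = f x) ->
  forall (m : int) x, f (x + m%:~R) = f x.
Proof.
move=> pf [n|n] x; first by rewrite -pmulrn periodic_nat.
by rewrite NegzE mulrNz -pmulrn -[in RHS](subrK n.+1%:R x) periodic_nat.
Qed.

(** The part of [[a, a + 1[[ below the first integer from [a] on is moved by 1. *)
Lemma integral_period f a : (forall x, f (x + 1)%R = f x) ->
  measurable_fun setT f -> (forall t, 0 <= f t)%E ->
  (\int[mu]_(t in `[a, (a + 1)%R[) f t = \int[mu]_(t in `[0%R, 1%R[) f t)%E.
Proof.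
move=> pf mf f0.
pose m : R := (Num.ceil a)%:~R.
have am : a <= m by exact: ceil_ge.
have ma : m <= a + 1.
  have /andP[h _] := ceil_itv a; move: h; rewrite rmorphB/= -/m; lra.
rewrite (@integral_split _ a m)//.
have -> : (\int[mu]_(t in `[a, m[) f t = \int[mu]_(t in `[(a + 1)%R, (m + 1)%R[) f t)%E.
  rewrite -(@integral_shift f 1 a m mf f0).
  by apply: eq_integral => t _; rewrite pf.
rewrite addeC -integral_split//; last by rewrite lerD2r.
have -> : `[m, m + 1[%classic = `[0 + m, 1 + m[%classic by rewrite add0r addrC.
rewrite -integral_shift//; apply: eq_integral => t _; exact: periodic_intz.
Qed.

Lemma integral_period_shift f a : (forall x, f (x + 1)%R = f x) ->
  measurable_fun setT f -> (forall t, 0 <= f t)%E ->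
  (\int[mu]_(t in `[0%R, 1%R[) f (t + a)%R = \int[mu]_(t in `[0%R, 1%R[) f t)%E.
Proof.
move=> pf mf f0.
by rewrite integral_shift// add0r addrC integral_period.
Qed.

(** Translated by [a], the windows of length [L] starting at the nodes are
    disjoint and lie in a single period. *)
Lemma sum_windows f (n : nat) (X : nat -> R) (L a : R) : (0 < n)%N -> 0 <= L ->
  (forall k, (1 <= k < n)%N -> X k + L <= X k.+1) -> X n + L <= X 1%N + 1 ->
  (forall x, f (x + 1)%R = f x) -> measurable_fun setT f -> (forall t, 0 <= f t)%E ->
  (\sum_(1 <= k < n.+1) \int[mu]_(t in `[0%R, L[) f ((X k + a) + t)%R
    <= \int[mu]_(t in `[0%R, 1%R[) f t)%E.
Proof.
move=> n0 L0 Xs Xn pf mf f0.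
have W k : (\int[mu]_(t in `[0%R, L[) f ((X k + a) + t)%R =
            \int[mu]_(t in `[(X k + a)%R, (X k + a + L)%R[) f t)%E.
  under eq_integral do rewrite (addrC (X k + a)).
  by rewrite integral_shift// add0r (addrC L).
under eq_bigr do rewrite W.
have H m : (1 <= m <= n)%N ->
  (\sum_(1 <= k < m.+1) \int[mu]_(t in `[(X k + a)%R, (X k + a + L)%R[) f t <=
   \int[mu]_(t in `[(X 1%N + a)%R, (X m + a + L)%R[) f t)%E /\ X 1%N <= X m.
  elim: m => [//|[|m] IH] /andP[_ mn]; first by rewrite big_nat1.
  have [IH1 IH2] := IH (ltnW mn).
  have Xm : X m.+1 + L <= X m.+2 by apply: Xs.
  have X12 : X 1%N <= X m.+2 by lra.
  split => //; rewrite big_nat_recr//=.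
  rewrite [leRHS](@integral_split _ _ (X m.+2 + a)) ?lerD2r// ?lerDl//.
  apply: leeD => //; apply: le_trans IH1 _.
  apply: ge0_subset_integral => //; first exact: measurable_funTS.
  by apply: subset_itvl; rewrite bnd_simp; lra.
have [|h _] := H n; first by rewrite n0 leqnn.
apply: le_trans h _; rewrite -(integral_period _ (X 1%N + a) pf mf f0).
apply: ge0_subset_integral => //; first exact: measurable_funTS.
by apply: subset_itvl; rewrite bnd_simp; lra.
Qed.

End PeriodIntegrals.

Section Averages.
Context {R : realType}.
Notation mu := (@lebesgue_measure R).
Implicit Types (p d : R).

Lemma le_poweR (x y : \bar R) p : 0 <= p -> (0 <= x)%E -> (x <= y)%E ->
  (x `^ p <= y `^ p)%E.
Proof.
move=> p0 x0 xy; apply: gt0_ler_poweR => //; rewrite in_itv/= leey andbT//.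
exact: le_trans xy.
Qed.

Lemma Rintegral_le_abs (D : set R) (u : R -> R) : measurable D -> measurable_fun D u ->
  (`|\int[mu]_(t in D) u t|%:E <= \int[mu]_(t in D) `|u t|%:E)%E.
Proof.
move=> mD mu_; rewrite /Rintegral.
apply: (@le_trans _ _ `|\int[mu]_(t in D) (u t)%:E|%E).
  by case: (\int[mu]_(t in D) (u t)%:E)%E => [x| |] /=; rewrite ?normr0 ?lexx ?leey.
apply: (le_trans (le_abse_integral _ _ _)) => //.
exact/measurable_EFinP.
Qed.

(** Holder's inequality against the indicator of [D]; for [p = 1], where the
    conjugate exponent is infinite, it is an equality. *)
Lemma integral_poweR_le p d (D : set R) (u : R -> R) : 1 <= p -> 0 < d ->
  measurable D -> mu D = d%:E -> measurable_fun setT u ->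
  ((\int[mu]_(t in D) `|u t|%:E) `^ p <=
    (d `^ (p - 1))%:E * \int[mu]_(t in D) (`|u t| `^ p)%:E)%E.
Proof.
rewrite le_eqVlt => /predU1P[<-|p1] d0 mD muD mu_.
  rewrite subrr powRr0 mul1e poweRe1; last by apply: integral_ge0.
  by under [leRHS]eq_integral do rewrite powRr1//.
have p0 : 0 < p by apply: lt_trans p1.
(* the exponent conjugate to [p] *)
pose q := p / (p - 1).
have q0 : 0 < q by rewrite divr_gt0// subr_gt0.
have pq : p^-1 + q^-1 = 1 by rewrite /q invf_div; field; rewrite gt_eqF.
have mf : measurable_fun setT (u \_ D).
  by apply/(measurable_restrictT _ mD); exact: measurable_funTS.
have mg : measurable_fun setT (\1_D : R -> R) by exact: measurable_indic.
have := @hoelder _ _ R mu (u \_ D) (\1_D) p q mf mg p0 q0 pq.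
rewrite Lnorm1 unlock.
have -> : (\int[mu]_x `|(EFin \o (u \_ D \* \1_D)%R) x| = \int[mu]_(t in D) `|u t|%:E)%E.
  rewrite [RHS]integral_mkcond; apply: eq_integral => x _ /=.
  rewrite !patchE indicE; case: ifP => _; first by rewrite mulr1.
  by rewrite mul0r normr0.
have -> : (\int[mu]_x `|(EFin \o u \_ D) x| `^ p = \int[mu]_(t in D) (`|u t| `^ p)%:E)%E.
  rewrite [RHS]integral_mkcond; apply: eq_integral => x _ /=.
  rewrite !patchE; case: ifP => _; first by [].
  by rewrite normr0 powR0// gt_eqF.
have -> : (\int[mu]_x `|(EFin \o (\1_D : R -> R)) x| `^ q = d%:E)%E.
  transitivity (\int[mu]_x (\1_D x)%:E)%E; last by rewrite integral_indic// setIT.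
  apply: eq_integral => x _ /=.
  rewrite indicE; case: (x \in D); first by rewrite normr1 powR1.
  by rewrite normr0 powR0// gt_eqF.
set A := (\int[mu]_(t in D) `|u t|%:E)%E; set B := (\int[mu]_(t in D) _)%E.
have A0 : (0 <= A)%E by exact: integral_ge0.
have B0 : (0 <= B)%E by apply: integral_ge0 => t _; rewrite lee_fin powR_ge0.
move=> AB.
apply: (@le_trans _ _ ((B `^ p^-1 * d%:E `^ q^-1) `^ p)%E).
  by apply: le_poweR => //; exact: ltW.
rewrite poweRM ?poweR_ge0// -!poweRrM mulVf ?gt_eqF// poweRe1// muleC.
rewrite poweR_EFin; rewrite (_ : q^-1 * p = p - 1)// /q invf_div.
by rewrite divfK// gt_eqF.
Qed.

Definition avg d (u : R -> R) : R := d^-1 * \int[mu]_(t in `[0, d]) u t.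

Lemma lebesgue_measure_0d d : 0 < d -> mu `[0, d]%classic = d%:E.
Proof. by move=> d0; rewrite lebesgue_measure_itv/= lte_fin d0 oppr0 adde0. Qed.

Lemma integral_cst_0d d (M : \bar R) : 0 < d ->
  (\int[mu]_(_ in `[0%R, d]) M = M * d%:E)%E.
Proof.
by move=> d0; rewrite integral_cst//; congr (_ * _)%E; exact: lebesgue_measure_0d.
Qed.

Lemma avg_powR p d (u : R -> R) : 1 <= p -> 0 < d -> measurable_fun setT u ->
  ((`|avg d u| `^ p)%:E <= d^-1%:E * \int[mu]_(t in `[0%R, d]) (`|u t| `^ p)%:E)%E.
Proof.
move=> p1 d0 mu_; have p0 : 0 < p by apply: lt_le_trans p1.
have h1 := @Rintegral_le_abs `[0, d]%classic u (measurable_itv _) (measurable_funTS mu_).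
have h2 := integral_poweR_le p d _ u p1 d0 (measurable_itv _) (lebesgue_measure_0d d d0) mu_.
rewrite /avg normrM (ger0_norm (_ : 0 <= d^-1)) ?invr_ge0 ?(ltW d0)//.
rewrite powRM ?invr_ge0 ?(ltW d0)// EFinM.
apply: (@le_trans _ _ ((d^-1 `^ p)%:E * ((d `^ (p - 1))%:E * \int[mu]_(t in `[0%R, d]) (`|u t| `^ p)%:E))%E).
  rewrite lee_pmul2l//; last by rewrite lte_fin powR_gt0// invr_gt0.
  rewrite -[leLHS]poweR_EFin; apply: le_trans h2.
  by apply: le_poweR => //; exact: ltW.
rewrite muleA -EFinM -(powR_inv1 (ltW d0)) -powRrM -powRD; last first.
  by rewrite (gt_eqF d0) implybT.
by rewrite (_ : -1 * p + (p - 1) = -1)//; ring.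
Qed.

Lemma tonelli_sets (A B : set R) (G : R * R -> \bar R) : measurable A -> measurable B ->
  measurable_fun setT G -> (forall z, 0 <= G z)%E ->
  (\int[mu]_(x in A) \int[mu]_(t in B) G (x, t) =
   \int[mu]_(t in B) \int[mu]_(x in A) G (x, t))%E.
Proof.
move=> mA mB mG G0.
pose H := G \_ (A `*` B).
have mH : measurable_fun setT H.
  by apply/(measurable_restrictT _ (measurableX mA mB)); exact: measurable_funTS.
have H0 z : (0 <= H z)%E by rewrite /H patchE; case: ifP.
have := @fubini_tonelli _ _ _ _ R mu mu H mH H0.
have -> : (\int[mu]_x \int[mu]_y H (x, y) = \int[mu]_(x in A) \int[mu]_(t in B) G (x, t))%E.
  rewrite [RHS]integral_mkcond; apply: eq_integral => x _; rewrite patchE; case: ifPn => xA.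
    rewrite [RHS]integral_mkcond; apply: eq_integral => t _.
    by rewrite /H !patchE in_setX /= xA.
  by apply: integral0_eq => t _; rewrite /H patchE in_setX /= (negbTE xA).
move=> ->.
rewrite [RHS]integral_mkcond; apply: eq_integral => t _; rewrite patchE; case: ifPn => tB.
  rewrite [RHS]integral_mkcond; apply: eq_integral => x _.
  by rewrite /H !patchE in_setX /= tB andbT.
by apply: integral0_eq => x _; rewrite /H patchE in_setX /= (negbTE tB) andbF.
Qed.

Lemma measurable_integral_snd (B : set R) (G : R * R -> \bar R) : measurable B ->
  measurable_fun setT G -> (forall z, 0 <= G z)%E ->
  measurable_fun setT (fun x => \int[mu]_(t in B) G (x, t))%E.
Proof.
move=> mB mG G0.
pose H := G \_ (setT `*` B).
have mH : measurable_fun setT H.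
  by apply/(measurable_restrictT _ (measurableX measurableT mB)); exact: measurable_funTS.
have H0 z : (0 <= H z)%E by rewrite /H patchE; case: ifP.
have := @measurable_fun_fubini_tonelli_F _ _ _ _ R mu H mH H0.
rewrite (_ : fubini_F mu H = fun x => \int[mu]_(t in B) G (x, t))%E//.
apply/funext => x; rewrite /fubini_F [RHS]integral_mkcond; apply: eq_integral => t _.
by rewrite /H !patchE in_setX /= in_setT.
Qed.

Lemma measurable_avg d (F : R * R -> R) : measurable_fun setT F ->
  measurable_fun setT (fun x => avg d (fun t => F (x, t))).
Proof.
move=> mF; apply: measurable_funM => //.
have mEF : measurable_fun setT (EFin \o F) by exact/measurable_EFinP.
rewrite (_ : (fun x => _) = fine \o (fun x => \int[mu]_(t in `[0%R, d]) (EFin \o F)^\+%E (x, t) - \int[mu]_(t in `[0%R, d]) (EFin \o F)^\-%E (x, t))%E); last first.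
  apply/funext => x /=; rewrite /Rintegral integralE; congr (fine (_ - _)); apply: eq_integral => t _; by rewrite ?funeposE ?funenegE.
apply: measurableT_comp; first exact: (fine_measurable measurableT).
apply: emeasurable_funB; apply: measurable_integral_snd => //.
  exact: measurable_funepos.
exact: measurable_funeneg.
Qed.

(** Convexity at each point, then Tonelli: an average of functions of norm at
    most [M] has norm at most [M]. *)
Lemma avg_contraction p d (F : R * R -> R) (M : \bar R) : 1 <= p -> 0 < d ->
  measurable_fun setT F ->
  (forall t, 0 <= t <= d -> (\int[mu]_(x in `[0%R, 1%R[) (`|F (x, t)| `^ p)%:E <= M)%E) ->
  (\int[mu]_(x in `[0%R, 1%R[) (`|avg d (fun t => F (x, t))| `^ p)%:E <= M)%E.
Proof.
move=> p1 d0 mF HM; have p0 : 0 < p by apply: lt_le_trans p1.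
have M0 : (0 <= M)%E.
  apply: le_trans (HM 0 _); last by rewrite lexx ltW.
  by apply: integral_ge0 => x _; rewrite lee_fin powR_ge0.
pose G z := (`|F z| `^ p)%:E.
have mG : measurable_fun setT G.
  apply/measurable_EFinP; apply: (measurableT_comp (measurable_powR p)).
  exact: measurableT_comp.
have G0 z : (0 <= G z)%E by rewrite lee_fin powR_ge0.
have mGs : measurable_fun setT (fun z : R * R => G (z.2, z.1)).
  apply: (measurableT_comp mG); exact: measurable_swap.
apply: (@le_trans _ _ (\int[mu]_(x in `[0%R, 1%R[) (d^-1%:E * \int[mu]_(t in `[0%R, d]) G (x, t)))%E).
  apply: ge0_le_integral.
  - exact: measurable_itv.
  - by move=> x _; rewrite lee_fin powR_ge0.
  - apply: measurable_funTS; apply/measurable_EFinP.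
    apply: (measurableT_comp (measurable_powR p)).
    apply: measurableT_comp => //; exact: measurable_avg.
  - apply: measurable_funTS; apply: measurable_funeM.
    exact: measurable_integral_snd.
  - move=> x _; apply: avg_powR => //.
    exact: (measurableT_comp mF (pair1_measurable x)).
rewrite ge0_integralZl//; last 3 first.
- apply: measurable_funTS; exact: measurable_integral_snd.
- by move=> x _; apply: integral_ge0.
- by rewrite lee_fin invr_ge0 ltW.
rewrite tonelli_sets//.
have K : (\int[mu]_(t in `[0%R, d]) \int[mu]_(x in `[0%R, 1%R[) G (x, t) <= \int[mu]_(t in `[0%R, d]) M)%E.
  apply: ge0_le_integral => //.
  - by move=> t _; apply: integral_ge0.
  - apply: measurable_funTS; exact: (measurable_integral_snd _ (fun z : R * R => G (z.2, z.1))).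
rewrite integral_cst_0d// in K.
apply: (@le_trans _ _ (d^-1%:E * (M * d%:E))%E).
  by rewrite lee_pmul2l// lte_fin invr_gt0.
by rewrite muleCA -EFinM mulVf ?mule1// gt_eqF.
Qed.

End Averages.

(** * Periodic Borel functions and sampled norms *)

Section RealClass.
Context {R : realType}.
Notation mu := (@lebesgue_measure R).
Implicit Types (p d : R) (u v : R -> R).

Definition toC u : R -> R[i] := fun x => (u x)%:C%C.

Definition Pint p u := (\int[mu]_(x in `[0%R, 1%R[) (`|u x| `^ p)%:E)%E.

Lemma measurable_abs_powR p dd (T : measurableType dd) (u : T -> R) :
  measurable_fun setT u -> measurable_fun setT (fun x => (`|u x| `^ p)%:E).
Proof.
move=> mu_; apply/measurable_EFinP; apply: (measurableT_comp (measurable_powR p)).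
exact: measurableT_comp.
Qed.

Lemma Pint_ge0 p u : (0 <= Pint p u)%E.
Proof. by apply: integral_ge0 => x _; rewrite lee_fin powR_ge0. Qed.

Lemma Lp_norm_toC p u : measurable_fun setT u ->
  Lp_norm p (toC u) = (Pint p u `^ p^-1)%E.
Proof.
move=> mu_; rewrite /Lp_norm /Pint -ge0_integral_leb; last 3 first.
- exact: measurable_itv.
- apply: measurable_funTS; exact: measurable_abs_powR.
- by move=> x _; rewrite lee_fin powR_ge0.
apply: (congr1 (fun z => poweR z p^-1)).
by apply: eq_integral => x _; rewrite normc_real.
Qed.

Lemma Lp_norm_toC_le p u (M : R) : 0 < p -> 0 <= M -> measurable_fun setT u ->
  (Lp_norm p (toC u) <= M%:E)%E <-> (Pint p u <= (M `^ p)%:E)%E.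
Proof.
move=> p0 M0 mu_; rewrite Lp_norm_toC//; split => h.
  rewrite -poweR_EFin -[leLHS](poweRe1 (Pint_ge0 p u)) -(mulVf (lt0r_neq0 p0)).
  rewrite poweRrM; apply: le_poweR => //; [exact: ltW|exact: poweR_ge0].
rewrite -(powRr1 M0) -(divff (lt0r_neq0 p0)) powRrM -poweR_EFin.
by apply: le_poweR => //; [rewrite invr_ge0 ltW|exact: Pint_ge0].
Qed.

(** Periodic functions of Lp with real values.  They are Borel, so that
    [(x, t) |-> u (x + t)] is jointly measurable and Tonelli applies. *)
Variant RLp p u : Prop :=
  IsRLp of (forall x, u (x + 1) = u x) & measurable_fun setT u & Lp p (toC u).

Definition rnorm p u : R := cnorm p (toC u).

Lemma rnormE p u : rnorm p u = cnorm p (toC u).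
Proof. by []. Qed.

Lemma cnorm_fine p (f : R -> R[i]) : fine (Lp_norm p f) = cnorm p f.
Proof. by []. Qed.

Lemma lmeas_toC u : measurable_fun setT u -> lmeas (toC u).
Proof. by move=> mu_; apply: lmeas_real; exact: lebesgue_measurableW. Qed.

Lemma RLpI p u (M : R) : 0 < p -> 0 <= M -> (forall x, u (x + 1) = u x) ->
  measurable_fun setT u -> (Pint p u <= (M `^ p)%:E)%E -> RLp p u /\ rnorm p u <= M.
Proof.
move=> p0 M0 pu mu_ /Lp_norm_toC_le h; have {}h := h p0 M0 mu_.
split; last exact: cnorm_le.
split => //; apply: LpE h; exact: lmeas_toC.
Qed.

Lemma RLp_Pint p u : 0 < p -> RLp p u -> (Pint p u = (rnorm p u `^ p)%:E)%E.
Proof.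
move=> p0 [_ mu_ Lu]; rewrite -poweR_EFin -cnormE// Lp_norm_toC// -poweRrM.
by rewrite mulVf ?gt_eqF// poweRe1// Pint_ge0.
Qed.

Lemma toCD u v : toC (fun x => u x + v x) = fun x => toC u x + toC v x.
Proof. by apply/funext => x; rewrite /toC rmorphD. Qed.

Lemma toCZ (c : R) u : toC (fun x => c * u x) = fun x => c%:C%C * toC u x.
Proof. by apply/funext => x; rewrite /toC rmorphM. Qed.

Lemma rnorm_ge0 p u : 0 <= rnorm p u.
Proof. exact: cnorm_ge0. Qed.

Lemma RLpD p u v : 1 <= p -> RLp p u -> RLp p v -> RLp p (fun x => u x + v x).
Proof.
move=> p1 [pu mu_ Lu] [pv mv Lv]; split.
- by move=> x; rewrite pu pv.
- exact: measurable_funD.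
- rewrite toCD; exact: LpD.
Qed.

Lemma rnormD p u v : 1 <= p -> RLp p u -> RLp p v ->
  rnorm p (fun x => u x + v x) <= rnorm p u + rnorm p v.
Proof. by move=> p1 [_ _ Lu] [_ _ Lv]; rewrite /rnorm toCD; exact: cnormD. Qed.

Lemma RLpZ p (c : R) u : 1 <= p -> RLp p u -> RLp p (fun x => c * u x).
Proof.
move=> p1 [pu mu_ Lu]; split.
- by move=> x; rewrite pu.
- exact: measurable_funM.
- rewrite toCZ; exact: LpZ.
Qed.

Lemma rnormZ p (c : R) u : 1 <= p -> RLp p u ->
  rnorm p (fun x => c * u x) = `|c| * rnorm p u.
Proof. by move=> p1 [_ _ Lu]; rewrite /rnorm toCZ cnormZ// normc_real. Qed.

Lemma RLp0 p : 1 <= p -> RLp p (fun=> 0).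
Proof.
move=> p1; split => //; rewrite (_ : toC _ = fun=> 0); first exact: Lp0.
by apply/funext => x; rewrite /toC rmorph0.
Qed.

Lemma rnorm0 p : 1 <= p -> rnorm p (fun=> 0) = 0.
Proof.
move=> p1; rewrite /rnorm (_ : toC _ = fun=> 0); first exact: cnorm0.
by apply/funext => x; rewrite /toC rmorph0.
Qed.

Lemma RLp_sum p (I : Type) (r : seq I) (P : pred I) (F : I -> R -> R) : 1 <= p ->
  (forall i, P i -> RLp p (F i)) -> RLp p (fun x => \sum_(i <- r | P i) F i x).
Proof.
move=> p1 LF; elim: r => [|i r IH].
  by under eq_fun do rewrite big_nil; exact: RLp0.
under eq_fun do rewrite big_cons.
case: (boolP (P i)) => Pi; last exact: IH.
by apply: (RLpD p (F i) _ p1 _ IH); exact: LF.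
Qed.

Lemma rnorm_sum p (I : Type) (r : seq I) (P : pred I) (F : I -> R -> R) : 1 <= p ->
  (forall i, P i -> RLp p (F i)) ->
  rnorm p (fun x => \sum_(i <- r | P i) F i x) <= \sum_(i <- r | P i) rnorm p (F i).
Proof.
move=> p1 LF; elim: r => [|i r IH].
  by under eq_fun do rewrite big_nil; rewrite big_nil rnorm0.
under eq_fun do rewrite big_cons.
rewrite big_cons; case: (boolP (P i)) => Pi; last exact: IH.
apply: le_trans (rnormD p (F i) (fun x => \sum_(i <- r | P i) F i x) p1 _ _) _.
- exact: LF.
- exact: RLp_sum.
- by rewrite lerD2l.
Qed.

Lemma RLp_shift p u a : 1 <= p -> RLp p u ->
  RLp p (fun x => u (x + a)) /\ rnorm p (fun x => u (x + a)) <= rnorm p u.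
Proof.
move=> p1 Ru; have p0 : 0 < p by apply: lt_le_trans p1.
case: (Ru) => pu mu_ Lu.
apply: RLpI => //.
- exact: rnorm_ge0.
- by move=> x; rewrite addrAC pu.
- by apply: (measurableT_comp mu_); exact: measurable_funD.
rewrite -RLp_Pint// /Pint (@integral_period_shift R (fun x => (`|u x| `^ p)%:E) a)//.
- by move=> x; rewrite pu.
- exact: measurable_abs_powR.
Qed.

Lemma RLp_avg p d (F : R * R -> R) (M : R) : 1 <= p -> 0 < d -> measurable_fun setT F ->
  (forall t x, F (x + 1, t) = F (x, t)) ->
  (forall t, 0 <= t <= d -> RLp p (fun x => F (x, t)) /\ rnorm p (fun x => F (x, t)) <= M) ->
  RLp p (fun x => avg d (fun t => F (x, t))) /\ rnorm p (fun x => avg d (fun t => F (x, t))) <= M.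
Proof.
move=> p1 d0 mF pF HM; have p0 : 0 < p by apply: lt_le_trans p1.
have M0 : 0 <= M.
  by have [] := HM 0; rewrite ?lexx ?(ltW d0)// => _; apply: le_trans; exact: rnorm_ge0.
apply: RLpI => //.
- by move=> x; congr avg; apply/funext => t; exact: pF.
- exact: measurable_avg.
apply: avg_contraction => // t td; have [Rt Mt] := HM t td.
have := RLp_Pint p _ p0 Rt; rewrite /Pint => ->.
by rewrite lee_fin ge0_ler_powR ?nnegrE ?rnorm_ge0// ltW.
Qed.

Definition smear d (c : R) u : R -> R := fun x => avg d (fun t => u (x + c * t)).

Lemma measurable_smear_arg u c : measurable_fun setT u ->
  measurable_fun setT (fun z : R * R => u (z.1 + c * z.2)).
Proof.
move=> mu_; apply: (measurableT_comp mu_); apply: measurable_funD => //.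
by apply: measurable_funM.
Qed.

Lemma RLp_smear p d c u : 1 <= p -> 0 < d -> RLp p u ->
  RLp p (smear d c u) /\ rnorm p (smear d c u) <= rnorm p u.
Proof.
move=> p1 d0 Ru; case: (Ru) => pu mu_ Lu.
apply: (@RLp_avg p d (fun z => u (z.1 + c * z.2)) (rnorm p u) p1 d0).
- exact: measurable_smear_arg.
- by move=> t x /=; rewrite addrAC pu.
- by move=> t _ /=; exact: RLp_shift.
Qed.

End RealClass.

Section SampledNorm.
Context {R : realType}.
Notation mu := (@lebesgue_measure R).
Implicit Types (p d : R) (u v : R -> R) (f g : R -> R[i]) (X : nat -> R) (n : nat).

Lemma lp_norm_ge0 p n X f : 0 <= lp_norm p n X f.
Proof. exact: powR_ge0. Qed.

Lemma sum_powR_ge0 p n X f : 0 <= n%:R^-1 * \sum_(1 <= k < n.+1) normc (f (X k)) `^ p.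
Proof. by rewrite mulr_ge0 ?invr_ge0// sumr_ge0// => k _; exact: powR_ge0. Qed.

Lemma lp_norm_le p n X f (M : R) : 0 < p -> 0 <= M ->
  n%:R^-1 * \sum_(1 <= k < n.+1) normc (f (X k)) `^ p <= M `^ p ->
  lp_norm p n X f <= M.
Proof.
move=> p0 M0 h; rewrite /lp_norm.
have -> : M = (M `^ p) `^ p^-1 by rewrite -powRrM divff ?powRr1// lt0r_neq0.
by apply: ge0_ler_powR => //; rewrite ?nnegrE ?powR_ge0 ?sum_powR_ge0// invr_ge0 ltW.
Qed.

Lemma lp_norm_powR p n X f : 0 < p ->
  lp_norm p n X f `^ p = n%:R^-1 * \sum_(1 <= k < n.+1) normc (f (X k)) `^ p.
Proof.
by move=> p0; rewrite /lp_norm -powRrM mulVf ?gt_eqF// powRr1// sum_powR_ge0.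
Qed.

(** Minkowski's inequality for the counting measure on [nat], the sampled
    values being continued by zeros. *)
Lemma lp_norm_triangle p n X f g : 1 <= p -> (0 < n)%N ->
  lp_norm p n X (fun x => f x + g x) <= lp_norm p n X f + lp_norm p n X g.
Proof.
move=> p1 n0; have p0 : 0 < p by apply: lt_le_trans p1.
pose a f k : R := if (k < n)%N then normc (f (X k.+1)) else 0.
have Ea (h : R -> R[i]) : ('N[(@counting nat R)]_p%:E [EFin \o a h] =
    ((\sum_(1 <= k < n.+1) normc (h (X k)) `^ p) `^ p^-1)%:E)%E.
  rewrite Lnorm_counting// -poweR_EFin; apply: (congr1 (fun z => poweR z p^-1)).
  rewrite (nneseries_split 0 n); last by move=> k; rewrite lee_fin powR_ge0.
  rewrite add0n ereal_series_cond eseries0 ?adde0; last first.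
    by move=> k _ /andP[nk _]; rewrite /a /= ltnNge nk /= normr0 powR0// gt_eqF.
  rewrite big_add1 /= -sumEFin !big_mkord; apply: eq_bigr => k _.
  by rewrite /a /= ltn_ord ger0_norm// normc_ge0.
have ma (h : R -> R[i]) : measurable_fun setT (a h) by [].
have := @minkowski_EFin _ nat R (@counting nat R) (a f) (a g) p (ma f) (ma g) p1.
rewrite !Ea -EFinD => hM.
have S0 (h : R -> R[i]) : 0 <= \sum_(1 <= k < n.+1) normc (h (X k)) `^ p.
  by apply: sumr_ge0 => k _; exact: powR_ge0.
have h2 : (\sum_(1 <= k < n.+1) normc (f (X k) + g (X k)) `^ p) `^ p^-1 <=
  (\sum_(1 <= k < n.+1) normc (f (X k)) `^ p) `^ p^-1 + (\sum_(1 <= k < n.+1) normc (g (X k)) `^ p) `^ p^-1.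
  rewrite -lee_fin; apply: le_trans hM.
  rewrite -(Ea (fun x => f x + g x)) !Lnorm_counting//.
  apply: le_poweR; first by rewrite invr_ge0 ltW.
    by apply: nneseries_ge0 => k _ _; rewrite lee_fin powR_ge0.
  apply: lee_nneseries => [k _ _|k _]; first by rewrite lee_fin powR_ge0.
  rewrite lee_fin; apply: ge0_ler_powR; rewrite ?nnegrE ?normr_ge0 ?(ltW p0)//.
  rewrite /= /a; case: ifP => _; last by rewrite addr0.
  by rewrite !ger0_norm ?addr_ge0 ?normc_ge0// le_normcD.
have E (h : R -> R[i]) : lp_norm p n X h =
    n%:R^-1 `^ p^-1 * (\sum_(1 <= k < n.+1) normc (h (X k)) `^ p) `^ p^-1.
  by rewrite /lp_norm powRM// invr_ge0.
by rewrite !E -mulrDr ler_wpM2l// powR_ge0.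
Qed.

Lemma lp_normZ p n X f (c : R[i]) : 0 < p ->
  lp_norm p n X (fun x => c * f x) = normc c * lp_norm p n X f.
Proof.
move=> p0; rewrite /lp_norm.
under eq_bigr do rewrite normcM powRM ?normc_ge0//.
rewrite -mulr_sumr mulrCA powRM ?powR_ge0 ?sum_powR_ge0//.
by rewrite -powRrM divff ?gt_eqF// powRr1// normc_ge0.
Qed.

Lemma lp_norm0 p n X : 0 < p -> lp_norm p n X (fun=> 0) = 0.
Proof.
move=> p0; rewrite /lp_norm big1 ?mulr0 ?powR0 ?invr_eq0 ?gt_eqF//.
by move=> k _; rewrite normc0 powR0// gt_eqF.
Qed.

Lemma lp_norm_sum p n X (I : Type) (r : seq I) (F : I -> R -> R[i]) : 1 <= p -> (0 < n)%N ->
  lp_norm p n X (fun x => \sum_(i <- r) F i x) <= \sum_(i <- r) lp_norm p n X (F i).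
Proof.
move=> p1 n0; have p0 : 0 < p by apply: lt_le_trans p1.
elim: r => [|i r IH].
  by under eq_fun do rewrite big_nil; rewrite big_nil lp_norm0.
under eq_fun do rewrite big_cons.
rewrite big_cons; apply: le_trans (lp_norm_triangle _ _ _ _ _ p1 n0) _.
by rewrite lerD2l.
Qed.

(** The discrete counterpart of [avg_contraction]. *)
Lemma lp_norm_avg p n X d (F : R * R -> R) (M : R) : 1 <= p -> (0 < n)%N -> 0 < d -> 0 <= M ->
  measurable_fun setT F ->
  (forall t, 0 <= t <= d -> lp_norm p n X (toC (fun x => F (x, t))) <= M) ->
  lp_norm p n X (toC (fun x => avg d (fun t => F (x, t)))) <= M.
Proof.
move=> p1 n0 d0 M0 mF HM; have p0 : 0 < p by apply: lt_le_trans p1.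
apply: lp_norm_le => //.
under eq_bigr do rewrite /toC normc_real.
have mFx x : measurable_fun setT (fun t => F (x, t)).
  exact: (measurableT_comp mF (pair1_measurable x)).
rewrite -lee_fin EFinM -sumEFin.
apply: (@le_trans _ _ (n%:R^-1%:E * \sum_(1 <= k < n.+1)
   (d^-1%:E * \int[mu]_(t in `[0%R, d]) (`|F (X k, t)| `^ p)%:E))%E).
  rewrite lee_pmul2l// ?lte_fin ?invr_gt0 ?ltr0n//.
  by apply: lee_sum => k _; exact: avg_powR.
rewrite -ge0_sume_distrr; last first.
  by move=> k _; apply: integral_ge0 => t _; rewrite lee_fin powR_ge0.
rewrite -ge0_integral_sum//; last first.
  by move=> k; apply: measurable_funTS; exact: (measurable_abs_powR p _ _ _ (mFx (X k))).
rewrite muleCA -ge0_integralZl//; last 2 first.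
- by apply: measurable_funTS; apply: emeasurable_sum => k; exact: (measurable_abs_powR p _ _ _ (mFx (X k))).
- by move=> t _; apply: sume_ge0 => k _; rewrite lee_fin powR_ge0.
apply: (@le_trans _ _ (d^-1%:E * \int[mu]_(t in `[0%R, d]) (M `^ p)%:E)%E); last first.
  rewrite integral_cst_0d// muleCA -EFinM mulVf ?gt_eqF//.
  by rewrite mulr1.
rewrite lee_pmul2l// ?lte_fin ?invr_gt0//.
apply: ge0_le_integral => //.
- by move=> t _; apply: mule_ge0 => //; apply: sume_ge0 => k _; rewrite lee_fin powR_ge0.
- apply: measurable_funTS; apply: measurable_funeM.
  by apply: emeasurable_sum => k; exact: (measurable_abs_powR p _ _ _ (mFx (X k))).
move=> t; rewrite /= in_itv/= => td.
rewrite sumEFin -EFinM lee_fin.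
have := HM t td; move=> h.
have : lp_norm p n X (toC (fun x => F (x, t))) `^ p <= M `^ p.
  by apply: ge0_ler_powR => //; rewrite ?nnegrE ?lp_norm_ge0// ltW.
rewrite lp_norm_powR//; under eq_bigr do rewrite /toC normc_real.
by [].
Qed.

(** The windows of length [c * d] starting at the nodes are disjoint modulo
    the period, so the integrals over them add up to at most one integral over
    the period. *)
Lemma lp_norm_smear p n X d c (a : R) u : 1 <= p -> (0 < n)%N -> 0 < d -> 0 < c ->
  (forall k, (1 <= k < n)%N -> X k + c * d <= X k.+1) -> X n + c * d <= X 1%N + 1 ->
  n%:R * (c * d) <= 1 -> RLp p u ->
  lp_norm p n X (toC (fun x => smear d c u (x + a))) <= (n%:R * (c * d))^-1 * rnorm p u.
Proof.
move=> p1 n0 d0 c0 Xs Xn k1 Ru; have p0 : 0 < p by apply: lt_le_trans p1.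
have [pu mu_ Lu] := Ru.
have n0R : 0 < n%:R :> R by rewrite ltr0n.
set kap := n%:R * (c * d).
have kap0 : 0 < kap by rewrite !mulr_gt0.
apply: lp_norm_le => //; first by rewrite mulr_ge0 ?rnorm_ge0// invr_ge0 ltW.
rewrite powRM ?rnorm_ge0 ?invr_ge0 ?(ltW kap0)//.
(* as [kap <= 1], its inverse is below the [p]-th power of its inverse *)
apply: (@le_trans _ _ (kap^-1 * rnorm p u `^ p)); last first.
  rewrite ler_wpM2r ?powR_ge0//; apply: le1r_powR => //.
  by rewrite invf_ge1.
rewrite -lee_fin EFinM -sumEFin EFinM -(RLp_Pint p u p0 Ru).
under eq_bigr do rewrite /toC normc_real.
pose f t := (`|u t| `^ p)%:E.
have mf : measurable_fun setT f by exact: measurable_abs_powR.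
have f0 t : (0 <= f t)%E by rewrite lee_fin powR_ge0.
have pf x : f (x + 1) = f x by rewrite /f pu.
apply: (@le_trans _ _ (n%:R^-1%:E * \sum_(1 <= k < n.+1)
   ((c * d)^-1%:E * \int[mu]_(t in `[0%R, (c * d)%R[) f ((X k + a) + t)%R))%E).
  rewrite lee_pmul2l// ?lte_fin ?invr_gt0//.
  apply: lee_sum => k _.
  have mg : measurable_fun setT (fun t => u (X k + a + c * t)).
    by apply: (measurableT_comp mu_); apply: measurable_funD => //; exact: measurable_funM.
  apply: le_trans (avg_powR p d _ p1 d0 mg) _.
  rewrite -(@integral_itv_bndo_bndc _ (BLeft 0) d); last first.
    by apply: measurable_funTS; exact: measurable_abs_powR.
  have mf2 : measurable_fun setT (fun t => f (X k + a + t)).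
    by apply: (measurableT_comp mf); exact: measurable_funD.
  rewrite [leRHS](_ : _ = ((c * d)^-1%:E * (c%:E *
     \int[mu]_(t in affine 0 c @^-1` `[0%R, (c * d)%R[) f (X k + a + affine 0 c t)%R))%E); last first.
    congr (_ * _)%E.
    by rewrite (@ge0_integral_affine R 0 c (fun t => f (X k + a + t)))//; exact: measurable_funTS.
  rewrite muleA -EFinM invfM mulrAC mulVf ?gt_eqF// mul1r.
  rewrite (_ : affine 0 c @^-1` `[0, c * d[ = `[0, d[%classic); last first.
    apply/seteqP; split => t /=; rewrite !in_itv/= /affine add0r;
      by rewrite pmulr_rge0// ltr_pM2l.
  by rewrite le_eqVlt; apply/orP; left; apply/eqP; congr (_ * _)%E; apply: eq_integral => t _; rewrite /f /affine add0r.
rewrite -ge0_sume_distrr; last by move=> k _; apply: integral_ge0.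
rewrite muleA -EFinM -invfM -/kap.
rewrite lee_pmul2l// ?lte_fin ?invr_gt0//.
by apply: sum_windows => //; rewrite mulr_ge0 ?ltW.
Qed.

End SampledNorm.

(** * Finite differences and regularity of window averages *)

Section Differences.
Context {R : realType} {V : nzRingType}.
Implicit Types (u v : R -> V) (h a x : R).

Definition fdiff h u : R -> V := fun x => u (x + h) - u x.

Lemma iter_fdiffE k h u x : iter k (fdiff h) u x =
  \sum_(nu < k.+1) ('C(k, nu))%:R * (-1) ^+ nu * u (x + (k - nu)%N%:R * h).
Proof.
elim: k x => [|k IH] x.
  by rewrite big_ord1 /= bin0 expr0 !mul1r subn0 mul0r addr0.
rewrite iterS /fdiff !IH [RHS]big_ord_recl /= bin0 expr0 !mul1r subn0.
under [in RHS]eq_bigr => i _.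
  rewrite /bump /= add1n binS natrD !mulrDl subSS exprS.
  over.
rewrite big_split /= addrA; congr (_ + _); last first.
  rewrite -sumrN; apply: eq_bigr => i _.
  by rewrite !mulN1r !mulrN !mulNr.
rewrite big_ord_recl /= bin0 expr0 !mul1r subn0; congr (_ + _).
  by congr u; rewrite -natr1; ring.
rewrite [RHS]big_ord_recr /= bin_small// !mul0r addr0.
apply: eq_bigr => i _; rewrite /bump /= add1n exprS; congr (_ * _ * _).
rewrite -(subnSK (ltn_ord i)) -natr1.
by congr u; ring.
Qed.

Lemma iter_fdiff0 k u : (0 < k)%N -> iter k (fdiff 0) u = fun=> 0.
Proof.
case: k => // k _; apply/funext => x; by rewrite iterS /fdiff addr0 subrr.
Qed.

End Differences.

Lemma finite_diffE {R : realType} s (h : R) (f : R -> R[i]) :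
  finite_diff s h f = iter s (fdiff h) f.
Proof. by apply/funext => x; rewrite iter_fdiffE. Qed.

Section LocalIntegrability.
Context {R : realType}.
Notation mu := (@lebesgue_measure R).
Implicit Types (p d c : R) (u v : R -> R).

Definition locint u := forall a b : R, mu.-integrable `[a, b] (EFin \o u).

Lemma locint_continuous u : continuous u -> locint u.
Proof.
move=> cu a b; apply: continuous_compact_integrable; first exact: segment_compact.
exact: continuous_subspaceT.
Qed.

Lemma locint_affine u a c : 0 < c -> measurable_fun setT u -> locint u ->
  locint (fun x => u (a + c * x)).
Proof.
move=> c0 mu_ lu x y; have /integrableP[_ fin] := lu (a + c * x) (a + c * y).
have mg : measurable_fun setT (fun x => u (a + c * x)).
  exact: (measurableT_comp mu_ (measurable_affine a c)).
apply/integrableP; split; first by apply/measurable_EFinP; exact: measurable_funTS.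
have := @ge0_integral_affine R a c (fun t => `|u t|%:E) `[a + c * x, a + c * y]%classic c0.
rewrite (_ : affine a c @^-1` _ = `[x, y]%classic); last first.
  by apply/seteqP; split => t /=; rewrite !in_itv/= /affine !lerD2l !ler_pM2l.
move=> /(_ _ _ _) E; move: fin; rewrite E//; last first.
  by apply/measurable_EFinP/measurableT_comp => //; exact: measurable_funTS.
set I := (\int[mu]_(t in `[x, y]) _)%E => h; suff: (I < +oo)%E by [].
move: h; have : (0 <= I)%E by exact: integral_ge0.
case: I => [r _ _|_|//]; first exact: ltry.
by rewrite gt0_muley ?lte_fin// ltxx.
Qed.

Lemma Rintegral_affine u a c x y : 0 < c -> measurable_fun setT u -> locint u ->
  \int[mu]_(t in `[a + c * x, a + c * y]) u t =
  c * \int[mu]_(t in `[x, y]) u (a + c * t).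
Proof.
move=> c0 mu_ lu.
have pre : affine a c @^-1` `[a + c * x, a + c * y] = `[x, y]%classic.
  by apply/seteqP; split => t /=; rewrite !in_itv/= /affine !lerD2l !ler_pM2l.
rewrite /Rintegral.
have := lu (a + c * x) (a + c * y); set D := `[_, _]%classic => luD.
have mE : measurable_fun D (EFin \o u) by exact/measurable_EFinP/measurable_funTS.
have E1 : (\int[mu]_(t in D) (u t)%:E =
   c%:E * \int[mu]_(t in `[x, y]) (u (a + c * t)%R)%:E)%E.
  rewrite integralE [X in (_ = _ * X)%E]integralE.
  have luA := locint_affine u a c c0 mu_ lu x y.
  set A := (X in (_ = _ * (X - _))%E); set B := (X in (_ = _ * (_ - X))%E).
  have fA : A \is a fin_num by apply: (integrable_pos_fin_num _ luA); exact: measurable_itv.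
  have cfin : c%:E \is a fin_num by [].
  rewrite (muleBr cfin (fin_num_adde_defr (- B)%E fA)) /A /B.
  congr (_ - _)%E.
    rewrite (@ge0_integral_affine R a c _ D c0)//; [|exact: measurable_itv|exact: measurable_funepos].
    by rewrite pre; congr (_ * _)%E; apply: eq_integral => t _; rewrite ?funeposE.
  rewrite (@ge0_integral_affine R a c _ D c0)//; [|exact: measurable_itv|exact: measurable_funeneg].
  by rewrite pre; congr (_ * _)%E; apply: eq_integral => t _; rewrite ?funenegE.
by rewrite E1 fineM//; apply: integrable_fin_num => //; exact: locint_affine.
Qed.

Lemma RLp_locint p u : 1 <= p -> RLp p u -> locint u.
Proof.
move=> p1 Ru a b; have p0 : 0 < p by apply: lt_le_trans p1.
have [pu mu_ Lu] := Ru.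
pose f t := `|u t|%:E.
have mf : measurable_fun setT f by apply/measurable_EFinP; exact: measurableT_comp.
have f0 t : (0 <= f t)%E by rewrite lee_fin.
have pf x : f (x + 1) = f x by rewrite /f pu.
have I1 : (\int[mu]_(t in `[0%R, 1%R[) f t < +oo)%E.
  have m01 : mu `[0, 1[%classic = 1%:E.
    by rewrite lebesgue_measure_itv/= lte_fin ltr01 oppr0 adde0.
  have := integral_poweR_le p 1 _ u p1 ltr01 (measurable_itv _) m01 mu_.
  rewrite powR1 mul1e; have := RLp_Pint p u p0 Ru; rewrite /Pint => ->.
  rewrite -/(\int[mu]_(t in `[0%R, 1%R[) f t)%E.
  case: (\int[mu]_(t in `[0%R, 1%R[) f t)%E => [r _|h|//]; first exact: ltry.
  by move: h; rewrite poweRyr ?gt_eqF// leye_eq.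
have In (n : nat) : (\int[mu]_(t in `[a, (a + n%:R)%R[) f t < +oo)%E.
  elim: n => [|n IH]; first by rewrite addr0 set_itvco0 integral_set0.
  rewrite (@integral_split _ _ a (a + n%:R))// ?lerDl// ?lerD2l ?ler_nat//.
  rewrite lte_add_pinfty// -natr1 addrA integral_period//.
apply/integrableP; split; first by apply/measurable_EFinP; exact: measurable_funTS.
have [n hn] : exists n : nat, b - a < n%:R.
  exists (Num.truncn `|b - a|).+1; apply: le_lt_trans (ler_norm _) _.
  exact: truncnS_gt.
apply: le_lt_trans (In n).
apply: ge0_subset_integral => //; first exact: measurable_funTS.
move=> t /=; rewrite !in_itv/= => /andP[-> tb] /=; apply: le_lt_trans tb _; lra.
Qed.

Lemma smearE d c u x : 0 < d -> 0 < c -> measurable_fun setT u -> locint u ->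
  smear d c u x = (c * d)^-1 * \int[mu]_(t in `[x, x + c * d]) u t.
Proof.
move=> d0 c0 mu_ lu; rewrite /smear /avg.
have := Rintegral_affine u x c 0 d c0 mu_ lu; rewrite mulr0 addr0 => ->.
by rewrite invfM mulrA mulrAC; field; rewrite !gt_eqF.
Qed.

Lemma smear0 d u : 0 < d -> smear d 0 u = u.
Proof.
move=> d0; apply/funext => x; rewrite /smear /avg.
under eq_Rintegral do rewrite mul0r addr0.
rewrite Rintegral_cst//= (_ : mu _ = d%:E) /=; last exact: lebesgue_measure_0d.
by rewrite mulrCA mulVf ?mulr1// gt_eqF.
Qed.

(** Away from the base point [x - 1], a window integral is a difference of
    two values of one primitive. *)
Lemma window_primitive u (x L : R) : 0 < L -> locint u ->
  \forall y \near x, \int[mu]_(t in `[y, y + L]) u t =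
    parameterized_integral mu (x - 1) (y + L) u - parameterized_integral mu (x - 1) y u.
Proof.
move=> L0 lu; near=> y.
rewrite /parameterized_integral Rintegral_itvB; first last.
- by rewrite bnd_simp lerDl ltW.
- rewrite bnd_simp; near: y; exists 1 => //= z /=; rewrite ltr_distl; lra.
- exact: lu.
rewrite Rintegral_itv_obnd_cbnd//.
apply: integrableS (lu y (y + L)) => //; exact: subset_itv_oc_cc.
Unshelve. all: by end_near. Qed.

Lemma primitive_continuous u a x : a < x -> locint u ->
  {for x, continuous (fun y => parameterized_integral mu a y u)}.
Proof.
move=> ax lu.
have ab : a <= x + 1 by lra.
have := @parameterized_integral_continuous R a (x + 1) u ab (lu _ _).
have ax1 : a < x + 1 by lra.
move=> /(continuous_within_itvP _ ax1)[+ _ _]; apply.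
by rewrite in_itv/= ax; lra.
Qed.

Lemma smear_continuous d c u : 0 < d -> 0 < c -> measurable_fun setT u -> locint u ->
  continuous (smear d c u).
Proof.
move=> d0 c0 mu_ lu x.
have L0 : 0 < c * d by rewrite mulr_gt0.
rewrite (_ : smear d c u = fun y => (c * d)^-1 * \int[mu]_(t in `[y, y + c * d]) u t); last first.
  by apply/funext => y; exact: smearE.
have H := window_primitive u x (c * d) L0 lu.
apply: cvgM; first exact: cvg_cst.
have -> : \int[mu]_(t in `[x, x + c * d]) u t =
   parameterized_integral mu (x - 1) (x + c * d) u - parameterized_integral mu (x - 1) x u.
  exact: (nbhs_singleton H).
apply: (@cvg_trans _ ((fun y => parameterized_integral mu (x - 1) (y + c * d) u - parameterized_integral mu (x - 1) y u) @ x)).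
  apply: near_eq_cvg; apply: filterS H => y ->//.
have c2 : {for x, continuous (fun y => parameterized_integral mu (x - 1) y u)}.
  by apply: primitive_continuous => //; lra.
suff c1 : {for x, continuous (fun y => parameterized_integral mu (x - 1) (y + c * d) u)}.
  exact: (continuousB c1 c2).
apply: (@continuous_comp _ _ _ (fun y => y + c * d) (fun y => parameterized_integral mu (x - 1) y u)).
  by apply: cvgD; [exact: cvg_id|exact: cvg_cst].
by apply: primitive_continuous => //; lra.
Qed.

Lemma primitive_derive u (a x : R) : a < x -> continuous u ->
  is_derive x 1 (fun y => parameterized_integral mu a y u) (u x).
Proof.
move=> ax cu.
have xx1 : x < x + 1 by lra.
have [D E] := @continuous_FTC1_closed R u a x (x + 1) xx1 (locint_continuous u cu _ _) ax (cu x).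
by apply: DeriveDef; [exact: D|rewrite -derive1E; exact: E].
Qed.

(** The window moves with [x]: its end points contribute the two values of
    [u]. *)
Lemma smear_derive d c u (x : R) : 0 < d -> 0 < c -> continuous u ->
  is_derive x 1 (smear d c u) ((c * d)^-1 * fdiff (c * d) u x).
Proof.
move=> d0 c0 cu; have mu_ : measurable_fun setT u by exact: continuous_measurable_fun.
have lu := locint_continuous u cu.
have L0 : 0 < c * d by rewrite mulr_gt0.
rewrite (_ : smear d c u = fun y => (c * d)^-1 * \int[mu]_(t in `[y, y + c * d]) u t); last first.
  by apply/funext => y; exact: smearE.
have H := window_primitive u x (c * d) L0 lu.
have h1 : is_derive x 1 (fun y => parameterized_integral mu (x - 1) y u) (u x).
  by apply: primitive_derive => //; lra.
have h2 : is_derive (x + c * d) 1 (fun y => parameterized_integral mu (x - 1) y u) (u (x + c * d)).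
  by apply: primitive_derive => //; lra.
have h3 : is_derive x 1 (fun y => parameterized_integral mu (x - 1) (y + c * d) u) (u (x + c * d)).
  have hs : is_derive x 1 (shift (c * d) : R -> R) 1 by exact: is_derive_shift.
  have := @is_derive1_comp _ (fun y => parameterized_integral mu (x - 1) y u) (shift (c * d)) x _ _ h2 hs.
  by rewrite mulr1.
have h4 := is_deriveB h3 h1.
have h5 : is_derive x 1 (fun y => \int[mu]_(t in `[y, y + c * d]) u t) (fdiff (c * d) u x).
  by apply: near_eq_is_derive h4; apply: filterS H => y ->.
exact: (is_deriveZ (c * d)^-1 h5).
Qed.

End LocalIntegrability.

Section AverageAlgebra.
Context {R : realType}.
Notation mu := (@lebesgue_measure R).
Implicit Types (p d c a x : R) (u f g : R -> R).

Lemma locint_cst (k : R) : locint (cst k).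
Proof. by apply: locint_continuous => x; exact: cvg_cst. Qed.

Lemma integrable_scale f (D : set R) (k : R) : measurable D ->
  mu.-integrable D (EFin \o f) -> mu.-integrable D (EFin \o (fun t => k * f t)).
Proof.
move=> mD If; rewrite (_ : _ \o _ = fun t => (k%:E * (EFin \o f) t)%E); last first.
  by apply/funext => t /=; rewrite EFinM.
exact: integrableZl.
Qed.

Lemma avgB d f g : mu.-integrable `[0, d] (EFin \o f) ->
  mu.-integrable `[0, d] (EFin \o g) -> avg d (fun t => f t - g t) = avg d f - avg d g.
Proof. by move=> If Ig; rewrite /avg RintegralB// mulrBr. Qed.

Lemma avgZ d k f : mu.-integrable `[0, d] (EFin \o f) ->
  avg d (fun t => k * f t) = k * avg d f.
Proof. by move=> If; rewrite /avg RintegralZl// mulrCA. Qed.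

Lemma avg_sum d (I : Type) (r : seq I) (F : I -> R -> R) :
  (forall i, mu.-integrable `[0, d] (EFin \o F i)) ->
  mu.-integrable `[0, d] (EFin \o (fun t => \sum_(i <- r) F i t)) /\
  avg d (fun t => \sum_(i <- r) F i t) = \sum_(i <- r) avg d (F i).
Proof.
move=> IF; elim: r => [|i r [IH1 IH2]].
  have -> : (fun t => \sum_(i <- [::]) F i t) = cst 0.
    by apply/funext => t; rewrite big_nil.
  rewrite big_nil; split; first exact: locint_cst.
  by rewrite /avg Rintegral_cst// mul0r mulr0.
have -> : (fun t => \sum_(j <- i :: r) F j t) = (fun t => F i t + \sum_(j <- r) F j t).
  by apply/funext => t; rewrite big_cons.
rewrite big_cons; split.
  exact: (integrableD _ (IF i) IH1).
by rewrite -IH2 /avg RintegralD// mulrDr.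
Qed.

Lemma smear_shift d c u a x :
  smear d c (fun y => u (y + a)) x = smear d c u (x + a).
Proof. by rewrite /smear; congr avg; apply/funext => t; rewrite addrAC. Qed.

Lemma avgE d f : avg d f = d^-1 * \int[mu]_(t in `[0, d]) f t.
Proof. by []. Qed.

Lemma smear_avg d c u x : smear d c u x = avg d (fun t => u (x + c * t)).
Proof. by []. Qed.

Lemma locint_arg p d c u x : 1 <= p -> 0 <= c -> RLp p u ->
  mu.-integrable `[0, d] (EFin \o (fun t => u (x + c * t))).
Proof.
move=> p1; rewrite le_eqVlt => /predU1P[<-|c0] Ru.
  rewrite (_ : (fun t => _) = cst (u x)); first exact: locint_cst.
  by apply/funext => t; rewrite mul0r addr0.
by apply: locint_affine => //; [case: Ru|exact: (RLp_locint p)].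
Qed.

Lemma continuous_sum (I : Type) (r : seq I) (F : I -> R -> R) :
  (forall i, continuous (F i)) -> continuous (fun x => \sum_(i <- r) F i x).
Proof.
move=> cF; elim: r => [|i r IH] x.
  rewrite (_ : (fun x => _) = cst 0); first exact: cvg_cst.
  by apply/funext => t; rewrite big_nil.
rewrite (_ : (fun x => _) = (fun t => F i t + \sum_(j <- r) F j t)); last first.
  by apply/funext => t; rewrite big_cons.
by apply: cvgD; [exact: cF|exact: IH].
Qed.

Lemma continuous_scale (k : R) f : continuous f -> continuous (fun x => k * f x).
Proof. by move=> cf x; apply: cvgM; [exact: cvg_cst|exact: cf]. Qed.

End AverageAlgebra.

Global Opaque avg smear rnorm cnorm lp_norm.

(** * The smooth approximant of a real function *)

Section SmearAlgebra.
Context {R : realType} (p d : R).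
Hypotheses (p1 : 1 <= p) (d0 : 0 < d).
Implicit Types (c h a : R) (u v : R -> R).

Lemma RLp_measurable u : RLp p u -> measurable_fun setT u.
Proof. by case. Qed.

Lemma RLp_fdiff h u : RLp p u -> RLp p (fdiff h u).
Proof.
move=> Ru; rewrite (_ : fdiff h u = fun x => u (x + h) + -1 * u x).
  by apply: RLpD => //; [have [] := RLp_shift p u h p1 Ru|exact: RLpZ].
by apply/funext => x; rewrite mulN1r.
Qed.

Lemma rnorm_fdiff h u : RLp p u -> rnorm p (fdiff h u) <= 2 * rnorm p u.
Proof.
move=> Ru; rewrite (_ : fdiff h u = fun x => u (x + h) + -1 * u x); last first.
  by apply/funext => x; rewrite mulN1r.
have [R1 n1] := RLp_shift p u h p1 Ru.
apply: le_trans (rnormD _ _ _ p1 R1 (RLpZ _ (-1) _ p1 Ru)) _.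
by rewrite rnormZ// normrN1 mul1r mulr_natl mulr2n lerD2r.
Qed.

Lemma RLp_iter_fdiff k h u : RLp p u -> RLp p (iter k (fdiff h) u).
Proof. by move=> Ru; elim: k => [//|k IH]; exact: RLp_fdiff. Qed.

Lemma rnorm_iter_fdiff k h u : RLp p u -> rnorm p (iter k (fdiff h) u) <= 2 ^+ k * rnorm p u.
Proof.
move=> Ru; elim: k => [|k IH]; first by rewrite expr0 mul1r.
apply: le_trans (rnorm_fdiff _ _ (RLp_iter_fdiff k h u Ru)) _.
by rewrite exprS -mulrA ler_pM2l.
Qed.

Lemma smear_fdiff c h u : 0 <= c -> RLp p u -> smear d c (fdiff h u) = fdiff h (smear d c u).
Proof.
move=> c0 Ru; apply/funext => x; rewrite /fdiff -(smear_shift d c u h x) !smear_avg.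
have [Rh _] := RLp_shift p u h p1 Ru.
apply: (avgB d (fun t => u (x + c * t + h))); last exact: (locint_arg p).
exact: (locint_arg p d c _ x p1 c0 Rh).
Qed.

Lemma smear_iter_fdiff c h k u : 0 <= c -> RLp p u ->
  smear d c (iter k (fdiff h) u) = iter k (fdiff h) (smear d c u).
Proof.
move=> c0 Ru; elim: k => [//|k IH]; rewrite iterS smear_fdiff ?IH//.
exact: RLp_iter_fdiff.
Qed.

Lemma RLp_iter_smear c m u : RLp p u ->
  RLp p (iter m (smear d c) u) /\ rnorm p (iter m (smear d c) u) <= rnorm p u.
Proof.
move=> Ru; elim: m => [//|m [IH1 IH2]]; rewrite iterS.
have [h1 h2] := RLp_smear p d c (iter m (smear d c) u) p1 d0 IH1.
by split; [exact: h1|exact: le_trans h2 IH2].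
Qed.

Lemma iter_smear_iter_fdiff c h k m u : 0 <= c -> RLp p u ->
  iter m (smear d c) (iter k (fdiff h) u) = iter k (fdiff h) (iter m (smear d c) u).
Proof.
move=> c0 Ru; elim: m => [//|m IH]; rewrite !iterS IH smear_iter_fdiff//.
by have [] := RLp_iter_smear c m u Ru.
Qed.

Lemma rnorm_fdiff_smear c h k m u : 0 <= c -> RLp p u ->
  rnorm p (iter k (fdiff h) (iter m (smear d c) u)) <= rnorm p (iter k (fdiff h) u).
Proof.
move=> c0 Ru; rewrite -(iter_smear_iter_fdiff _ _ _ _ _ c0 Ru).
by have [] := RLp_iter_smear c m _ (RLp_iter_fdiff k h u Ru).
Qed.

Lemma continuous_iter_smear c m u : 0 < c -> RLp p u -> continuous (iter m.+1 (smear d c) u).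
Proof.
move=> c0 Ru; have [R1 _] := RLp_iter_smear c m u Ru.
by apply: smear_continuous => //; [exact: RLp_measurable|exact: (RLp_locint p)].
Qed.

Lemma continuous_fdiff h u : continuous u -> continuous (fdiff h u).
Proof.
move=> cu x; apply: cvgB; last exact: cu.
apply: (@continuous_comp _ _ _ (fun y => y + h) u); last exact: cu.
by apply: cvgD; [exact: cvg_id|exact: cvg_cst].
Qed.

Lemma continuous_iter_fdiff k h u : continuous u -> continuous (iter k (fdiff h) u).
Proof. by move=> cu; elim: k => [//|k IH]; exact: continuous_fdiff. Qed.

End SmearAlgebra.

Section Smoothing.
Context {R : realType} (p d H W : R) (s : nat) (u : R -> R).
Hypotheses (p1 : 1 <= p) (d0 : 0 < d) (Ru : RLp p u).
Hypothesis HW : forall h, 0 <= h < H -> rnorm p (iter s (fdiff h) u) <= W.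
Notation mu := (@lebesgue_measure R).

(** For [k = 0] this is, up to sign, the [s]-th difference of [u] with step
    [tau], and each further [k] averages over the step; for [k = s + 1] and
    [tau = 0] it is the error of the approximant [jackson] below. *)
Definition alt_smear k (tau : R) : R -> R := fun x =>
  \sum_(j < s.+1) ((-1) ^+ j * ('C(s, j))%:R) * iter k (smear d j%:R) u (x + j%:R * tau).

Lemma alt_smear0 tau x : alt_smear 0 tau x = (-1) ^+ s * iter s (fdiff tau) u x.
Proof.
rewrite iter_fdiffE mulr_sumr (reindex_inj rev_ord_inj) /=; apply: eq_bigr => j _.
rewrite subSS bin_sub; last by rewrite -ltnS ltn_ord.
have js : (j <= s)%N by rewrite -ltnS.
rewrite subKn//.
have -> : (-1) ^+ j = (-1) ^+ s * (-1) ^+ (s - j) :> R.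
  rewrite -exprD -signr_odd -[RHS]signr_odd oddD oddB//.
  by case: (odd s); case: (odd j).
rewrite /=; ring.
Qed.

Lemma alt_smear_step k tau x : alt_smear k.+1 tau x = avg d (fun t => alt_smear k (tau + t) x).
Proof.
have Rk (j : 'I_s.+1) : RLp p (iter k (smear d j%:R) u).
  by have [] := RLp_iter_smear p d p1 d0 j%:R k u Ru.
pose F (j : 'I_s.+1) t := ((-1) ^+ j * ('C(s, j))%:R) *
  iter k (smear d j%:R) u (x + j%:R * tau + j%:R * t).
have If (j : 'I_s.+1) := locint_arg p d j%:R _ (x + j%:R * tau) p1 (ler0n _ _) (Rk j).
have IF (j : 'I_s.+1) : mu.-integrable `[0, d] (EFin \o F j).
  by apply: integrable_scale => //; exact: If.
transitivity (avg d (fun t => \sum_(j < s.+1) F j t)).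
  rewrite (proj2 (avg_sum d _ (index_enum _) F IF)); apply: eq_bigr => j _.
  by rewrite /F avgZ; [rewrite -smear_avg|exact: If].
congr avg; apply/funext => t; apply: eq_bigr => j _.
by rewrite /F mulrDr addrA.
Qed.

(** A [k]-fold average over the step only uses steps up to [tau + k d]. *)
Lemma RLp_alt_smear_bound k tau : 0 <= tau -> tau + k%:R * d < H ->
  RLp p (alt_smear k tau) /\ rnorm p (alt_smear k tau) <= W.
Proof.
elim: k tau => [|k IH] tau t0 tH.
  rewrite (_ : alt_smear 0 tau = fun x => (-1) ^+ s * iter s (fdiff tau) u x); last first.
    by apply/funext => x; exact: alt_smear0.
  have Rs := RLp_iter_fdiff p p1 s tau u Ru.
  split; first exact: RLpZ.
  rewrite rnormZ// normrX normrN1 expr1n mul1r; apply: HW; rewrite t0/=.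
  by move: tH; rewrite mul0r addr0.
rewrite (_ : alt_smear k.+1 tau = fun x => avg d (fun t => alt_smear k (tau + t) x)); last first.
  by apply/funext => x; exact: alt_smear_step.
have Rk (j : 'I_s.+1) : RLp p (iter k (smear d j%:R) u).
  by have [] := RLp_iter_smear p d p1 d0 j%:R k u Ru.
apply: (@RLp_avg R p d (fun z => alt_smear k (tau + z.2) z.1) W p1 d0).
- apply: measurable_sum => j; apply: measurable_funM => //.
  apply: (measurableT_comp (RLp_measurable p _ (Rk j))).
  apply: measurable_funD => //; apply: measurable_funM => //.
  by apply: measurable_funD => //.
- move=> t x /=; apply: eq_bigr => j _; congr (_ * _).
  by case: (Rk j) => pj _ _; rewrite addrAC pj.
move=> t /andP[tt td] /=; apply: IH; first by rewrite addr_ge0.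
apply: le_lt_trans tH; rewrite -natr1 mulrDl mul1r; lra.
Qed.

(** Each term is averaged [s + 1] times, which makes the [s]-th derivative
    continuous; the binomial coefficients make [u - jackson] an average of
    [s]-th differences. *)
Definition jackson : R -> R := fun x =>
  \sum_(j < s) ((-1) ^+ j * ('C(s, j.+1))%:R) * iter s.+1 (smear d j.+1%:R) u x.

Lemma jacksonE x : u x - jackson x = alt_smear s.+1 0 x.
Proof.
rewrite /alt_smear big_ord_recl expr0 bin0 !mul1r mulr0 addr0.
have -> : iter s.+1 (smear d 0) u = u.
  by elim: (s.+1) => [//|m IH]; rewrite iterS IH smear0.
congr (_ + _); rewrite -sumrN; apply: eq_bigr => j _.
by rewrite mulr0 addr0 lift0 exprS mulN1r !mulNr.
Qed.

(** The [k]-th derivative of [jackson]: differentiating turns one average over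
    a window of length [(j + 1) d] into a difference quotient with that step. *)
Definition jackson_der k : R -> R := fun x =>
  \sum_(j < s) (((-1) ^+ j * ('C(s, j.+1))%:R) * (j.+1%:R * d) ^- k) *
     iter k (fdiff (j.+1%:R * d)) (iter (s.+1 - k) (smear d j.+1%:R) u) x.

Lemma jackson_der0 : jackson_der 0 = jackson.
Proof. by apply/funext => x; apply: eq_bigr => j _; rewrite expr0 invr1 mulr1 subn0. Qed.

Lemma jn_gt0 (j : nat) : 0 < j.+1%:R * d :> R.
Proof. by rewrite mulr_gt0// ltr0n. Qed.

Lemma is_derive_fdiff (f f' : R -> R) h : (forall x : R, is_derive x 1 f (f' x)) ->
  forall x : R, is_derive x 1 (fdiff h f) (fdiff h f' x).
Proof.
move=> df x.
have h3 : is_derive x 1 (fun y => f (y + h)) (f' (x + h)).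
  have hs : is_derive x 1 (shift h : R -> R) 1 by exact: is_derive_shift.
  have := @is_derive1_comp _ f (shift h) x _ _ (df (x + h)) hs.
  by rewrite mulr1.
exact: (is_deriveB h3 (df x)).
Qed.

Lemma is_derive_iter_fdiff (f f' : R -> R) h k : (forall x : R, is_derive x 1 f (f' x)) ->
  forall x : R, is_derive x 1 (iter k (fdiff h) f) (iter k (fdiff h) f' x).
Proof. by move=> df; elim: k => [//|k IH] x; exact: is_derive_fdiff. Qed.

Lemma iter_fdiffZ (h a : R) k (f : R -> R) x :
  iter k (fdiff h) (fun x => a * f x) x = a * iter k (fdiff h) f x.
Proof.
rewrite !iter_fdiffE mulr_sumr; apply: eq_bigr => i _; exact: mulrCA.
Qed.

Lemma is_derive_jackson_der k (x : R) : (k < s)%N -> is_derive x 1 (jackson_der k) (jackson_der k.+1 x).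
Proof.
move=> ks.
pose F (j : 'I_s) : R -> R := fun x => (((-1) ^+ j * ('C(s, j.+1))%:R) * (j.+1%:R * d) ^- k) *
     iter k (fdiff (j.+1%:R * d)) (iter (s.+1 - k) (smear d j.+1%:R) u) x.
have -> : jackson_der k = \sum_(j < s) F j.
  by apply/funext => y; rewrite fct_sumE.
apply: is_derive_sum => j.
set v := iter (s - k) (smear d j.+1%:R) u.
have cv : continuous v.
  by rewrite /v -(subnSK ks); apply: (continuous_iter_smear p d p1 d0).
(* one window average is differentiated, the others keep [v] continuous *)
have dsm (y : R) : is_derive y 1 (smear d j.+1%:R v)
    ((fun z => (j.+1%:R * d)^-1 * fdiff (j.+1%:R * d) v z) y).
  by apply: smear_derive => //; rewrite ltr0n.
have := is_derive_iter_fdiff _ _ (j.+1%:R * d) k dsm x.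
rewrite iter_fdiffZ -iterSr => D1.
rewrite /F; have -> : iter (s.+1 - k) (smear d j.+1%:R) u = smear d j.+1%:R v.
  by rewrite subSn// ltnW.
have D2 := is_deriveZ (((-1) ^+ j * ('C(s, j.+1))%:R) * (j.+1%:R * d) ^- k) D1.
apply: is_derive_eq D2 _.
rewrite [LHS]mulrA; congr (_ * _).
have E (A L : R) : A / L ^+ k / L = A / L ^+ k.+1 by rewrite exprSr invfM mulrA.
exact: E.
Qed.

Lemma derive1n_jackson k : (k <= s)%N -> derive1n k jackson = jackson_der k.
Proof.
elim: k => [|k IH] ks; first by rewrite jackson_der0.
rewrite derive1nS (IH (ltnW ks)); apply/funext => x; rewrite derive1E.
exact: (@derive_val _ _ _ _ _ _ _ (is_derive_jackson_der k x ks)).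
Qed.

Lemma RLp_jackson_der k : (k <= s)%N -> RLp p (jackson_der k).
Proof.
move=> ks; apply: RLp_sum => // j _; apply: RLpZ => //; apply: RLp_iter_fdiff => //.
by have [] := RLp_iter_smear p d p1 d0 j.+1%:R (s.+1 - k) u Ru.
Qed.

Lemma RLp_jackson : RLp p jackson.
Proof. by rewrite -jackson_der0; exact: RLp_jackson_der. Qed.

Lemma continuous_jackson_der k : (k <= s)%N -> continuous (jackson_der k).
Proof.
move=> ks; apply: continuous_sum => j; apply: continuous_scale.
rewrite subSn//.
apply: (@continuous_iter_fdiff R k (j.+1%:R * d) (iter (s - k).+1 (smear d j.+1%:R) u)).
by apply: (continuous_iter_smear p d p1 d0).
Qed.

Lemma W_ge0 : 0 < H -> 0 <= W.
Proof. move=> H0; apply: le_trans (HW 0 _); rewrite ?lexx//; exact: rnorm_ge0. Qed.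

Lemma rnorm_jackson_sub : s.+1%:R * d < H ->
  RLp p (fun x => u x - jackson x) /\ rnorm p (fun x => u x - jackson x) <= W.
Proof.
move=> sH; under eq_fun do rewrite jacksonE.
by apply: RLp_alt_smear_bound => //; rewrite add0r.
Qed.

Lemma sum_binS_le : \sum_(j < s) ('C(s, j.+1))%:R <= 2 ^+ s :> R.
Proof.
rewrite -natrX -natr_sum ler_nat.
have -> : (2 ^ s = \sum_(i < s.+1) 'C(s, i))%N.
  rewrite -[2%N]/(1 + 1)%N expnDn; apply: eq_bigr => i _.
  by rewrite !exp1n !muln1.
by rewrite [leqRHS]big_ord_recl leq_addl.
Qed.

(** All [s] difference quotients taken in a term have the same step, at most
    [s d], so together they form an [s]-th difference of [u]. *)
Lemma rnorm_jackson_der_top : s%:R * d < H -> rnorm p (jackson_der s) <= 2 ^+ s * d ^- s * W.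
Proof.
move=> sH.
have H0 : 0 < H by apply: le_lt_trans sH; rewrite mulr_ge0// ltW.
have W0 := W_ge0 H0.
have R1 j : RLp p (iter s (fdiff (j.+1%:R * d)) (iter (s.+1 - s) (smear d j.+1%:R) u)).
  apply: RLp_iter_fdiff => //.
  by have [] := RLp_iter_smear p d p1 d0 j.+1%:R (s.+1 - s) u Ru.
apply: le_trans (rnorm_sum p _ _ _ _ p1 _) _ => [j _|]; first exact: RLpZ.
apply: (@le_trans _ _ (\sum_(j < s) (('C(s, j.+1))%:R * (d ^- s * W)))); last first.
  rewrite -mulr_suml mulrA -mulrA -[leRHS]mulrA ler_wpM2r ?sum_binS_le//.
  by rewrite mulr_ge0// invr_ge0 exprn_ge0// ltW.
apply: ler_sum => j _; rewrite rnormZ// !normrM normrX normrN1 expr1n mul1r.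
rewrite normr_nat -mulrA ler_wpM2l//.
rewrite ger0_norm ?invr_ge0 ?exprn_ge0 ?(ltW (jn_gt0 _))//.
apply: ler_pM => //; [by rewrite invr_ge0 exprn_ge0// ltW// jn_gt0|exact: rnorm_ge0| |].
  rewrite lef_pV2 ?posrE ?exprn_gt0 ?jn_gt0//.
  apply: lerXn2r; rewrite ?nnegrE ?(ltW d0) ?(ltW (jn_gt0 _))//.
  by rewrite ler_peMl ?(ltW d0)// ler1n.
apply: le_trans (rnorm_fdiff_smear p d p1 d0 _ _ _ _ _ _ Ru) _; first by rewrite ler0n.
apply: HW; rewrite (ltW (jn_gt0 _))/=; apply: le_lt_trans sH.
by rewrite ler_wpM2r ?(ltW d0)// ler_nat.
Qed.

End Smoothing.

(** * Steklov averages at separated nodes *)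

Section RealSteklov.
Context {R : realType}.
Notation mu := (@lebesgue_measure R).
Implicit Types (p d delta x t : R) (u v : R -> R) (r nu : nat).

Definition steklov_weight r nu : R :=
  (-1) ^+ r.+1 * ('C((2 * r)%N, r))%:R^-1 * 2 * ((-1) ^+ nu * ('C((2 * r)%N, nu))%:R).

Definition steklov_ratio r nu : R := (r - nu)%N%:R / r%:R.

(** [steklov] for real functions, with Lebesgue measure on the Borel sets. *)
Definition rsteklov delta r u x : R :=
  (-1) ^+ r.+1 * ('C((2 * r)%N, r))%:R^-1 * (2 / delta) *
  \int[mu]_(t in `[- (delta / 2), delta / 2])
     \sum_(nu < r) (-1) ^+ nu * ('C((2 * r)%N, nu))%:R * u (x + (r - nu)%N%:R / r%:R * t).

Lemma steklov_ratio_gt0 r nu : (nu < r)%N -> 0 < steklov_ratio r nu.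
Proof. by move=> nr; rewrite /steklov_ratio divr_gt0// ltr0n ?subn_gt0//; case: r nr. Qed.

Lemma steklov_ratio_le1 r nu : (nu < r)%N -> steklov_ratio r nu <= 1.
Proof.
move=> nr; rewrite /steklov_ratio ler_pdivrMr ?mul1r ?ler_nat ?leq_subr// ltr0n.
by case: r nr.
Qed.

Lemma locint_sum (I : Type) (s : seq I) (F : I -> R -> R) :
  (forall i, locint (F i)) -> locint (fun t => \sum_(i <- s) F i t).
Proof.
move=> lF; elim: s => [|i s IH] a b.
  rewrite (_ : (fun t => _) = cst 0); first exact: locint_cst.
  by apply/funext => t; rewrite big_nil.
rewrite (_ : (fun t => _) = (fun t => F i t + \sum_(j <- s) F j t)); last first.
  by apply/funext => t; rewrite big_cons.
exact: (integrableD _ (lF i a b) (IH a b)).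
Qed.

Lemma rsteklov_smear p delta r u x : 1 <= p -> 0 < delta -> RLp p u ->
  rsteklov delta r u x =
  \sum_(nu < r) steklov_weight r nu * smear delta (steklov_ratio r nu) u (x + - (steklov_ratio r nu * (delta / 2))).
Proof.
move=> p1 d0 Ru; have [pu mu_ Lu] := Ru; have lu := RLp_locint p u p1 Ru.
pose w t := \sum_(nu < r) (-1) ^+ nu * ('C((2 * r)%N, nu))%:R * u (x + steklov_ratio r nu * t).
have mw : measurable_fun setT w.
  apply: measurable_sum => nu; apply: measurable_funM => //.
  exact: (measurableT_comp mu_ (measurable_affine x (steklov_ratio r nu))).
have lw : locint w.
  apply: locint_sum => nu a b; apply: integrable_scale => //.
  by apply: locint_affine => //; exact: steklov_ratio_gt0.
have := Rintegral_affine w (- (delta / 2)) 1 0 delta ltr01 mw lw.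
rewrite mulr0 addr0 !mul1r (_ : - (delta / 2) + delta = delta / 2); last by field.
rewrite /rsteklov -/(w _) => ->.
rewrite (_ : \int[mu]_(t in `[0, delta]) _ =
   delta * avg delta (fun t => \sum_(nu < r) (-1) ^+ nu * ('C((2 * r)%N, nu))%:R * u (x + - (steklov_ratio r nu * (delta / 2)) + steklov_ratio r nu * t))); last first.
  rewrite avgE mulrA mulfV ?gt_eqF// mul1r; apply: eq_Rintegral => t _.
  by apply: eq_bigr => nu _; congr (_ * u _); ring.
have If (nu : 'I_r) := locint_arg p delta (steklov_ratio r nu) u (x + - (steklov_ratio r nu * (delta / 2))) p1 (ltW (steklov_ratio_gt0 r nu (ltn_ord nu))) Ru.
rewrite (proj2 (avg_sum delta _ (index_enum _) (fun (nu : 'I_r) t => (-1) ^+ nu * ('C((2 * r)%N, nu))%:R * u (x + - (steklov_ratio r nu * (delta / 2)) + steklov_ratio r nu * t)) _)); last first.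
  by move=> nu; apply: integrable_scale => //; exact: If.
rewrite mulrA !mulr_sumr; apply: eq_bigr => nu _.
rewrite avgZ; last exact: If.
rewrite -smear_avg /steklov_weight !mulrA; congr (_ * _); rewrite -!mulrA; do 2 congr (_ * _).
by rewrite !mulrA mulfVK// gt_eqF.
Qed.

(** The coefficients [nu] and [2r - nu] of the central difference agree and
    belong to opposite shifts; the middle one belongs to [v x]. *)
Lemma stencil_sum r v x t : (0 < r)%N ->
  iter (2 * r) (fdiff (t / r%:R)) v (x - t) =
  \sum_(nu < r) (-1) ^+ nu * ('C((2 * r)%N, nu))%:R *
     (v (x + steklov_ratio r nu * t) + v (x + steklov_ratio r nu * - t))
  + (-1) ^+ r * ('C((2 * r)%N, r))%:R * v x.
Proof.
move=> r0; have rnorm0 : r%:R != 0 :> R by rewrite pnatr_eq0 -lt0n.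
rewrite iter_fdiffE.
pose F nu := ('C((2 * r)%N, nu))%:R * (-1) ^+ nu * v (x - t + (2 * r - nu)%N%:R * (t / r%:R)).
rewrite -(big_mkord xpredT F) (@big_cat_nat _ _ _ r)//=; last first.
  by rewrite mul2n -addnn -addnS leq_addr.
rewrite (@big_ltn _ _ _ r); last by rewrite ltnS mul2n -addnn leq_addr.
rewrite addrCA [LHS]addrC; congr (_ + _); last first.
  rewrite /F mulrC mulrA [X in v X](_ : _ = x) 1?mulrC; last first.
    by rewrite mul2n -addnn addnK; field.
  by rewrite (mulrC (_%:R)).
have -> : \sum_(r.+1 <= i < (2 * r).+1) F i = \sum_(0 <= i < r) F (2 * r - i)%N.
  rewrite big_nat_rev /= -{1}(add0n r.+1) big_addn.
  have -> : ((2 * r).+1 - r.+1 = r)%N by rewrite subSS mul2n -addnn addnK.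
  apply: eq_big_nat => i /andP[_ ir]; congr F; lia.
rewrite -big_split /= big_mkord; apply: eq_bigr => nu _.
have nr := ltn_ord nu.
rewrite /F bin_sub; last lia.
rewrite subKn; last lia.
have -> : (-1) ^+ (2 * r - nu) = (-1) ^+ nu :> R.
  rewrite -signr_odd -[RHS]signr_odd oddB; last lia.
  by rewrite mul2n odd_double.
have -> : x - t + (2 * r - nu)%N%:R * (t / r%:R) = x + steklov_ratio r nu * t.
  rewrite /steklov_ratio natrB; last lia.
  rewrite natrM natrB; last lia.
  by field.
have -> : x - t + nu%:R * (t / r%:R) = x + steklov_ratio r nu * - t.
  by rewrite /steklov_ratio natrB; [field|lia].
by ring.
Qed.

Lemma Rintegral_sym (w : R -> R) (a : R) : 0 <= a -> continuous w ->
  \int[mu]_(t in `[- a, a]) w t = \int[mu]_(t in `[0, a]) (w t + w (- t)).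
Proof.
move=> a0 cw; have lw := locint_continuous w cw.
have cwN : continuous (fun t => w (- t)).
  by move=> t; apply: (@continuous_comp _ _ _ (fun y : R => - y) w); [exact: opp_continuous|exact: cw].
rewrite RintegralD; [|exact: measurable_itv|exact: lw|exact: (locint_continuous _ cwN)].
have -> : \int[mu]_(t in `[0, a]) w (- t) = \int[mu]_(t in `[- a, 0]) w t.
  rewrite /Rintegral; congr fine.
  have := @integration_by_substitution_oppr R w 0 a a0; rewrite oppr0 => -> //.
  exact: continuous_subspaceT.
have := @Rintegral_itvB R w (BLeft (- a)) (BRight a) 0.
rewrite !bnd_simp => /(_ (lw _ _)) h.
rewrite -(@Rintegral_itv_obnd_cbnd _ 0); last first.
  by apply: integrableS (lw 0 a) => //; exact: subset_itv_oc_cc.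
by rewrite -h ?subrK// oppr_le0.
Qed.

(** The weights of the Steklov average are those of a central difference of
    order [2r], divided by its middle coefficient. *)
Lemma sub_rsteklov delta r v x : (0 < r)%N -> 0 < delta -> continuous v ->
  v x - rsteklov delta r v x =
  ((-1) ^+ r * ('C((2 * r)%N, r))%:R^-1) *
    avg (delta / 2) (fun t => iter (2 * r) (fdiff (t / r%:R)) v (x - t)).
Proof.
move=> r0 d0 cv.
have C0 : ('C((2 * r)%N, r))%:R != 0 :> R.
  by rewrite pnatr_eq0 -lt0n bin_gt0 mul2n -addnn leq_addr.
pose w t := \sum_(nu < r) (-1) ^+ nu * ('C((2 * r)%N, nu))%:R * v (x + steklov_ratio r nu * t).
have cw : continuous w.
  apply: continuous_sum => nu; apply: continuous_scale => t.
  apply: (@continuous_comp _ _ _ (fun t : R => x + steklov_ratio r nu * t) v); last exact: cv.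
  by apply: cvgD; [exact: cvg_cst|apply: cvgM; [exact: cvg_cst|exact: cvg_id]].
have cwN : continuous (fun t => w (- t)).
  by move=> t; apply: (@continuous_comp _ _ _ (fun y : R => - y) w); [exact: opp_continuous|exact: cw].
have d20 : 0 < delta / 2 by rewrite divr_gt0.
have E : (fun t => iter (2 * r) (fdiff (t / r%:R)) v (x - t)) =
   (fun t => (w t + w (- t)) - (- ((-1) ^+ r * ('C((2 * r)%N, r))%:R * v x))).
  apply/funext => t; rewrite stencil_sum// opprK /w -big_split /=; congr (_ + _).
  by apply: eq_bigr => nu _; rewrite mulrDr.
have lww : locint (fun t => w t + w (- t)).
  by apply: locint_continuous => t; apply: cvgD; [exact: cw|exact: cwN].
rewrite E avgB; [|exact: lww|exact: locint_cst].
have -> : avg (delta / 2) (fun=> - ((-1) ^+ r * ('C((2 * r)%N, r))%:R * v x)) =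
   - ((-1) ^+ r * ('C((2 * r)%N, r))%:R * v x).
  rewrite avgE Rintegral_cst//= (_ : mu _ = (delta / 2)%:E) /=; last exact: lebesgue_measure_0d.
  by rewrite mulrCA mulVf ?mulr1// gt_eqF.
rewrite /rsteklov -/(w _) Rintegral_sym//; last exact: ltW.
rewrite avgE invf_div opprK mulrDr.
set I := \int[mu]_(t in _) _.
have -> : (-1) ^+ r * ('C((2 * r)%N, r))%:R^-1 * ((-1) ^+ r * ('C((2 * r)%N, r))%:R * v x) = v x.
  have ee : (-1) ^+ r * (-1) ^+ r = 1 :> R by rewrite -expr2 sqrr_sign.
  have cancel_sign (e C y : R) : C != 0 -> e * e = 1 -> e / C * (e * C * y) = y.
    by move=> Cn0 h; transitivity ((e * e) * y); [field|rewrite h mul1r].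
  exact: cancel_sign.
by rewrite exprS; ring.
Qed.

End RealSteklov.

Section SampledSmoothing.
Context {R : realType} (p gamma : R) (r n : nat) (X : nat -> R).
Hypotheses (p1 : 1 <= p) (r0 : (0 < r)%N) (n0 : (0 < n)%N) (g0 : 0 < gamma) (g1 : gamma <= 1).
Hypothesis Xs : forall k, (1 <= k < n)%N -> X k + gamma / n%:R <= X k.+1.
Hypothesis Xn : X n + gamma / n%:R <= X 1%N + 1.
Implicit Types (u v w : R -> R).

Let n0R : 0 < n%:R :> R. Proof. by rewrite ltr0n. Qed.
Let p0 : 0 < p. Proof. exact: lt_le_trans p1. Qed.
Let gn0 : 0 < gamma / n%:R. Proof. by rewrite divr_gt0. Qed.

Lemma sampled_smear d c a u : 0 < d -> 0 < c -> c * d <= gamma / n%:R -> RLp p u ->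
  lp_norm p n X (toC (fun x => smear d c u (x + a))) <= (n%:R * (c * d))^-1 * rnorm p u.
Proof.
move=> d0 c0 cd Ru; apply: lp_norm_smear => //.
- by move=> k kn; apply: le_trans (Xs k kn); rewrite lerD2l.
- by apply: le_trans Xn; rewrite lerD2l.
- apply: (@le_trans _ _ (n%:R * (gamma / n%:R))); first by rewrite ler_pM2l.
  by rewrite mulrCA mulfV ?mulr1// gt_eqF.
Qed.

Definition steklov_const : R := \sum_(nu < r) `|steklov_weight r nu| * (steklov_ratio r nu * gamma)^-1.

Lemma sampled_lincomb m (a : 'I_m -> R) (F : 'I_m -> R -> R) :
  lp_norm p n X (toC (fun x => \sum_(j < m) a j * F j x)) <=
  \sum_(j < m) `|a j| * lp_norm p n X (toC (F j)).
Proof.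
have -> : toC (fun x => \sum_(j < m) a j * F j x) =
    fun x => \sum_(j < m) (fun x => (a j)%:C%C * toC (F j) x) x.
  by apply/funext => x; rewrite /toC rmorph_sum; apply: eq_bigr => j _; rewrite rmorphM.
apply: le_trans (lp_norm_sum p n X _ (index_enum _) (fun j x => (a j)%:C%C * toC (F j) x) p1 n0) _.
by apply: ler_sum => j _; rewrite lp_normZ// normc_real.
Qed.

(** The windows of a Steklov average have length at most [gamma / n], so that
    [lp_norm_smear] applies to each of them. *)
Lemma sampled_rsteklov u : RLp p u ->
  lp_norm p n X (toC (rsteklov (gamma / n%:R) r u)) <= steklov_const * rnorm p u.
Proof.
move=> Ru.
have -> : rsteklov (gamma / n%:R) r u = fun x => \sum_(nu < r) steklov_weight r nu *
   (fun x => smear (gamma / n%:R) (steklov_ratio r nu) u (x + - (steklov_ratio r nu * (gamma / n%:R / 2)))) x.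
  by apply/funext => x; exact: rsteklov_smear p1 gn0 Ru.
apply: le_trans (sampled_lincomb r _ _) _.
rewrite /steklov_const mulr_suml; apply: ler_sum => nu _.
rewrite -[leRHS]mulrA ler_wpM2l//.
have c0 : 0 < steklov_ratio r nu :> R := steklov_ratio_gt0 r nu (ltn_ord nu).
have := sampled_smear (gamma / n%:R) (steklov_ratio r nu) (- (steklov_ratio r nu * (gamma / n%:R / 2))) u gn0 c0 _ Ru.
have -> : n%:R * (steklov_ratio r nu * (gamma / n%:R)) = steklov_ratio r nu * gamma.
  by field; rewrite gt_eqF.
apply; rewrite ler_piMl// ?(ltW gn0)//; exact: steklov_ratio_le1.
Qed.

Section SampledJackson.
Context (H W : R) (s : nat) (u : R -> R).
Hypotheses (sr : (s <= 2 * r)%N) (Ru : RLp p u).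
Hypothesis HW : forall h, 0 <= h < H -> rnorm p (iter s (fdiff h) u) <= W.
Hypothesis gH : gamma / n%:R <= H.

Definition jackson_step : R := gamma / n%:R / s.+2%:R.

Definition sampled_jackson_const : R :=
  \sum_(j < s) ('C(s, j.+1))%:R * ((j.+1%:R * (gamma / s.+2%:R))^-1 * 2 ^+ (2 * r - s)).

Let jstep0 : 0 < jackson_step. Proof. by rewrite divr_gt0. Qed.

Let jackson_step_le j : (j < s)%N -> j.+1%:R * jackson_step <= gamma / n%:R.
Proof.
move=> js; rewrite /jackson_step mulrCA ler_piMr ?(ltW gn0)//.
by rewrite ler_pdivrMr// mul1r ler_nat ltnW// ltnS ltnW.
Qed.

Lemma iter_fdiff_lincomb m (a : 'I_m -> R) (F : 'I_m -> R -> R) k h x :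
  iter k (fdiff h) (fun x => \sum_(j < m) a j * F j x) x =
  \sum_(j < m) a j * iter k (fdiff h) (F j) x.
Proof.
rewrite iter_fdiffE; under eq_bigr do rewrite mulr_sumr.
rewrite exchange_big /=; apply: eq_bigr => j _.
by rewrite iter_fdiffE mulr_sumr; apply: eq_bigr => i _; rewrite mulrCA.
Qed.

Let jack := jackson jackson_step s u.

(** By [sub_rsteklov] the left side is an average of [2r]-th differences of
    the approximant, with steps below [H].  The outermost of the [s + 1] window
    averages of each term pays for the sampling; of the differences, [2r - s]
    are estimated trivially and [s] of them fall on [u]. *)
Lemma sampled_jackson :
  lp_norm p n X (toC (fun x => jack x - rsteklov (gamma / n%:R) r jack x)) <=
  sampled_jackson_const * W.
Proof.
have H0 : 0 < H by apply: lt_le_trans gH.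
have W0 : 0 <= W by apply: le_trans (HW 0 _); rewrite ?lexx//; exact: rnorm_ge0.
have cj : continuous jack.
  by rewrite /jack -jackson_der0; apply: (continuous_jackson_der p jackson_step s u p1 jstep0 Ru).
have mj : measurable_fun setT jack by exact: continuous_measurable_fun.
have K0 : 0 <= sampled_jackson_const.
  apply: sumr_ge0 => j _; apply: mulr_ge0 => //; apply: mulr_ge0; last exact: exprn_ge0.
  by rewrite invr_ge0 mulr_ge0// divr_ge0// ltW.
pose kappa : R := (-1) ^+ r * ('C((2 * r)%N, r))%:R^-1.
pose F (z : R * R) := iter (2 * r) (fdiff (z.2 / r%:R)) jack (z.1 - z.2).
have -> : toC (fun x => jack x - rsteklov (gamma / n%:R) r jack x) =
    fun x => kappa%:C%C * toC (fun x => avg (gamma / n%:R / 2) (fun t => F (x, t))) x.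
  by apply/funext => x; rewrite /toC sub_rsteklov// rmorphM.
rewrite lp_normZ// normc_real.
have k1 : `|kappa| <= 1.
  rewrite /kappa normrM normrX normrN1 expr1n mul1r ger0_norm ?invr_ge0//.
  by rewrite invf_le1 ?ler1n ?ltr0n bin_gt0 mul2n -addnn leq_addr.
apply: le_trans (ler_piMl (lp_norm_ge0 _ _ _ _) k1) _.
apply: lp_norm_avg => //; [by rewrite divr_gt0|by rewrite mulr_ge0| |].
  rewrite (_ : F = fun z => \sum_(nu < (2 * r).+1) ('C((2 * r)%N, nu))%:R * (-1) ^+ nu *
      jack (z.1 - z.2 + (2 * r - nu)%N%:R * (z.2 / r%:R))); last first.
    by apply/funext => z; rewrite /F iter_fdiffE.
  apply: measurable_sum => nu; apply: measurable_funM => //.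
  apply: (measurableT_comp mj); apply: measurable_funD.
    by apply: measurable_funB.
  by apply: measurable_funM => //; apply: measurable_funM.
move=> t /andP[t0 td]; set tau := t / r%:R.
have tauH : 0 <= tau < H.
  rewrite /tau divr_ge0//=; apply: lt_le_trans gH; apply: le_lt_trans (_ : gamma / n%:R / 2 < _).
    by apply: le_trans td; rewrite ler_pdivrMr ?ltr0n// ler_peMr// ler1n.
  by rewrite ltr_pdivrMr// ltr_pMr// ltr1n.
pose g (j : nat) := iter s (smear jackson_step j.+1%:R) u.
have Rg j : RLp p (g j) by have [] := RLp_iter_smear p jackson_step p1 jstep0 j.+1%:R s u Ru.
have -> : toC (fun x => F (x, t)) = toC (fun x => \sum_(j < s) ((-1) ^+ j * ('C(s, j.+1))%:R) *
    (fun x => smear jackson_step j.+1%:R (iter (2 * r) (fdiff tau) (g j)) (x + - t)) x).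
  congr toC; apply/funext => x; rewrite /F /= -/tau.
  have -> : jack = fun x => \sum_(j < s) ((-1) ^+ j * ('C(s, j.+1))%:R) * smear jackson_step j.+1%:R (g j) x by [].
  rewrite (iter_fdiff_lincomb s (fun j : 'I_s => (-1) ^+ j * ('C(s, j.+1))%:R) (fun j : 'I_s => smear jackson_step j.+1%:R (g j))).
  apply: eq_bigr => j _; congr (_ * _).
  by rewrite (smear_iter_fdiff p jackson_step p1 _ _ _ _ (ler0n _ _) (Rg j)).
apply: le_trans (sampled_lincomb s _ _) _.
rewrite mulr_suml; apply: ler_sum => j _.
rewrite normrM normrX normrN1 expr1n mul1r normr_nat -mulrA ler_wpM2l//.
have Rj := RLp_iter_fdiff p p1 (2 * r) tau (g j) (Rg j).
apply: le_trans (sampled_smear jackson_step j.+1%:R (- t) _ jstep0 _ (jackson_step_le j (ltn_ord j)) Rj) _.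
  by rewrite ltr0n.
have -> : n%:R * (j.+1%:R * jackson_step) = j.+1%:R * (gamma / s.+2%:R).
  have cancel (a b c e : R) : a != 0 -> c != 0 -> a * (b * (e / a / c)) = b * (e / c).
    by move=> a0 c0; field; rewrite a0 c0.
  by rewrite /jackson_step cancel// gt_eqF.
rewrite -mulrA ler_wpM2l//; first by rewrite invr_ge0 mulr_ge0// divr_ge0// ltW.
apply: le_trans (rnorm_fdiff_smear p jackson_step p1 jstep0 _ _ _ _ _ (ler0n _ _) Ru) _.
rewrite -(subnK sr) iterD.
apply: le_trans (rnorm_iter_fdiff p p1 _ _ _ (RLp_iter_fdiff p p1 s tau u Ru)) _.
by rewrite subnK// ler_wpM2l ?exprn_ge0//; exact: HW.
Qed.

End SampledJackson.

End SampledSmoothing.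

(** * Periodic Borel functions with complex values *)

Section ComplexClass.
Context {R : realType} (p : R).
Hypothesis p1 : 1 <= p.
Implicit Types (f g : R -> R[i]) (u v : R -> R).
Let p0 : 0 < p. Proof. exact: lt_le_trans p1. Qed.

Definition reF f : R -> R := fun x => complex.Re (f x).
Definition imF f : R -> R := fun x => complex.Im (f x).

(** The analogue of [RLp] for complex values. *)
Variant CLp f : Prop := IsCLp of periodic1 f & measurable_fun setT (reF f) &
  measurable_fun setT (imF f) & Lp p f.

Lemma CLp_Lp f : CLp f -> Lp p f.
Proof. by case. Qed.

Lemma measurable_normF f : measurable_fun setT (reF f) -> measurable_fun setT (imF f) ->
  measurable_fun setT (fun x => normc (f x)).
Proof. exact: measurable_normc. Qed.

Lemma CLp_norm f : CLp f -> RLp p (fun x => normc (f x)) /\ rnorm p (fun x => normc (f x)) = cnorm p f.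
Proof.
move=> [pf m1 m2 Lf].
have E : Lp_norm p (toC (fun x => normc (f x))) = Lp_norm p f by exact: Lp_norm_normc.
have mn := measurable_normF f m1 m2.
split; last first.
  rewrite (_ : rnorm p _ = fine (Lp_norm p (toC (fun x => normc (f x))))); last exact: rnormE.
  by rewrite E cnorm_fine.
split; [by move=> x; rewrite pf|exact: mn|].
split; first exact: lmeas_toC.
by rewrite E; case: Lf.
Qed.

Lemma CLpI f : periodic1 f -> measurable_fun setT (reF f) -> measurable_fun setT (imF f) ->
  RLp p (fun x => normc (f x)) -> CLp f.
Proof.
move=> pf m1 m2 [_ _ [_ h]]; split => //; split.
  by split; exact: lebesgue_measurableW.
by rewrite -Lp_norm_normc.
Qed.

Lemma CLp_shift f a : CLp f -> CLp (fun x => f (x + a)) /\ cnorm p (fun x => f (x + a)) <= cnorm p f.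
Proof.
move=> Bf; have [Rn En] := CLp_norm f Bf; case: (Bf) => pf m1 m2 _.
have [Rs ns] := RLp_shift p _ a p1 Rn.
have Bs : CLp (fun x => f (x + a)).
  apply: CLpI => //.
  - by move=> x; rewrite addrAC pf.
  - by apply: (measurableT_comp m1); exact: measurable_funD.
  - by apply: (measurableT_comp m2); exact: measurable_funD.
by split; [exact: Bs|rewrite -(CLp_norm _ Bs).2 -En; exact: ns].
Qed.

Lemma CLpD f g : CLp f -> CLp g -> CLp (fun x => f x + g x).
Proof.
move=> [pf f1 f2 Lf] [pg g1 g2 Lg]; split.
- by move=> x; rewrite pf pg.
- rewrite (_ : reF _ = fun x => reF f x + reF g x); first exact: measurable_funD.
  by apply/funext => x; rewrite /reF ReD.
- rewrite (_ : imF _ = fun x => imF f x + imF g x); first exact: measurable_funD.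
  by apply/funext => x; rewrite /imF ImD.
- exact: LpD.
Qed.

Lemma CLpZ (c : R[i]) f : CLp f -> CLp (fun x => c * f x).
Proof.
move=> [pf f1 f2 Lf]; split.
- by move=> x; rewrite pf.
- rewrite (_ : reF _ = fun x => complex.Re c * reF f x - complex.Im c * imF f x).
    by apply: measurable_funB; apply: measurable_funM.
  by apply/funext => x; rewrite /reF ReM.
- rewrite (_ : imF _ = fun x => complex.Re c * imF f x + complex.Im c * reF f x).
    by apply: measurable_funD; apply: measurable_funM.
  by apply/funext => x; rewrite /imF ImM.
- exact: LpZ.
Qed.

Lemma CLpB f g : CLp f -> CLp g -> CLp (fun x => f x - g x).
Proof.
move=> Bf Bg; rewrite (_ : (fun x => _) = fun x => f x + -1 * g x).
  by apply: CLpD => //; exact: CLpZ.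
by apply/funext => x; rewrite mulN1r.
Qed.

Lemma CLp_fdiff h f : CLp f -> CLp (fdiff h f).
Proof. by move=> Bf; apply: CLpB => //; have [] := CLp_shift f h Bf. Qed.

Lemma cnorm_fdiff h f : CLp f -> cnorm p (fdiff h f) <= 2 * cnorm p f.
Proof.
move=> Bf; have [Bs ns] := CLp_shift f h Bf.
apply: le_trans (cnormB p _ _ p1 (CLp_Lp _ Bs) (CLp_Lp _ Bf)) _.
by rewrite mulr_natl mulr2n lerD2r.
Qed.

Lemma CLp_iter_fdiff k h f : CLp f -> CLp (iter k (fdiff h) f).
Proof. by move=> Bf; elim: k => [//|k IH]; exact: CLp_fdiff. Qed.

Lemma cnorm_iter_fdiff k h f : CLp f -> cnorm p (iter k (fdiff h) f) <= 2 ^+ k * cnorm p f.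
Proof.
move=> Bf; elim: k => [|k IH]; first by rewrite expr0 mul1r.
apply: le_trans (cnorm_fdiff _ _ (CLp_iter_fdiff k h f Bf)) _.
by rewrite exprS -mulrA ler_pM2l.
Qed.

Lemma fdiffB h f g : fdiff h (fun x => f x - g x) = fun x => fdiff h f x - fdiff h g x.
Proof. by apply/funext => x; rewrite /fdiff; ring. Qed.

Lemma iter_fdiffB k h f g :
  iter k (fdiff h) (fun x => f x - g x) = fun x => iter k (fdiff h) f x - iter k (fdiff h) g x.
Proof. by elim: k => [//|k IH]; rewrite !iterS IH fdiffB. Qed.

Lemma fdiff_mulr_nat m h f x :
  fdiff (m%:R * h) f x = \sum_(i < m) fdiff h f (x + i%:R * h).
Proof.
elim: m => [|m IH]; first by rewrite big_ord0 mul0r /fdiff addr0 subrr.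
rewrite big_ord_recr /= -IH /fdiff -natr1 mulrDl mul1r addrA; ring.
Qed.

Lemma cnorm_fdiff_mul m h f : CLp f -> cnorm p (fdiff (m%:R * h) f) <= m%:R * cnorm p (fdiff h f).
Proof.
move=> Bf; have Bd := CLp_fdiff h f Bf.
rewrite (_ : fdiff (m%:R * h) f = fun x => \sum_(i < m) (fun x => fdiff h f (x + i%:R * h)) x); last first.
  by apply/funext => x; exact: fdiff_mulr_nat.
apply: le_trans (cnorm_sum p _ _ _ (fun (i : 'I_m) x => fdiff h f (x + i%:R * h)) p1 _) _.
  by move=> i _; apply: CLp_Lp; have [] := CLp_shift _ (i%:R * h) Bd.
apply: (@le_trans _ _ (\sum_(i < m) cnorm p (fdiff h f))).
  by apply: ler_sum => i _; have [] := CLp_shift _ (i%:R * h) Bd.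
by rewrite sumr_const card_ord mulr_natl.
Qed.

Lemma iter_fdiff_comm k h h' f : iter k (fdiff h) (fdiff h' f) = fdiff h' (iter k (fdiff h) f).
Proof.
elim: k => [//|k IH]; rewrite !iterS IH; apply/funext => x; rewrite /fdiff.
by rewrite (addrAC x h h'); ring.
Qed.

(** A difference with step [m h] is the sum of [m] translates of the
    difference with step [h]. *)
Lemma cnorm_iter_fdiff_mul k m h f : CLp f ->
  cnorm p (iter k (fdiff (m%:R * h)) f) <= m%:R ^+ k * cnorm p (iter k (fdiff h) f).
Proof.
elim: k f => [|k IH] f Bf; first by rewrite expr0 mul1r.
rewrite iterSr; apply: le_trans (IH _ (CLp_fdiff _ _ Bf)) _.
rewrite exprSr -mulrA ler_wpM2l ?exprn_ge0//.
rewrite iter_fdiff_comm iterSr iter_fdiff_comm.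
exact: cnorm_fdiff_mul (CLp_iter_fdiff _ _ _ Bf).
Qed.

Lemma rnorm_re f : CLp f -> RLp p (reF f) /\ rnorm p (reF f) <= cnorm p f.
Proof.
move=> Bf; case: (Bf) => pf m1 m2 Lf.
have h : (Lp_norm p (toC (reF f)) <= (cnorm p f)%:E)%E.
  rewrite -(cnormE _ _ Lf); apply: le_Lp_norm => //; [exact: lmeas_toC|by case: Lf|].
  move=> x; rewrite normc_real normcE_sqrt -sqrtr_sqr ler_sqrt ?addr_ge0 ?sqr_ge0//.
  by rewrite lerDl sqr_ge0.
split; last by rewrite rnormE; exact: cnorm_le h.
split => //; first by move=> x; rewrite /reF pf.
by apply: LpE h; exact: lmeas_toC.
Qed.

Lemma rnorm_im f : CLp f -> RLp p (imF f) /\ rnorm p (imF f) <= cnorm p f.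
Proof.
move=> Bf; case: (Bf) => pf m1 m2 Lf.
have h : (Lp_norm p (toC (imF f)) <= (cnorm p f)%:E)%E.
  rewrite -(cnormE _ _ Lf); apply: le_Lp_norm => //; [exact: lmeas_toC|by case: Lf|].
  move=> x; rewrite normc_real normcE_sqrt -sqrtr_sqr ler_sqrt ?addr_ge0 ?sqr_ge0//.
  by rewrite lerDr sqr_ge0.
split; last by rewrite rnormE; exact: cnorm_le h.
split => //; first by move=> x; rewrite /imF pf.
by apply: LpE h; exact: lmeas_toC.
Qed.

Definition ofReIm u v : R -> R[i] := fun x => (u x +i* v x)%C.

Lemma ofReImE u v : ofReIm u v = fun x => toC u x + (0 +i* 1)%C * toC v x.
Proof.
apply/funext => x; apply/eqP; rewrite eq_complex ReD ImD ReM ImM /=.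
by apply/andP; split; apply/eqP; ring.
Qed.

Lemma normc_i : normc (0 +i* 1 : R[i])%C = 1.
Proof. by rewrite normcE_sqrt /= expr0n expr1n add0r sqrtr1. Qed.

Lemma CLp_ofReIm u v : RLp p u -> RLp p v ->
  CLp (ofReIm u v) /\ cnorm p (ofReIm u v) <= rnorm p u + rnorm p v.
Proof.
move=> [pu mu_ Lu] [pv mv Lv]; have Liv := LpZ p (0 +i* 1)%C _ p1 Lv.
split.
  split => //; first by move=> x; rewrite /ofReIm pu pv.
  by rewrite ofReImE; exact: LpD.
rewrite ofReImE; apply: le_trans (cnormD p _ _ p1 Lu Liv) _.
by rewrite cnormZ// normc_i mul1r -!rnormE.
Qed.

Lemma reim f : ofReIm (reF f) (imF f) = f.
Proof. by apply/funext => x; rewrite /ofReIm /reF /imF; case: (f x). Qed.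

End ComplexClass.

(** * Quadrature weights for the derivative of a trigonometric polynomial *)

Section TrigExp.
Context {R : realType}.
Implicit Types (l m : int) (x y t : R).

Lemma Re_trig l x : complex.Re (trig_exp l x) = cos (2 * pi * l%:~R * x).
Proof. by []. Qed.

Lemma Im_trig l x : complex.Im (trig_exp l x) = sin (2 * pi * l%:~R * x).
Proof. by []. Qed.

Lemma complex_ext (a b : R[i]) : complex.Re a = complex.Re b ->
  complex.Im a = complex.Im b -> a = b.
Proof. by case: a => ? ?; case: b => ? ? /= -> ->. Qed.

Lemma trig_expD l x y : trig_exp l (x + y) = trig_exp l x * trig_exp l y.
Proof.
apply: complex_ext; rewrite ?ReM ?ImM !Re_trig !Im_trig mulrDr ?cosD ?sinD//.
by rewrite addrC.
Qed.

Lemma trig_exp_addl l m x : trig_exp (l + m) x = trig_exp l x * trig_exp m x.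
Proof.
apply: complex_ext; rewrite ?ReM ?ImM !Re_trig !Im_trig rmorphD mulrDr mulrDl ?cosD ?sinD//.
by rewrite addrC.
Qed.

Lemma trig_exp0 l : trig_exp l 0 = 1 :> R[i].
Proof. by apply: complex_ext; rewrite ?Re_trig ?Im_trig mulr0 ?cos0 ?sin0. Qed.

Lemma trig_exp_zero x : trig_exp 0 x = 1 :> R[i].
Proof. by apply: complex_ext; rewrite ?Re_trig ?Im_trig mulr0 mul0r ?cos0 ?sin0. Qed.

Lemma trig_exp_nat l x (k : nat) : trig_exp l (k%:R * x) = trig_exp l x ^+ k.
Proof.
elim: k => [|k IH]; first by rewrite mul0r trig_exp0 expr0.
by rewrite -natr1 mulrDl mul1r trig_expD IH exprSr.
Qed.

Lemma cos_period_nat t (k : nat) : cos (t + 2 * pi * k%:R) = cos t.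
Proof.
elim: k => [|k IH]; first by rewrite mulr0 addr0.
have -> : t + 2 * pi * k.+1%:R = t + 2 * pi * k%:R + pi *+ 2.
  by rewrite -natr1 -mulr_natl; ring.
by rewrite cosD2pi.
Qed.

Lemma sin_period_nat t (k : nat) : sin (t + 2 * pi * k%:R) = sin t.
Proof.
elim: k => [|k IH]; first by rewrite mulr0 addr0.
have -> : t + 2 * pi * k.+1%:R = t + 2 * pi * k%:R + pi *+ 2.
  by rewrite -natr1 -mulr_natl; ring.
by rewrite sinD2pi.
Qed.

Lemma trig_exp1 l : trig_exp l 1 = 1 :> R[i].
Proof.
apply: complex_ext; rewrite ?Re_trig ?Im_trig mulr1; case: l => k.
- by rewrite -[in LHS]pmulrn -[X in cos X]add0r cos_period_nat cos0.
- by rewrite NegzE mulrNz mulrN cosN -pmulrn -[X in cos X]add0r cos_period_nat cos0.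
- by rewrite -[in LHS]pmulrn -[X in sin X]add0r sin_period_nat sin0.
- by rewrite NegzE mulrNz mulrN sinN -pmulrn -[X in sin X]add0r sin_period_nat sin0 oppr0.
Qed.

Lemma trig_exp_periodic l x : trig_exp l (x + 1) = trig_exp l x :> R[i].
Proof. by rewrite trig_expD trig_exp1 mulr1. Qed.

(** If the cosine of [2 pi m / N] were 1, the sine of half that angle would
    vanish; but the half angle is, up to sign, strictly between 0 and [pi]. *)
Lemma trig_exp_neq1 m (N : nat) : (0 < `|m| < N)%N ->
  trig_exp m (N%:R^-1 : R) != 1.
Proof.
move=> /andP[m0 mN]; apply/eqP => /(congr1 (@complex.Re R)); rewrite Re_trig /= => h.
have N0 : 0 < N%:R :> R by rewrite ltr0n (leq_ltn_trans _ mN).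
pose a : R := pi * (`|m|%N)%:R / N%:R.
have ha : cos (a *+ 2) = 1.
  rewrite -h /a; case: m m0 mN {h a} => k _ _ /=.
    by rewrite -mulr_natl -pmulrn; congr cos; ring.
  rewrite NegzE mulrNz mulrN mulNr cosN -pmulrn -mulr_natl; congr cos; ring.
have sa : sin a = 0.
  have s2 : sin a ^+ 2 = 0.
    by have := cos2Dsin2 a; move: ha; rewrite cos_mulr2n -mulr_natl; lra.
  by apply/eqP; rewrite -sqrf_eq0 s2.
have : 0 < sin a.
  apply: sin_gt0_pi; apply/andP; split.
    by rewrite /a divr_gt0// mulr_gt0 ?pi_gt0// ltr0n.
  by rewrite /a ltr_pdivrMr// ltr_pM2l ?pi_gt0// ltr_nat.
by rewrite sa ltxx.
Qed.

Lemma trig_orthogonality m (N : nat) : (`|m| < N)%N ->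
  \sum_(j < N) trig_exp m (j%:R * N%:R^-1 : R) = (if m == 0 then N%:R else 0).
Proof.
move=> mN; have N0 : (0 < N)%N by exact: leq_ltn_trans mN.
have N0R : N%:R != 0 :> R by rewrite pnatr_eq0 -lt0n.
case: eqP => [->|/eqP m0].
  by under eq_bigr do rewrite trig_exp_zero; rewrite sumr_const card_ord.
set z := trig_exp m (N%:R^-1 : R).
have zN : z ^+ N = 1 by rewrite -trig_exp_nat mulfV// trig_exp1.
have z1 : z - 1 != 0.
  by rewrite subr_eq0; apply: trig_exp_neq1; rewrite mN andbT absz_gt0.
under eq_bigr do rewrite trig_exp_nat -/z.
have := subrX1 z N; rewrite zN subrr => /esym/eqP.
by rewrite mulf_eq0 (negbTE z1) => /eqP.
Qed.

End TrigExp.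

Section BernsteinWeights.
Context {R : realType} (n : nat).
Hypothesis n0 : (0 < n)%N.
Local Notation N := (4 * n)%N.

Definition node (j : nat) : R := j%:R * N%:R^-1.

Definition fejer (x : R) : R[i] :=
  \sum_(a < n) \sum_(b < n) trig_exp (a%:Z - b%:Z) x.

(** Fejer's kernel modulated by [e_n - e_(-n)]: its Fourier coefficients follow
    a straight line through the origin on [-n, ..., n]. *)
Definition bweight (j : nat) : R[i] :=
  (N%:R^-1 * n%:R^-1) * fejer (node j) *
  (trig_exp n%:Z (node j) - trig_exp (- n%:Z) (node j)).

Let n0R : n%:R != 0 :> R[i]. Proof. by rewrite pnatr_eq0 -lt0n. Qed.
Let N0R : N%:R != 0 :> R[i]. Proof. by rewrite pnatr_eq0 -lt0n muln_gt0. Qed.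

(** The frequencies of the product are below [4 n] in absolute value, so the
    sum over [4 n] equidistant nodes retains the constant term only. *)
Lemma fejer_coef (m : int) : (`|m| <= 2 * n)%N ->
  \sum_(j < N) fejer (node j) * trig_exp m (node j) =
  N%:R * (n - `|m|)%N%:R :> R[i].
Proof.
move=> mn; rewrite /fejer.
under eq_bigr => j _.
  rewrite mulr_suml; under eq_bigr do rewrite mulr_suml.
  under eq_bigr do under eq_bigr do rewrite -trig_exp_addl.
  over.
rewrite exchange_big /=; under eq_bigr do rewrite exchange_big /=.
have E (a b : 'I_n) : \sum_(j < N) trig_exp (a%:Z - b%:Z + m) (node j) =
    (if (a%:Z - b%:Z + m == 0)%R then N%:R else 0) :> R[i].
  apply: trig_orthogonality; have := ltn_ord a; have := ltn_ord b.
  by move: mn n0; lia.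
under eq_bigr do under eq_bigr do rewrite E.
have count (k : nat) : (k <= 2 * n)%N ->
   (\sum_(a < n) \sum_(b < n) (a + k == b :> nat) = n - k)%N.
  move=> kn.
  transitivity (\sum_(a < n) (a + k < n))%N.
    apply: eq_bigr => a _; case: ltnP => akn.
      rewrite (bigD1 (Ordinal akn)) //= eqxx big1 ?addn0// => b bn.
      apply/eqP; rewrite eqb0; apply: contra bn => /eqP h; apply/eqP/val_inj => /=; by rewrite h.
    rewrite big1// => b _; apply/eqP; rewrite eqb0; apply/eqP => h.
    by have := ltn_ord b; rewrite -h ltnNge akn.
  rewrite -(big_mkord xpredT (fun a => (a + k < n : nat))).
  case: (leqP k n) => kn'.
    rewrite (@big_cat_nat _ _ _ (n - k))//=; last exact: leq_subr.
    rewrite (eq_big_nat _ _ (F2 := fun=> 1%N)); last by move=> i; lia.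
    rewrite [X in (_ + X)%N](eq_big_nat _ _ (F2 := fun=> 0%N)); last by move=> i; lia.
    by rewrite !sum_nat_const_nat; lia.
  rewrite (eq_big_nat _ _ (F2 := fun=> 0%N)); last by move=> i; lia.
  by rewrite sum_nat_const_nat; lia.
have count' : (\sum_(a < n) \sum_(b < n) (a%:Z - b%:Z + m == 0)%R = n - `|m|)%N.
  case: m mn {E} => k kn /=.
    rewrite exchange_big /=; rewrite -[RHS](count k)// exchange_big /=.
    rewrite exchange_big /=; rewrite exchange_big /=.
    apply: eq_bigr => a _; apply: eq_bigr => b _; congr nat_of_bool; apply/eqP/eqP; lia.
  rewrite exchange_big /= -[RHS](count k.+1)//.
  apply: eq_bigr => a _; apply: eq_bigr => b _; congr nat_of_bool; apply/eqP/eqP; lia.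
rewrite -count' mulrC natr_sum mulr_suml; apply: eq_bigr => a _.
rewrite natr_sum mulr_suml; apply: eq_bigr => b _.
by case: eqP => _; rewrite ?mul1r ?mul0r.
Qed.

Lemma bweight_multiplier (l : int) : (`|l| <= n)%N ->
  \sum_(j < N) bweight j * trig_exp l (node j) = - (l%:~R / n%:R).
Proof.
move=> ln.
have E (j : nat) : bweight j * trig_exp l (node j) = (N%:R^-1 * n%:R^-1) *
   (fejer (node j) * trig_exp (n%:Z + l) (node j) -
    fejer (node j) * trig_exp (- n%:Z + l) (node j)).
  by rewrite /bweight !trig_exp_addl; ring.
under eq_bigr do rewrite E.
rewrite -mulr_sumr sumrB !fejer_coef; [|lia|lia].
have cancel (F : fieldType) (A B x y : F) : A != 0 -> B != 0 ->
    A^-1 * B^-1 * (A * x - A * y) = (x - y) / B.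
  by move=> A0 B0; field; rewrite A0 B0.
rewrite cancel// -mulNr; congr (_ / _).
case: l ln {E} => k /= kn.
  have -> : (n - `|(n%:Z + k%:Z)%R|)%N = 0%N by lia.
  have -> : (n - `|(- n%:Z + k%:Z)%R|)%N = k by lia.
  by rewrite sub0r -pmulrn.
have -> : (n - `|(n%:Z + Negz k)%R|)%N = k.+1 by lia.
have -> : (n - `|(- n%:Z + Negz k)%R|)%N = 0%N by lia.
by rewrite subr0 NegzE mulrNz opprK -pmulrn.
Qed.

(** The kernel is a sum times its conjugate, hence nonnegative. *)
Lemma fejer_real x : fejer x = (normc (fejer x))%:C%C.
Proof.
pose P := \sum_(a < n) trig_exp a%:Z x.
pose Q := \sum_(a < n) trig_exp (- a%:Z) x.
have -> : fejer x = P * Q.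
  rewrite /fejer mulr_suml; apply: eq_bigr => a _; rewrite mulr_sumr.
  by apply: eq_bigr => b _; rewrite trig_exp_addl.
have ReS (F : 'I_n -> R[i]) : complex.Re (\sum_(i < n) F i) = \sum_(i < n) complex.Re (F i).
  exact: raddf_sum.
have ImS (F : 'I_n -> R[i]) : complex.Im (\sum_(i < n) F i) = \sum_(i < n) complex.Im (F i).
  exact: raddf_sum.
have reQ : complex.Re Q = complex.Re P.
  rewrite /P /Q !ReS; apply: eq_bigr => a _ /=.
  by rewrite rmorphN mulrN mulNr cosN.
have imQ : complex.Im Q = - complex.Im P.
  rewrite /P /Q !ImS -sumrN; apply: eq_bigr => a _ /=.
  by rewrite rmorphN mulrN mulNr sinN.
have E : P * Q = (complex.Re P ^+ 2 + complex.Im P ^+ 2)%:C%C.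
  apply: complex_ext; rewrite ?ReM ?ImM reQ imQ /=; ring.
by rewrite E normc_real ger0_norm// addr_ge0 ?sqr_ge0.
Qed.

(** As the kernel is nonnegative, the sum of its moduli over the nodes is its
    coefficient of order 0, up to the factor [4 n]. *)
Lemma sum_bweight : \sum_(j < N) normc (bweight j) <= 2.
Proof.
have nc (k : nat) : normc (k%:R : R[i]) = k%:R.
  by rewrite -(rmorph_nat (@real_complex R)) normc_real normr_nat.
have ncV (k : nat) : normc ((k%:R)^-1 : R[i]) = k%:R^-1.
  by rewrite normcV nc.
have t1 m (x : R) : normc (trig_exp m x) = 1.
  by rewrite normcE_sqrt Re_trig Im_trig cos2Dsin2 sqrtr1.
apply: (@le_trans _ _ (\sum_(j < N) (N%:R^-1 * n%:R^-1 * 2) * normc (fejer (node j)))).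
  apply: ler_sum => j _; rewrite /bweight !normcM !ncV.
  rewrite mulrAC ler_wpM2r ?normc_ge0// ler_wpM2l ?mulr_ge0 ?invr_ge0//.
  by apply: le_trans (le_normcD _ _) _; rewrite normcN !t1.
rewrite -mulr_sumr.
have -> : \sum_(j < N) normc (fejer (node j)) = N%:R * n%:R.
  have := fejer_coef 0 (leq0n _).
  under eq_bigr do rewrite trig_exp_zero mulr1 fejer_real.
  rewrite subn0 -!(rmorph_nat (@real_complex R)) -rmorph_sum -rmorphM.
  by move/(congr1 (@complex.Re R)).
have a0 : n%:R != 0 :> R by rewrite pnatr_eq0 -lt0n.
have b0 : N%:R != 0 :> R by rewrite pnatr_eq0 -lt0n muln_gt0.
by rewrite le_eqVlt; apply/orP; left; apply/eqP; field; rewrite -?natrM ?a0 ?b0.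
Qed.

End BernsteinWeights.

(** * Bernstein's inequality and the modulus of smoothness *)

Section Bernstein.
Context {R : realType} (p : R).
Hypothesis p1 : 1 <= p.
Let p0 : 0 < p. Proof. exact: lt_le_trans p1. Qed.
Implicit Types (l : int) (c : R[i]) (f U : R -> R[i]).

Lemma ftc_smear (a a' : R -> R) h (x : R) : 0 < h -> continuous a' ->
  (forall y : R, is_derive y 1 a (a' y)) -> fdiff h a x = h * smear h 1 a' x.
Proof.
move=> h0 ca' da.
have ca : continuous a.
  by move=> y; apply: differentiable_continuous; apply/derivable1_diffP; have [] := da y.
have lu := locint_continuous a' ca'.
rewrite smearE//; last exact: continuous_measurable_fun.
rewrite mul1r mulrA mulfV ?gt_eqF// mul1r.
have xh : x < x + h by rewrite ltrDl.
rewrite /Rintegral (@continuous_FTC2 R a' a x (x + h))//.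
- exact: continuous_subspaceT.
- split.
  + by move=> y _; have [] := da y.
  + by apply: cvg_at_right_filter; exact: ca.
  + by apply: cvg_at_left_filter; exact: ca.
- by move=> y _; rewrite derive1E; have [] := da y.
Qed.

Definition freq l : R[i] := (0 +i* (2 * pi * l%:~R))%C.

Lemma is_derive_cosM (a x : R) : is_derive x 1 (fun y => cos (a * y)) (- (a * sin (a * x))).
Proof.
have d1 : is_derive x 1 (fun y : R => a * y) a.
  by apply: is_derive_eq (is_deriveZ a (is_derive_id x 1)) _; rewrite /GRing.scale /= mulr1.
apply: is_derive_eq (is_derive1_comp (is_derive_cos (a * x)) d1) _.
by rewrite mulNr mulrC.
Qed.

Lemma is_derive_sinM (a x : R) : is_derive x 1 (fun y => sin (a * y)) (a * cos (a * x)).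
Proof.
have d1 : is_derive x 1 (fun y : R => a * y) a.
  by apply: is_derive_eq (is_deriveZ a (is_derive_id x 1)) _; rewrite /GRing.scale /= mulr1.
apply: is_derive_eq (is_derive1_comp (is_derive_sin (a * x)) d1) _.
by rewrite mulrC.
Qed.

Lemma is_derive_re_trig c l (x : R) :
  is_derive x 1 (reF (fun y => c * trig_exp l y)) (reF (fun y => freq l * (c * trig_exp l y)) x).
Proof.
pose a : R := 2 * pi * l%:~R.
have -> : reF (fun y => c * trig_exp l y) =
    (fun y => complex.Re c * cos (a * y)) - (fun y => complex.Im c * sin (a * y)).
  by apply/funext => y; rewrite /reF ReM.
have d1 := is_deriveZ (complex.Re c) (is_derive_cosM a x).
have d2 := is_deriveZ (complex.Im c) (is_derive_sinM a x).
apply: is_derive_eq (is_deriveB d1 d2) _.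
rewrite /reF !ReM ImM Re_trig Im_trig /= /GRing.scale /= /a; ring.
Qed.

Lemma is_derive_im_trig c l (x : R) :
  is_derive x 1 (imF (fun y => c * trig_exp l y)) (imF (fun y => freq l * (c * trig_exp l y)) x).
Proof.
pose a : R := 2 * pi * l%:~R.
have -> : imF (fun y => c * trig_exp l y) =
    (fun y => complex.Re c * sin (a * y)) + (fun y => complex.Im c * cos (a * y)).
  by apply/funext => y; rewrite /imF ImM.
have d1 := is_deriveZ (complex.Re c) (is_derive_sinM a x).
have d2 := is_deriveZ (complex.Im c) (is_derive_cosM a x).
apply: is_derive_eq (is_deriveD d1 d2) _.
rewrite /imF !ImM ReM Re_trig Im_trig /= /GRing.scale /= /a; ring.
Qed.

Lemma continuous_derive (a a' : R -> R) : (forall y : R, is_derive y 1 a (a' y)) -> continuous a.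
Proof.
by move=> da y; apply: differentiable_continuous; apply/derivable1_diffP; have [] := da y.
Qed.

Lemma normc_trig l (x : R) : normc (trig_exp l x) = 1.
Proof. by rewrite normcE_sqrt Re_trig Im_trig cos2Dsin2 sqrtr1. Qed.

Lemma RLp_cst1 : RLp p (fun=> 1 : R).
Proof.
apply: (RLpI p (fun=> 1) 1 p0 ler01 _ _ _).1 => //.
rewrite /Pint normr1 powR1 integral_cst//= lebesgue_measure_itv/= lte_fin ltr01.
by rewrite oppr0 adde0 mule1.
Qed.

Lemma CLp_trig l : CLp p (trig_exp l).
Proof.
have e1 : (trig_exp l : R -> R[i]) = (fun y => 1 * trig_exp l y) by apply/funext => y; rewrite mul1r.
apply: CLpI => //.
- by move=> x; exact: trig_exp_periodic.
- apply: continuous_measurable_fun; rewrite e1.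
  exact: (continuous_derive _ _ (fun y => is_derive_re_trig 1 l y)).
- apply: continuous_measurable_fun; rewrite e1.
  exact: (continuous_derive _ _ (fun y => is_derive_im_trig 1 l y)).
- rewrite (_ : (fun x => _) = fun=> 1); first exact: RLp_cst1.
  by apply/funext => x; rewrite normc_trig.
Qed.

Lemma CLp0 : CLp p (fun=> 0).
Proof.
rewrite (_ : (fun=> 0) = fun x => 0 * trig_exp 0 x); first exact: CLpZ (CLp_trig 0).
by apply/funext => x; rewrite mul0r.
Qed.

Lemma CLp_sum (I : Type) (s : seq I) (F : I -> R -> R[i]) :
  (forall i, CLp p (F i)) -> CLp p (fun x => \sum_(i <- s) F i x).
Proof.
move=> BF; elim: s => [|i s IH].
  rewrite (_ : (fun x => _) = fun=> 0); first exact: CLp0.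
  by apply/funext => t; rewrite big_nil.
rewrite (_ : (fun x => _) = (fun t => F i t + \sum_(j <- s) F j t)); last first.
  by apply/funext => t; rewrite big_cons.
exact: CLpD (BF i) IH.
Qed.

Section OnePolynomial.
Variables (n : nat) (c : int -> R[i]).
Hypothesis n0 : (0 < n)%N.

Let fr (j : nat) : int := j%:Z - n%:Z.

Definition tsum (d : int -> R[i]) : R -> R[i] := fun x =>
  \sum_(j < (2 * n).+1) d (fr j) * trig_exp (fr j) x.

Lemma CLp_tsum d : CLp p (tsum d).
Proof. by apply: CLp_sum => j; exact: CLpZ (CLp_trig _). Qed.

Lemma reF_tsum d x : reF (tsum d) x = \sum_(j < (2 * n).+1) reF (fun y => d (fr j) * trig_exp (fr j) y) x.
Proof. exact: raddf_sum. Qed.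

Lemma imF_tsum d x : imF (tsum d) x = \sum_(j < (2 * n).+1) imF (fun y => d (fr j) * trig_exp (fr j) y) x.
Proof. exact: raddf_sum. Qed.

Lemma is_derive_re_tsum d (x : R) :
  is_derive x 1 (reF (tsum d)) (reF (tsum (fun l => freq l * d l)) x).
Proof.
pose F (j : 'I_(2 * n).+1) : R -> R := reF (fun y => d (fr j) * trig_exp (fr j) y).
pose F' (j : 'I_(2 * n).+1) : R := reF (fun y => freq (fr j) * (d (fr j) * trig_exp (fr j) y)) x.
have -> : reF (tsum d) = \sum_(j < (2 * n).+1) F j.
  by apply/funext => y; rewrite fct_sumE reF_tsum.
have -> : reF (tsum (fun l => freq l * d l)) x = \sum_(j < (2 * n).+1) F' j.
  by rewrite reF_tsum; apply: eq_bigr => j _; rewrite /F' /reF mulrA.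
exact: (@is_derive_sum _ _ _ _ F x 1 F' (fun j => is_derive_re_trig (d (fr j)) (fr j) x)).
Qed.

Lemma is_derive_im_tsum d (x : R) :
  is_derive x 1 (imF (tsum d)) (imF (tsum (fun l => freq l * d l)) x).
Proof.
pose F (j : 'I_(2 * n).+1) : R -> R := imF (fun y => d (fr j) * trig_exp (fr j) y).
pose F' (j : 'I_(2 * n).+1) : R := imF (fun y => freq (fr j) * (d (fr j) * trig_exp (fr j) y)) x.
have -> : imF (tsum d) = \sum_(j < (2 * n).+1) F j.
  by apply/funext => y; rewrite fct_sumE imF_tsum.
have -> : imF (tsum (fun l => freq l * d l)) x = \sum_(j < (2 * n).+1) F' j.
  by rewrite imF_tsum; apply: eq_bigr => j _; rewrite /F' /imF mulrA.
exact: (@is_derive_sum _ _ _ _ F x 1 F' (fun j => is_derive_im_trig (d (fr j)) (fr j) x)).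
Qed.

(** Differentiating multiplies the coefficient of frequency [l] by
    [2 pi i l], and so does, by [bweight_multiplier], this sum of translates. *)
Lemma tsum_translates d x : tsum (fun l => freq l * d l) x =
  \sum_(k < 4 * n) ((- n%:R * (0 +i* (2 * pi))%C) * bweight n k) * tsum d (x + node n k).
Proof.
rewrite /tsum; under [in RHS]eq_bigr do rewrite mulr_sumr.
rewrite exchange_big /=; apply: eq_bigr => j _.
under [in RHS]eq_bigr do rewrite trig_expD.
have jn : (`|fr j| <= n)%N by rewrite /fr; have := ltn_ord j; lia.
transitivity (\sum_(k < 4 * n) (- n%:R * (0 +i* (2 * pi))%C * (d (fr j) * trig_exp (fr j) x)) *
   (bweight n k * trig_exp (fr j) (node n k))); last first.
  by apply: eq_bigr => k _; ring.
rewrite -mulr_sumr bweight_multiplier//.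
have nn : n%:R != 0 :> R[i] by rewrite pnatr_eq0 -lt0n.
have -> : freq (fr j) = (0 +i* (2 * pi))%C * (fr j)%:~R.
  rewrite -(rmorph_int (@real_complex R)) /freq; apply: complex_ext; rewrite ?ReM ?ImM /=; ring.
by field.
Qed.

Lemma bernstein_derivative : cnorm p (tsum (fun l => freq l * c l)) <= 4 * pi * n%:R * cnorm p (tsum c).
Proof.
have BU := CLp_tsum c.
have Bk k : CLp p (fun x => tsum c (x + node n k)) by have [] := CLp_shift p p1 _ (node n k) BU.
rewrite (_ : tsum (fun l => _) = fun x => \sum_(k < 4 * n)
   (fun x => ((- n%:R * (0 +i* (2 * pi))%C) * bweight n k) * tsum c (x + node n k)) x); last first.
  by apply/funext => x; exact: tsum_translates.
apply: le_trans (cnorm_sum p _ _ _ (fun (k : 'I_(4 * n)) x => ((- n%:R * (0 +i* (2 * pi))%C) * bweight n k) * tsum c (x + node n k)) p1 _) _.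
  by move=> k _; apply: LpZ => //; exact: CLp_Lp (Bk k).
have nB : normc (- n%:R * (0 +i* (2 * pi))%C : R[i]) = n%:R * (2 * pi).
  rewrite normcM normcN -(rmorph_nat (@real_complex R)) normc_real normr_nat.
  by rewrite normcE_sqrt /= expr0n add0r sqrtr_sqr ger0_norm// mulr_ge0 ?pi_ge0.
apply: (@le_trans _ _ (\sum_(k < 4 * n) (n%:R * (2 * pi) * cnorm p (tsum c)) * normc (bweight n k))).
  apply: ler_sum => k _; rewrite cnormZ//; last exact: CLp_Lp (Bk k).
  have [_ nk] := CLp_shift p p1 _ (node n k) BU.
  rewrite normcM nB -mulrA -[leRHS]mulrA ler_wpM2l//.
    by rewrite !mulr_ge0 ?pi_ge0.
  by rewrite mulrC ler_wpM2r ?normc_ge0.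
rewrite -mulr_sumr.
apply: (@le_trans _ _ ((n%:R * (2 * pi) * cnorm p (tsum c)) * 2)).
  by rewrite ler_wpM2l ?sum_bweight// !mulr_ge0 ?pi_ge0 ?cnorm_ge0.
by rewrite le_eqVlt; apply/orP; left; apply/eqP; ring.
Qed.

(** A difference with step [h] is [h] times a window average of the
    derivative. *)
Lemma bernstein h : 0 < h -> cnorm p (fdiff h (tsum c)) <= 8 * pi * n%:R * h * cnorm p (tsum c).
Proof.
move=> h0; set U := tsum c; set V := tsum (fun l => freq l * c l).
have BU : CLp p U := CLp_tsum c; have BV : CLp p V := CLp_tsum _.
have BF := CLp_fdiff p p1 h U BU.
have [Rr nr] := rnorm_re p p1 V BV; have [Ri ni] := rnorm_im p p1 V BV.
have er : reF (fdiff h U) = fun x => h * smear h 1 (reF V) x.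
  apply/funext => x; rewrite -(ftc_smear (reF U) (reF V) h x h0 (continuous_derive _ _ (is_derive_re_tsum _)) (is_derive_re_tsum c)).
  by rewrite /reF /fdiff ReD; congr (_ + _); case: (U x).
have ei : imF (fdiff h U) = fun x => h * smear h 1 (imF V) x.
  apply/funext => x; rewrite -(ftc_smear (imF U) (imF V) h x h0 (continuous_derive _ _ (is_derive_im_tsum _)) (is_derive_im_tsum c)).
  by rewrite /imF /fdiff ImD; congr (_ + _); case: (U x).
have [Rsr nsr] := RLp_smear p h 1 _ p1 h0 Rr; have [Rsi nsi] := RLp_smear p h 1 _ p1 h0 Ri.
rewrite -(reim (fdiff h U)) er ei.
have [_ hn] := CLp_ofReIm p p1 _ _ (RLpZ p h _ p1 Rsr) (RLpZ p h _ p1 Rsi).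
apply: le_trans hn _; rewrite (rnormZ p h _ p1 Rsr) (rnormZ p h _ p1 Rsi) (ger0_norm (ltW h0)) -mulrDr.
have hV := bernstein_derivative.
rewrite -/U -/V in hV.
apply: (@le_trans _ _ (h * (cnorm p V + cnorm p V))).
  exact: ler_wpM2l (ltW h0) _ _ (lerD (le_trans nsr nr) (le_trans nsi ni)).
apply: (@le_trans _ _ (h * (2 * (4 * pi * n%:R * cnorm p U)))).
  by apply: ler_wpM2l (ltW h0) _ _ _; rewrite -mulr2n -[leLHS]mulr_natl ler_wpM2l.
by rewrite le_eqVlt; apply/orP; left; apply/eqP; ring.
Qed.

End OnePolynomial.

Lemma trig_poly_fdiff n h U : trig_poly n U -> trig_poly n (fdiff h U).
Proof.
move=> [c hc]; exists (fun l => c l * (trig_exp l h - 1)) => x.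
rewrite /fdiff !hc -sumrB; apply: eq_bigr => j _; rewrite trig_expD; ring.
Qed.

Lemma trig_poly_iter_fdiff n k h U : trig_poly n U -> trig_poly n (iter k (fdiff h) U).
Proof. by move=> tU; elim: k => [//|k IH]; exact: trig_poly_fdiff. Qed.

Lemma trig_poly_CLp n U : trig_poly n U -> CLp p U.
Proof.
by move=> [c hc]; rewrite (_ : U = tsum n c); [exact: CLp_tsum|apply/funext => x; rewrite hc].
Qed.

Lemma trig_poly_bernstein n h U : (0 < n)%N -> 0 < h -> trig_poly n U ->
  cnorm p (fdiff h U) <= 8 * pi * n%:R * h * cnorm p U.
Proof.
move=> n0 h0 [c hc]; rewrite (_ : U = tsum n c); first exact: bernstein.
by apply/funext => x; rewrite hc.
Qed.

End Bernstein.

Section Modulus.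
Context {R : realType} (p : R).
Hypothesis p1 : 1 <= p.
Implicit Types (f T : R -> R[i]) (d h : R).

Definition rmodulus s f d : R := fine (modulus s p f d).

Lemma modulus_ub s f d (M : R) : CLp p f ->
  (forall h, 0 < h < d -> cnorm p (iter s (fdiff h) f) <= M) -> (modulus s p f d <= M%:E)%E.
Proof.
move=> Bf HM; apply: ub_ereal_sup => _ [h /= hd <-]; rewrite finite_diffE.
rewrite cnormE ?lee_fin; first by apply: HM; move: hd; rewrite in_itv.
exact: CLp_Lp (CLp_iter_fdiff p p1 s h f Bf).
Qed.

Lemma modulus_lb s f d h : 0 < h < d -> (Lp_norm p (iter s (fdiff h) f) <= modulus s p f d)%E.
Proof.
move=> hd; apply: ereal_sup_ubound; exists h; last by rewrite finite_diffE.
by rewrite /= in_itv.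
Qed.

Lemma modulusE s f d : 0 < d -> CLp p f -> modulus s p f d = (rmodulus s f d)%:E.
Proof.
move=> d0 Bf; rewrite /rmodulus fineK//.
have h1 : (modulus s p f d <= (2 ^+ s * cnorm p f)%:E)%E.
  by apply: modulus_ub => // h _; exact: cnorm_iter_fdiff.
have h2 : (0 <= modulus s p f d)%E.
  apply: le_trans (modulus_lb s f d (d / 2) _); first exact: Lp_norm_ge0.
  by rewrite divr_gt0//= ltr_pdivrMr// ltr_pMr// ltr1n.
by rewrite ge0_fin_numE// (le_lt_trans h1)// ltry.
Qed.

Lemma rmodulus_ub s f d (M : R) : 0 < d -> CLp p f ->
  (forall h, 0 < h < d -> cnorm p (iter s (fdiff h) f) <= M) -> rmodulus s f d <= M.
Proof.
by move=> d0 Bf HM; rewrite -lee_fin -modulusE//; exact: modulus_ub.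
Qed.

Lemma rmodulus_lb s f d h : 0 < h < d -> CLp p f -> cnorm p (iter s (fdiff h) f) <= rmodulus s f d.
Proof.
move=> /[dup] hd /andP[h0 h1] Bf; have d0 := lt_trans h0 h1.
rewrite -lee_fin -modulusE// -cnormE; first exact: modulus_lb.
exact: CLp_Lp (CLp_iter_fdiff p p1 s h f Bf).
Qed.

(** Large enough for [8 pi K / m] to be at most [1 / 2]. *)
Definition stechkin_steps (K : R) : nat := (Num.truncn (16 * pi * K)).+1.

Definition stechkin_const s (K : R) : R :=
  (stechkin_steps K)%:R ^+ s * (2 * K * (2 ^+ s.+1 + 8 * pi * 2 ^+ s)).

Lemma absorb_half (K P M E w w1 t1 t2 : R) : 0 < K -> 0 < P -> 1 <= M ->
  16 * P * K < M -> 0 <= E -> 0 <= w -> 0 <= t2 -> w <= K * w1 ->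
  w1 <= t1 * E + 8 * P / M * (t2 * E + w) -> w <= 2 * K * (t1 + 8 * P * t2) * E.
Proof.
move=> K0 P0 M1 KM E0 w0 t20 h1 h2.
have M0 : 0 < M by exact: lt_le_trans M1.
have q : K * (8 * P / M) <= 2^-1.
  by rewrite mulrA ler_pdivrMr//; lra.
have a1 : K * (8 * P / M) * w <= 2^-1 * w by rewrite ler_wpM2r.
have a2 : 8 * P / M * (t2 * E) <= 8 * P * (t2 * E).
  by rewrite ler_wpM2r ?mulr_ge0// ler_pdivrMr// ler_peMr// mulr_ge0// ltW.
have a3 : K * (8 * P / M * (t2 * E)) <= K * (8 * P * (t2 * E)) by rewrite ler_pM2l.
have a4 : K * w1 <= K * (t1 * E + 8 * P / M * (t2 * E + w)) by rewrite ler_pM2l.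
have e4 : K * (t1 * E + 8 * P / M * (t2 * E + w)) =
   K * t1 * E + K * (8 * P / M * (t2 * E)) + K * (8 * P / M) * w by ring.
have e5 : 2 * K * (t1 + 8 * P * t2) * E = 2 * (K * t1 * E + K * (8 * P * (t2 * E))) by ring.
rewrite e5; rewrite e4 in a4.
move: a1 a3 a4; set z1 := _ * w; set z2 := K * (_ * _); set z3 := K * (_ * _); set z4 := _ * E; lra.
Qed.

(** Differences of [T] lose a factor [n h] at each order, so the [(s + 1)]-st
    modulus of [f] at [1 / (n m)] is at most a multiple of the error plus a
    small multiple of the [s]-th modulus, and the relation between the two
    moduli lets the latter be absorbed. *)
Lemma modulus_le_error s K f T n : 0 < K -> (0 < n)%N -> CLp p f -> trig_poly n T ->
  (forall h, 0 < h -> (modulus s p f h <= K%:E * modulus s.+1 p f h)%E) ->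
  rmodulus s f n%:R^-1 <= stechkin_const s K * cnorm p (fun x => f x - T x).
Proof.
move=> K0 n0 Bf tT HK.
have BT := trig_poly_CLp p p1 n T tT; have Bd := CLpB p p1 f T Bf BT.
set E := cnorm p (fun x => f x - T x).
have E0 : 0 <= E by exact: cnorm_ge0.
set m := stechkin_steps K.
have m0 : 0 < m%:R :> R by rewrite ltr0n.
have n0R : 0 < n%:R :> R by rewrite ltr0n.
(* a step at which Bernstein's inequality gains the factor [8 pi / m] *)
pose h0 : R := n%:R^-1 / m%:R.
have h00 : 0 < h0 by rewrite divr_gt0// invr_gt0.
have HKW : rmodulus s f h0 <= K * rmodulus s.+1 f h0.
  by have := HK h0 h00; rewrite !modulusE// -EFinM lee_fin.
have mK : 16 * pi * K < m%:R by exact: truncnS_gt.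
have pi0 : 0 < pi :> R by exact: pi_gt0.
have key : rmodulus s.+1 f h0 <= 2 ^+ s.+1 * E + 8 * pi / m%:R * (2 ^+ s * E + rmodulus s f h0).
  apply: rmodulus_ub => // h hh; move/andP: (hh) => [hpos hlt].
  have Bf1 := CLp_iter_fdiff p p1 s.+1 h f Bf; have BT1 := CLp_iter_fdiff p p1 s.+1 h T BT.
  have Bd1 := CLp_iter_fdiff p p1 s.+1 h _ Bd.
  have -> : iter s.+1 (fdiff h) f = fun x => iter s.+1 (fdiff h) (fun x => f x - T x) x + iter s.+1 (fdiff h) T x.
    by rewrite iter_fdiffB; apply/funext => x; rewrite subrK.
  apply: le_trans (cnormD p _ _ p1 (CLp_Lp p _ Bd1) (CLp_Lp p _ BT1)) _.
  apply: lerD; first exact: cnorm_iter_fdiff.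
  rewrite iterS; apply: le_trans (trig_poly_bernstein p p1 n h _ n0 hpos (trig_poly_iter_fdiff n s h T tT)) _.
  have hn : n%:R * h <= m%:R^-1.
    have : n%:R * h <= n%:R * h0 by rewrite ler_pM2l// ltW.
    by rewrite /h0 mulrA mulfV ?gt_eqF// mul1r.
  have nT : cnorm p (iter s (fdiff h) T) <= 2 ^+ s * E + rmodulus s f h0.
    have -> : iter s (fdiff h) T = fun x => iter s (fdiff h) f x - iter s (fdiff h) (fun x => f x - T x) x.
      by rewrite iter_fdiffB; apply/funext => x; ring.
    have Bf2 := CLp_iter_fdiff p p1 s h f Bf; have Bd2 := CLp_iter_fdiff p p1 s h _ Bd.
    apply: le_trans (cnormB p _ _ p1 (CLp_Lp p _ Bf2) (CLp_Lp p _ Bd2)) _.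
    rewrite addrC; apply: lerD; [exact: cnorm_iter_fdiff|exact: rmodulus_lb].
  have pp : 0 < 8 * pi :> R by rewrite mulr_gt0.
  apply: ler_pM; [|exact: cnorm_ge0| |exact: nT].
    by apply: mulr_ge0; [apply: mulr_ge0; exact: ltW|exact: ltW].
  by rewrite -mulrA ler_pM2l.
have sm : rmodulus s f h0 <= 2 * K * (2 ^+ s.+1 + 8 * pi * 2 ^+ s) * E.
  have W0 : 0 <= rmodulus s f h0.
    apply: le_trans (rmodulus_lb s f h0 (h0 / 2) _ Bf); first exact: cnorm_ge0.
    by rewrite divr_gt0//= ltr_pdivrMr// ltr_pMr// ltr1n.
  have M1 : 1 <= m%:R :> R by rewrite ler1n.
  exact: (absorb_half K pi m%:R E (rmodulus s f h0) (rmodulus s.+1 f h0) (2 ^+ s.+1) (2 ^+ s) K0 pi0 M1 mK E0 W0 (exprn_ge0 s (ler0n R 2)) HKW key).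
apply: (@le_trans _ _ (m%:R ^+ s * rmodulus s f h0)); last first.
  by rewrite /stechkin_const -mulrA ler_pM2l// exprn_gt0.
apply: rmodulus_ub; [by rewrite invr_gt0|exact: Bf|].
move=> h /andP[hpos hlt].
have -> : h = m%:R * (h / m%:R) by rewrite mulrCA mulfV ?mulr1// gt_eqF.
apply: le_trans (cnorm_iter_fdiff_mul p p1 s m (h / m%:R) f Bf) _.
rewrite ler_pM2l ?exprn_gt0//; apply: rmodulus_lb => //.
by rewrite divr_gt0//= ltr_pM2r// invr_gt0.
Qed.

End Modulus.

(** * Changes on null sets *)

Section AlmostEverywhere.
Context {R : realType}.
Notation mu := (@lebesgue_measure R).
Notation cara := (caratheodory_type ((@wlength R idfun)^*)%mu).
Implicit Types (p d c a h x : R) (f g : R -> R[i]).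

(** Stated with Borel null sets, which stay null under affine changes of
    variable. *)
Definition aeq {T : Type} (u v : R -> T) : Prop :=
  mu.-negligible [set x | u x <> v x].

Lemma aeq_refl {T : Type} (u : R -> T) : aeq u u.
Proof.
rewrite /aeq (_ : [set x | _] = set0); first exact: negligible_set0.
by apply/seteqP; split => x //=; exact.
Qed.

Lemma aeq_comp {T T' : Type} (F : T -> T') (u v : R -> T) : aeq u v ->
  aeq (fun x => F (u x)) (fun x => F (v x)).
Proof. by apply: negligibleS => x /= H E; apply: H; rewrite E. Qed.

Lemma aeq_comp2 {T T' T'' : Type} (F : T -> T' -> T'') (u v : R -> T) (u' v' : R -> T') :
  aeq u v -> aeq u' v' -> aeq (fun x => F (u x) (u' x)) (fun x => F (v x) (v' x)).
Proof.
move=> uv uv'; have := negligibleU uv uv'; apply: negligibleS => x /= H.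
have [E|] := pselect (u x = v x); last by left.
by right=> E'; apply: H; rewrite E E'.
Qed.

Lemma aeq_affine {T : Type} (u v : R -> T) a c : 0 < c -> aeq u v ->
  aeq (fun t => u (a + c * t)) (fun t => v (a + c * t)).
Proof.
move=> c0 [N [mN N0 uvN]]; exists (affine a c @^-1` N); split.
- by rewrite -[X in measurable X]setTI; apply: measurable_affine.
- exact: null_affine.
- by move=> t /= H; apply: uvN.
Qed.

Lemma aeq_shift {T : Type} (u v : R -> T) a : aeq u v ->
  aeq (fun t => u (t + a)) (fun t => v (t + a)).
Proof.
move=> uv; have := aeq_affine u v a 1 ltr01 uv.
by apply: negligibleS => x /=; rewrite mul1r addrC.
Qed.

Lemma aeq_fdiff h f g : aeq f g -> aeq (fdiff h f) (fdiff h g).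
Proof. by move=> fg; exact: (aeq_comp2 (fun a b : R[i] => a - b) _ _ _ _ (aeq_shift f g h fg) fg). Qed.

Lemma aeq_iter_fdiff k h f g : aeq f g -> aeq (iter k (fdiff h) f) (iter k (fdiff h) g).
Proof. by move=> fg; elim: k => [//|k IH]; exact: aeq_fdiff. Qed.

Lemma aeq_sum (I : Type) (s : seq I) (F G : I -> R -> R[i]) :
  (forall i, aeq (F i) (G i)) -> aeq (fun x => \sum_(i <- s) F i x) (fun x => \sum_(i <- s) G i x).
Proof.
move=> FG; elim: s => [|i s IH].
  rewrite (_ : (fun x => \sum_(i <- [::]) F i x) = (fun x => \sum_(i <- [::]) G i x)); first exact: aeq_refl.
  by apply/funext => x; rewrite !big_nil.
have := aeq_comp2 (fun a b : R[i] => a + b) _ _ _ _ (FG i) IH.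
by apply: negligibleS => x /=; rewrite !big_cons.
Qed.

Lemma aeq_leb {T : Type} (u v : R -> T) (D : set cara) : aeq u v -> ae_eq (@leb R) D v u.
Proof.
move=> [N [mN N0 uvN]]; exists (N : set cara); split.
- by have := @measurable_cara_borel R measurableT N mN; rewrite setTI.
- exact: N0.
- by move=> x /= H; apply: uvN => /= E; apply: H => _; rewrite E.
Qed.

(** By completeness of the measure. *)
Lemma aeq_lmeas (u v : R -> R) : aeq u v -> measurable_fun setT v -> lebesgue_measurable u.
Proof.
move=> uv mv.
apply/measurable_EFinP.
apply: (ae_measurable_fun (@completed_lebesgue_measure_is_complete R) (f := EFin \o v)).
  exact: aeq_leb (aeq_comp EFin u v uv).
by apply/measurable_EFinP; exact: lebesgue_measurableW.
Qed.

Lemma aeq_integral (D : set R) (u v : R -> R) : measurable D -> aeq u v -> measurable_fun setT v ->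
  (\int[leb]_(x in D) (u x)%:E = \int[leb]_(x in D) (v x)%:E)%E.
Proof.
move=> mD uv mv; apply/esym; apply: ae_eq_integral.
- by have := @measurable_cara_borel R measurableT D mD; rewrite setTI.
- by apply: measurable_funTS; apply/measurable_EFinP; exact: lebesgue_measurableW.
- by apply: measurable_funTS; apply/measurable_EFinP; exact: aeq_lmeas uv mv.
- exact: aeq_leb (aeq_comp EFin u v uv).
Qed.

Lemma aeq_Lp_norm p f g : aeq f g -> measurable_fun setT (reF g) -> measurable_fun setT (imF g) ->
  Lp_norm p f = Lp_norm p g.
Proof.
move=> fg mr mi; rewrite /Lp_norm; congr (_ `^ _)%E; apply: aeq_integral.
- exact: measurable_itv.
- exact: (aeq_comp (fun z => normc z `^ p) f g fg).
- by apply: measurableT_comp (measurable_powR _) _; exact: measurable_normc.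
Qed.

(** A Borel version on [[0, 1[[ is continued by periodicity; the exceptional
    set is covered by countably many integer translates of a null set. *)
Lemma periodize_version f : periodic1 f -> lmeas f -> exists g : R -> R[i],
  [/\ periodic1 g, measurable_fun setT (reF g), measurable_fun setT (imF g) & aeq f g].
Proof.
move=> Pf [/borel_version[v [mv [N [mN N0 Nv]]]] /borel_version[w [mw [M [mM M0 Mw]]]]].
pose frac (x : R) : R := x - (Num.floor x)%:~R.
have mfrac : measurable_fun setT frac.
  apply: measurable_funB; first exact: measurable_id.
  apply: nondecreasing_measurable => // x y xy.
  by rewrite ler_int; exact: le_floor.
have frac1 x : frac (x + 1) = frac x.
  rewrite /frac floorDrz ?rpred1// floor1 rmorphD /=; ring.
exists (ofReIm (fun x => v (frac x)) (fun x => w (frac x))); split.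
- by move=> x; rewrite /ofReIm frac1.
- exact: (measurableT_comp mv mfrac).
- exact: (measurableT_comp mw mfrac).
have fint (k : int) x : f (x + k%:~R) = f x.
  exact: periodic_intz.
pose B := N `|` M.
have nB : mu.-negligible B.
  by apply: negligibleU; [exists N|exists M]; split.
have nBk (a : R) : mu.-negligible [set x | B (x + a)].
  have [B' [mB' B0' BB']] := nB; exists (affine a 1 @^-1` B'); split.
  - by rewrite -[X in measurable X]setTI; apply: measurable_affine.
  - exact: null_affine.
  - by move=> x /= /BB'; rewrite /affine mul1r addrC.
apply: (@negligibleS _ _ _ mu (\bigcup_i ([set x | B (x + i%:R)] `|` [set x | B (x + - i%:R)]))); last first.
  by apply: negligible_bigcup => i; apply: negligibleU.
move=> x /= H.
have Bx : B (frac x).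
  apply: contrapT => nBx; apply: H.
  rewrite /ofReIm -Nv; last by move=> ?; apply: nBx; left.
  rewrite -Mw; last by move=> ?; apply: nBx; right.
  by rewrite -(fint (- Num.floor x) x) rmorphN /=; case: (f _).
move: Bx; rewrite /frac; case: (Num.floor x) => k Bx.
  by exists k => //; right; exact: Bx.
by exists k.+1 => //; left; move: Bx; rewrite NegzE rmorphN opprK.
Qed.

End AlmostEverywhere.

(** * Steklov averages and Sobolev classes of complex functions *)

Section SteklovParts.
Context {R : realType} (p : R).
Hypothesis p1 : 1 <= p.
Let p0 : 0 < p. Proof. exact: lt_le_trans p1. Qed.
Notation mu := (@lebesgue_measure R).
Implicit Types (d a x : R) (f g F G : R -> R[i]) (u v : R -> R).

Lemma Re_realM (a : R) (z : R[i]) : complex.Re (a%:C%C * z) = a * complex.Re z.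
Proof. by rewrite ReM /= mul0r subr0. Qed.

Lemma Im_realM (a : R) (z : R[i]) : complex.Im (a%:C%C * z) = a * complex.Im z.
Proof. by rewrite ImM /= mul0r addr0. Qed.

Lemma kernel_reim r g x t :
  \sum_(nu < r) (-1) ^+ nu * ('C((2 * r)%N, nu))%:R * g (x + (r - nu)%N%:R / r%:R * t) =
  ofReIm (fun t => \sum_(nu < r) (-1) ^+ nu * ('C((2 * r)%N, nu))%:R * reF g (x + (r - nu)%N%:R / r%:R * t))
         (fun t => \sum_(nu < r) (-1) ^+ nu * ('C((2 * r)%N, nu))%:R * imF g (x + (r - nu)%N%:R / r%:R * t)) t.
Proof.
have E nu : (-1) ^+ nu * ('C((2 * r)%N, nu))%:R = ((-1) ^+ nu * ('C((2 * r)%N, nu))%:R)%:C%C :> R[i].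
  by rewrite rmorphM rmorphXn rmorphN1 rmorph_nat.
apply: complex_ext; rewrite raddf_sum; apply: eq_bigr => nu _; rewrite E.
- exact: Re_realM.
- exact: Im_realM.
Qed.

Lemma measurable_kernel r u x : measurable_fun setT u ->
  measurable_fun setT (fun t : R => \sum_(nu < r) (-1) ^+ nu * ('C((2 * r)%N, nu))%:R * u (x + (r - nu)%N%:R / r%:R * t)).
Proof.
move=> mu'; apply: measurable_sum => nu; apply: measurable_funM; first exact: measurable_cst.
exact: (measurableT_comp mu' (measurable_affine x _)).
Qed.

Lemma cintegral_aeq a b F G : aeq F G -> measurable_fun setT (reF G) -> measurable_fun setT (imF G) ->
  cintegral a b F = cintegral a b G.
Proof.
move=> FG mr mi; apply: complex_ext; rewrite /= /Rintegral; congr (fine _).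
- apply: (aeq_integral _ (reF F) (reF G) _ (aeq_comp (fun z => complex.Re z) F G FG) mr).
  exact: measurable_itv.
- apply: (aeq_integral _ (imF F) (imF G) _ (aeq_comp (fun z => complex.Im z) F G FG) mi).
  exact: measurable_itv.
Qed.

(** Each value of a Steklov average is an integral, hence blind to null sets. *)
Lemma steklov_aeq d r f g x : aeq f g ->
  measurable_fun setT (reF g) -> measurable_fun setT (imF g) ->
  steklov d r f x = steklov d r g x.
Proof.
move=> fg mr mi; rewrite /steklov; congr (_ * _); apply: cintegral_aeq.
- apply: aeq_sum => nu.
  apply: (aeq_comp (fun z => (-1) ^+ nu * ('C((2 * r)%N, nu))%:R * z)).
  have r0 : (0 < r)%N by exact: leq_ltn_trans (ltn_ord nu).
  apply: aeq_affine fg; rewrite divr_gt0 ?ltr0n//.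
  by rewrite subn_gt0.
- rewrite (_ : reF _ = fun t => \sum_(nu < r) (-1) ^+ nu * ('C((2 * r)%N, nu))%:R * reF g (x + (r - nu)%N%:R / r%:R * t)).
    exact: measurable_kernel.
  by apply/funext => t; rewrite /reF kernel_reim.
- rewrite (_ : imF _ = fun t => \sum_(nu < r) (-1) ^+ nu * ('C((2 * r)%N, nu))%:R * imF g (x + (r - nu)%N%:R / r%:R * t)).
    exact: measurable_kernel.
  by apply/funext => t; rewrite /imF kernel_reim.
Qed.

Lemma Rintegral_leb (D : set R) u : measurable D -> measurable_fun setT u ->
  \int[leb]_(x in D) u x = \int[mu]_(x in D) u x.
Proof.
move=> mD mu'; rewrite /Rintegral; congr fine; apply: integral_leb => //.
by apply: measurable_funTS; exact/measurable_EFinP.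
Qed.

Lemma steklov_rsteklov d r g :
  measurable_fun setT (reF g) -> measurable_fun setT (imF g) ->
  steklov d r g = ofReIm (rsteklov d r (reF g)) (rsteklov d r (imF g)).
Proof.
move=> mr mi; apply/funext => x; rewrite /steklov.
under [X in cintegral _ _ X]eq_fun do rewrite kernel_reim.
have -> : (-1) ^+ r.+1 * ('C((2 * r)%N, r))%:R^-1 * (2 / d)%:C%C =
   ((-1) ^+ r.+1 * ('C((2 * r)%N, r))%:R^-1 * (2 / d))%:C%C :> R[i].
  by rewrite 2![in RHS]rmorphM rmorphXn rmorphN1 fmorphV rmorph_nat.
apply: complex_ext.
- rewrite Re_realM /cintegral /ofReIm /= /rsteklov; congr (_ * _).
  exact: (Rintegral_leb _ _ (measurable_itv _) (measurable_kernel _ _ _ mr)).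
- rewrite Im_realM /cintegral /ofReIm /= /rsteklov; congr (_ * _).
  exact: (Rintegral_leb _ _ (measurable_itv _) (measurable_kernel _ _ _ mi)).
Qed.

Lemma rsteklov_sub d r u v x : 0 < d -> RLp p u -> RLp p v ->
  rsteklov d r (fun x => u x - v x) x = rsteklov d r u x - rsteklov d r v x.
Proof.
move=> d0 Ru Rv.
have Rw : RLp p (fun x => u x - v x).
  rewrite (_ : (fun x => _) = (fun x => u x + -1 * v x)).
    exact: RLpD p _ _ p1 Ru (RLpZ p (-1) _ p1 Rv).
  by apply/funext => y; rewrite mulN1r.
rewrite (rsteklov_smear p d r _ x p1 d0 Rw) (rsteklov_smear p d r u x p1 d0 Ru) (rsteklov_smear p d r v x p1 d0 Rv).
rewrite -sumrB; apply: eq_bigr => nu _; rewrite -mulrBr; congr (_ * _).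
rewrite !smear_avg; apply: avgB; apply: (locint_arg p) => //;
  by apply/ltW/steklov_ratio_gt0.
Qed.

Lemma lp_norm_ofReIm n X u v : (0 < n)%N ->
  lp_norm p n X (ofReIm u v) <= lp_norm p n X (toC u) + lp_norm p n X (toC v).
Proof.
move=> n0; rewrite ofReImE; apply: le_trans (lp_norm_triangle p n X _ _ p1 n0) _.
by rewrite (lp_normZ p n X (toC v) _ p0) normc_i mul1r.
Qed.

End SteklovParts.

Section SobolevClass.
Context {R : realType} (p : R).
Hypothesis p1 : 1 <= p.
Implicit Types (f g : R -> R[i]) (u v : R -> R).

Lemma CLp_in_Lp f : CLp p f -> in_Lp p f.
Proof. by move=> [pf _ _ [[l1 l2] Lf]]. Qed.

Lemma continuous_bounded u : continuous u -> exists2 M : R, 0 < M & forall x, 0 <= x <= 1 -> `|u x| <= M.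
Proof.
move=> cu; have cn : continuous (fun x => `|u x|).
  by move=> x; apply: continuous_comp; [exact: cu|exact: norm_continuous].
have [c _ hc] := EVT_max ler01 (continuous_subspaceT cn).
exists (`|u c| + 1); first by rewrite ltr_wpDl.
move=> x x01; apply: le_trans (hc x _) _; first by rewrite in_itv.
by rewrite lerDl.
Qed.

Lemma lipschitz_of_derive u u' (M : R) : continuous u ->
  (forall x : R, is_derive x 1 u (u' x)) -> (forall x, 0 <= x <= 1 -> `|u' x| <= M) ->
  forall a b, 0 <= a -> a <= b -> b <= 1 -> `|u b - u a| <= M * (b - a).
Proof.
move=> cu du HM a b a0 ab b1.
have [c cab ->] := MVT_segment ab (fun x _ => du x) (continuous_subspaceT cu).
rewrite normrM (ger0_norm (x := b - a)) ?subr_ge0// ler_wpM2r ?subr_ge0//.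
move: cab; rewrite in_itv /= => /andP[ac cb]; apply: HM.
by rewrite (le_trans a0 ac) (le_trans cb b1).
Qed.

Lemma normc_le_add (z : R[i]) : normc z <= `|complex.Re z| + `|complex.Im z|.
Proof.
rewrite normcE_sqrt -[leRHS]ger0_norm ?addr_ge0// -sqrtr_sqr ler_sqrt ?sqr_ge0//.
have -> : (`|complex.Re z| + `|complex.Im z|) ^+ 2 =
    complex.Re z ^+ 2 + complex.Im z ^+ 2 + 2 * (`|complex.Re z| * `|complex.Im z|).
  by rewrite sqrrD !real_normK ?num_real//; ring.
by rewrite lerDl mulr_ge0// mulr_ge0.
Qed.

Lemma abs_continuous_lipschitz f (M : R) : 0 < M ->
  (forall a b, 0 <= a -> a <= b -> b <= 1 -> normc (f b - f a) <= M * (b - a)) ->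
  abs_continuous 0 1 f.
Proof.
move=> M0 HM e e0; exists (e / M); first by rewrite divr_gt0.
move=> m u v uv _ Hd; apply: (@le_lt_trans _ _ (M * \sum_i (v i - u i))).
  by rewrite mulr_sumr; apply: ler_sum => i _; have [? [? ?]] := uv i; exact: HM.
by rewrite mulrC -ltr_pdivlMr.
Qed.

(** The derivative of order [s - 1] has a continuous derivative, so that it is
    Lipschitz on [[0, 1]] and absolutely continuous. *)
Lemma jackson_in_W d s u v : 0 < d -> (0 < s)%N -> RLp p u -> RLp p v ->
  in_W s p (ofReIm (jackson d s u) (jackson d s v)) /\
  cderiven s (ofReIm (jackson d s u) (jackson d s v)) = ofReIm (jackson_der d s u s) (jackson_der d s v s).
Proof.
move=> d0 s0 Ru Rv.
have CD k : (k <= s)%N -> cderiven k (ofReIm (jackson d s u) (jackson d s v)) =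
    ofReIm (jackson_der d s u k) (jackson_der d s v k).
  move=> ks; apply/funext => x.
  rewrite -(derive1n_jackson p d s u p1 d0 Ru k ks).
  by rewrite -(derive1n_jackson p d s v p1 d0 Rv k ks).
split; last exact: CD.
split.
- have [pu _ _] := RLp_jackson p d s u p1 d0 Ru; have [pv _ _] := RLp_jackson p d s v p1 d0 Rv.
  by move=> x; rewrite /ofReIm pu pv.
- move=> k ks; rewrite (CD k (ltnW (ltnW ks))) => x.
  have [du _] := is_derive_jackson_der p d s u p1 d0 Ru k x (ltnW ks).
  by have [dv _] := is_derive_jackson_der p d s v p1 d0 Rv k x (ltnW ks).
- have s1 : (s.-1 < s)%N by rewrite prednK.
  rewrite (CD _ (ltnW s1)).
  have D (w : R -> R) (Rw : RLp p w) (x : R) : is_derive x 1 (jackson_der d s w s.-1) (jackson_der d s w s x).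
    by have := is_derive_jackson_der p d s w p1 d0 Rw s.-1 x s1; rewrite prednK.
  have L (w : R -> R) (Rw : RLp p w) : exists2 M : R, 0 < M & forall a b, 0 <= a -> a <= b -> b <= 1 ->
      `|jackson_der d s w s.-1 b - jackson_der d s w s.-1 a| <= M * (b - a).
    have [M M0 HM] := continuous_bounded _ (continuous_jackson_der p d s w p1 d0 Rw s (leqnn s)).
    exists M => //; apply: lipschitz_of_derive (D w Rw) HM.
    exact: (continuous_jackson_der p d s w p1 d0 Rw _ (ltnW s1)).
  have [M M0 HM] := L u Ru; have [M' M'0 HM'] := L v Rv.
  apply: (abs_continuous_lipschitz _ (M + M')); first exact: addr_gt0.
  move=> a b a0 ab b1; apply: le_trans (normc_le_add _) _; rewrite mulrDl.
  exact: lerD (HM a b a0 ab b1) (HM' a b a0 ab b1).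
- rewrite (CD s (leqnn s)); apply: CLp_in_Lp.
  have Ru' := RLp_jackson_der p d s u p1 d0 Ru s (leqnn s); have Rv' := RLp_jackson_der p d s v p1 d0 Rv s (leqnn s).
  by have [] := CLp_ofReIm p p1 _ _ Ru' Rv'.
Qed.

End SobolevClass.

(** * The smooth approximant of a complex function *)

Lemma le_double {R : realDomainType} (a b c x : R) : a <= b + c -> b <= x -> c <= x -> a <= 2 * x.
Proof. by move=> h1 h2 h3; lra. Qed.

Section Approximant.
Context {R : realType} (p : R).
Hypothesis p1 : 1 <= p.
Let p0 : 0 < p. Proof. exact: lt_le_trans p1. Qed.
Implicit Types (f g : R -> R[i]) (u v : R -> R).

Lemma reF_iter_fdiff k (h : R) g : reF (iter k (fdiff h) g) = iter k (fdiff h) (reF g).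
Proof.
elim: k => [//|k IH]; rewrite !iterS -IH; apply/funext => x.
by rewrite /reF /fdiff raddfB.
Qed.

Lemma imF_iter_fdiff k (h : R) g : imF (iter k (fdiff h) g) = iter k (fdiff h) (imF g).
Proof.
elim: k => [//|k IH]; rewrite !iterS -IH; apply/funext => x.
by rewrite /imF /fdiff raddfB.
Qed.

Lemma rmodulus_ge0 s g (H : R) : 0 < H -> CLp p g -> 0 <= rmodulus p s g H.
Proof.
move=> H0 Bg; apply: le_trans (rmodulus_lb p p1 s g H (H / 2) _ Bg); first exact: cnorm_ge0.
by rewrite divr_gt0//= ltr_pdivrMr// ltr_pMr// ltr1n.
Qed.

(** The modulus is a supremum over positive steps; for step 0 the difference
    vanishes. *)
Lemma rnorm_iter_fdiff_parts s g (H h : R) : (0 < s)%N -> CLp p g -> 0 <= h < H ->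
  rnorm p (iter s (fdiff h) (reF g)) <= rmodulus p s g H /\ rnorm p (iter s (fdiff h) (imF g)) <= rmodulus p s g H.
Proof.
move=> s0 Bg /andP[h0 hH]; have H0 := le_lt_trans h0 hH.
move: h0; rewrite le_eqVlt => /orP[/eqP <-|h0].
  by rewrite !iter_fdiff0// (rnorm0 p p1); split; exact: rmodulus_ge0.
have hh : 0 < h < H by rewrite h0.
have Bd := CLp_iter_fdiff p p1 s h g Bg; have Wl := rmodulus_lb p p1 s g H h hh Bg.
rewrite -reF_iter_fdiff -imF_iter_fdiff; split.
- exact: le_trans (rnorm_re p p1 _ Bd).2 Wl.
- exact: le_trans (rnorm_im p p1 _ Bd).2 Wl.
Qed.

Lemma small_step (k s' : nat) (g m : R) : 0 < g -> g <= 1 -> 0 < m -> (k < s')%N ->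
  k%:R * (g / m / s'%:R) < m^-1.
Proof.
move=> gp gl mp ks; have sp : 0 < s'%:R :> R by rewrite ltr0n (leq_ltn_trans _ ks).
have -> : k%:R * (g / m / s'%:R) = m^-1 * (g * (k%:R / s'%:R)) by ring.
rewrite -[ltRHS]mulr1 ltr_pM2l ?invr_gt0//.
apply: (@le_lt_trans _ _ (1 * (k%:R / s'%:R))).
  by rewrite ler_wpM2r// divr_ge0 ?ler0n.
by rewrite mul1r ltr_pdivrMr// mul1r ltr_nat.
Qed.

Section Data.
Context (gamma : R) (r s n : nat) (X : nat -> R).
Hypotheses (r0 : (0 < r)%N) (s0 : (0 < s)%N) (sr : (s <= 2 * r)%N) (n0 : (0 < n)%N)
  (g0 : 0 < gamma) (g1 : gamma <= 1).
Hypothesis Xsep : separated_nodes gamma n X.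
Let n0R : 0 < n%:R :> R. Proof. by rewrite ltr0n. Qed.

Let Xs k : (1 <= k < n)%N -> X k + gamma / n%:R <= X k.+1.
Proof.
move=> /andP[k1 kn]; have /Xsep : (1 <= k <= n)%N by rewrite k1 ltnW.
by rewrite /next_node (ltn_eqF kn) lerBrDl.
Qed.

Let Xn : X n + gamma / n%:R <= X 1%N + 1.
Proof.
have /Xsep : (1 <= n <= n)%N by rewrite n0 leqnn.
by rewrite /next_node eqxx lerBrDl (addrC 1).
Qed.

Notation d := (jackson_step gamma n s).
Notation Cs := (steklov_const gamma r).
Notation Cj := (sampled_jackson_const gamma r s).

Let d0 : 0 < d.
Proof. by rewrite /jackson_step divr_gt0 ?divr_gt0 ?ltr0n. Qed.

Let gn_le : gamma / n%:R <= n%:R^-1.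
Proof. by rewrite ler_pdivrMr// mulVf ?gt_eqF. Qed.

(** The smooth approximant of [g] at scale [1 / n]. *)
Definition smooth g : R -> R[i] := ofReIm (jackson d s (reF g)) (jackson d s (imF g)).

Section OneFunction.
Context (g : R -> R[i]).
Hypothesis Bg : CLp p g.
Notation w := (rmodulus p s g n%:R^-1).
Let Rre : RLp p (reF g). Proof. by have [] := rnorm_re p p1 g Bg. Qed.
Let Rim : RLp p (imF g). Proof. by have [] := rnorm_im p p1 g Bg. Qed.
Let HWre (h : R) : 0 <= h < n%:R^-1 -> rnorm p (iter s (fdiff h) (reF g)) <= w.
Proof. move=> hh; exact: (rnorm_iter_fdiff_parts s g _ h s0 Bg hh).1. Qed.
Let HWim (h : R) : 0 <= h < n%:R^-1 -> rnorm p (iter s (fdiff h) (imF g)) <= w.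
Proof. move=> hh; exact: (rnorm_iter_fdiff_parts s g _ h s0 Bg hh).2. Qed.
Let dsmall : s.+1%:R * d < n%:R^-1.
Proof. exact: small_step. Qed.
Let dsmall' : s%:R * d < n%:R^-1.
Proof. by apply: small_step. Qed.

Let Jre : RLp p (jackson d s (reF g)). Proof. exact: (RLp_jackson p d s (reF g) p1 d0 Rre). Qed.
Let Jim : RLp p (jackson d s (imF g)). Proof. exact: (RLp_jackson p d s (imF g) p1 d0 Rim). Qed.

Lemma CLp_smooth : CLp p (smooth g).
Proof. by have [] := CLp_ofReIm p p1 _ _ Jre Jim. Qed.

Lemma smooth_in_W : in_W s p (smooth g).
Proof. by have [] := jackson_in_W p p1 d s (reF g) (imF g) d0 s0 Rre Rim. Qed.

Lemma cnorm_sub_smooth : cnorm p (fun x => g x - smooth g x) <= 2 * w.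
Proof.
have [Dre nre] := rnorm_jackson_sub p d _ w s (reF g) p1 d0 Rre HWre dsmall.
have [Dim nim] := rnorm_jackson_sub p d _ w s (imF g) p1 d0 Rim HWim dsmall.
have [_ hn] := CLp_ofReIm p p1 _ _ Dre Dim.
have -> : (fun x => g x - smooth g x) = ofReIm (fun x => reF g x - jackson d s (reF g) x)
   (fun x => imF g x - jackson d s (imF g) x).
  by apply/funext => x; apply: complex_ext; rewrite raddfB.
exact: le_double hn nre nim.
Qed.

Lemma cnorm_deriv_smooth : CLp p (cderiven s (smooth g)) /\
  cnorm p (cderiven s (smooth g)) <= 2 * (2 ^+ s * d ^- s * w).
Proof.
have [_ ->] := jackson_in_W p p1 d s (reF g) (imF g) d0 s0 Rre Rim.
have nre := rnorm_jackson_der_top p d _ w s (reF g) p1 d0 Rre HWre dsmall'.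
have nim := rnorm_jackson_der_top p d _ w s (imF g) p1 d0 Rim HWim dsmall'.
have [B hn] := CLp_ofReIm p p1 _ _ (RLp_jackson_der p d s (reF g) p1 d0 Rre s (leqnn s)) (RLp_jackson_der p d s (imF g) p1 d0 Rim s (leqnn s)).
split; [exact: B|exact: le_double hn nre nim].
Qed.

Notation st := (steklov (gamma / n%:R) r).

Lemma sampled_smooth_sub : lp_norm p n X (fun x => smooth g x - st (smooth g) x) <= 2 * (Cj * w).
Proof.
have [_ mr mi _] := CLp_smooth.
rewrite (steklov_rsteklov _ r _ mr mi).
have -> : (fun x => smooth g x - ofReIm (rsteklov (gamma / n%:R) r (reF (smooth g))) (rsteklov (gamma / n%:R) r (imF (smooth g))) x) =
   ofReIm (fun x => jackson d s (reF g) x - rsteklov (gamma / n%:R) r (jackson d s (reF g)) x)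
          (fun x => jackson d s (imF g) x - rsteklov (gamma / n%:R) r (jackson d s (imF g)) x).
  by apply/funext => x; apply: complex_ext; rewrite raddfB.
apply: le_double (lp_norm_ofReIm p p1 n X _ _ n0) _ _.
- exact: (sampled_jackson p gamma r n X p1 r0 n0 g0 g1 Xs Xn _ w s (reF g) sr Rre HWre gn_le).
- exact: (sampled_jackson p gamma r n X p1 r0 n0 g0 g1 Xs Xn _ w s (imF g) sr Rim HWim gn_le).
Qed.

Lemma steklov_const_ge0 : 0 <= Cs.
Proof.
apply: sumr_ge0 => nu _; rewrite mulr_ge0 ?normr_ge0// invr_ge0 mulr_ge0 ?(ltW g0)//.
exact: ltW (steklov_ratio_gt0 r nu (ltn_ord nu)).
Qed.

Lemma sampled_jackson_const_ge0 : 0 <= Cj.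
Proof.
apply: sumr_ge0 => j _; rewrite mulr_ge0 ?ler0n// mulr_ge0 ?exprn_ge0// invr_ge0.
by rewrite mulr_ge0 ?ler0n// divr_ge0 ?ler0n// ltW.
Qed.

(** The Steklov average of [g - smooth g] samples at the cost of its Lp
    norm. *)
Lemma sampled_steklov_sub : lp_norm p n X (fun x => st g x - st (smooth g) x) <= 2 * (Cs * w).
Proof.
have [_ mr mi _] := CLp_smooth; have [_ mr' mi' _] := Bg.
rewrite (steklov_rsteklov _ r _ mr mi) (steklov_rsteklov _ r _ mr' mi').
have dg : 0 < gamma / n%:R by rewrite divr_gt0.
have [Dre nre] := rnorm_jackson_sub p d _ w s (reF g) p1 d0 Rre HWre dsmall.
have [Dim nim] := rnorm_jackson_sub p d _ w s (imF g) p1 d0 Rim HWim dsmall.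
have -> : (fun x => ofReIm (rsteklov (gamma / n%:R) r (reF g)) (rsteklov (gamma / n%:R) r (imF g)) x -
     ofReIm (rsteklov (gamma / n%:R) r (reF (smooth g))) (rsteklov (gamma / n%:R) r (imF (smooth g))) x) =
   ofReIm (rsteklov (gamma / n%:R) r (fun x => reF g x - jackson d s (reF g) x))
          (rsteklov (gamma / n%:R) r (fun x => imF g x - jackson d s (imF g) x)).
  apply/funext => x; apply: complex_ext; rewrite raddfB /=.
  - by rewrite (rsteklov_sub p p1 _ r _ _ x dg Rre Jre).
  - by rewrite (rsteklov_sub p p1 _ r _ _ x dg Rim Jim).
apply: le_double (lp_norm_ofReIm p p1 n X _ _ n0) _ _.
- apply: le_trans (sampled_rsteklov p gamma r n X p1 n0 g0 g1 Xs Xn _ Dre) _.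
  exact: ler_wpM2l steklov_const_ge0 _ _ nre.
- apply: le_trans (sampled_rsteklov p gamma r n X p1 n0 g0 g1 Xs Xn _ Dim) _.
  exact: ler_wpM2l steklov_const_ge0 _ _ nim.
Qed.

End OneFunction.

End Data.
End Approximant.

(** * The two-sided estimate *)

(** Here [E] is the error, [w] the modulus and [L] the sampled norm of
    [st f - f]; [a], [b], [c] are [|f - h|_p], [|h - G_n h|_p] and the sampled
    norm of [h - f]; [lj] and [lst] are the sampled norms of [h - st h] and of
    [st f - st h]. *)
Lemma two_sided_bound {R : realFieldType} (E w L a b c lst lj A D K1 K2 Cs Cj : R) :
  0 < K1 -> 0 < K2 -> 0 <= A -> 0 < D -> 0 <= Cs -> 0 <= Cj -> 0 <= w -> 0 <= L ->
  a <= 2 * w -> b <= A * w -> lj <= 2 * (Cj * w) -> lst <= 2 * (Cs * w) ->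
  c <= lj + lst + L -> L <= lst + lj + c ->
  K2 * c <= b + a + E -> E <= a + b + K1 * c -> w <= D * E ->
  ((2 * Cs + 2 * Cj + 1 + (A + 2) / K2) * D + K2^-1)^-1 * (L + w) <= E /\
  E <= (2 + A + 2 * K1 * (Cj + Cs) + K1) * (L + w).
Proof.
move=> K10 K20 A0 D0 Cs0 Cj0 w0 L0 ha hb hlj hlst hc hL hE1 hE2 hw.
have [AL CjL CsL] : [/\ 0 <= A * L, 0 <= K1 * (Cj * L) & 0 <= K1 * (Cs * L)].
  by split; rewrite !mulr_ge0// ltW.
have K1c : K1 * c <= K1 * (2 * (Cj * w) + 2 * (Cs * w) + L) by rewrite ler_pM2l//; lra.
split; last by move: (K1c); nra.
have M0 : 0 < (2 * Cs + 2 * Cj + 1 + (A + 2) / K2) * D + K2^-1.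
  rewrite ltr_wpDl ?invr_gt0// mulr_ge0 ?(ltW D0)//.
  by rewrite !addr_ge0 ?mulr_ge0// ?invr_ge0 ?addr_ge0// ltW.
rewrite ler_pdivrMl// mulrDl.
have c1 : c <= (A + 2) / K2 * w + K2^-1 * E.
  have -> : (A + 2) / K2 * w + K2^-1 * E = K2^-1 * ((A + 2) * w + E) by ring.
  by rewrite ler_pdivlMl//; lra.
have h1 : L + w <= (2 * Cs + 2 * Cj + 1 + (A + 2) / K2) * w + K2^-1 * E by lra.
apply: le_trans h1 _; rewrite lerD2r -mulrA ler_wpM2l//.
by rewrite !addr_ge0 ?mulr_ge0// ?invr_ge0 ?addr_ge0// ltW.
Qed.

Lemma scale_cancel {R : fieldType} k (m g q : R) : m != 0 -> q != 0 ->
  m ^- k * (g / m / q) ^- k = (g / q) ^- k.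
Proof. by move=> m0 q0; rewrite -invfM -exprMn; congr ((_ ^+ k)^-1); field; rewrite ?m0 ?q0. Qed.

Lemma le_rearrange {R : realFieldType} (k nk dk b w x : R) : 0 <= k * nk ->
  x <= 2 * (b * dk * w) -> k * nk * x <= k * (2 * (b * (nk * dk))) * w.
Proof.
move=> knk hx; apply: (@le_trans _ _ (k * nk * (2 * (b * dk * w)))); first exact: ler_wpM2l.
by rewrite le_eqVlt; apply/orP; left; apply/eqP; ring.
Qed.

Section SampledNormFacts.
Context {R : realType} (p : R) (n : nat) (X : nat -> R).
Hypotheses (p1 : 1 <= p) (n0 : (0 < n)%N).
Implicit Types (f g h u v : R -> R[i]).
Notation lp := (lp_norm p n X).

Lemma lp_norm_subC u v : lp (fun x => u x - v x) = lp (fun x => v x - u x).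
Proof.
rewrite (_ : (fun x => u x - v x) = (fun x => -1 * (v x - u x))).
  by rewrite (lp_normZ p n X _ _ (lt_le_trans ltr01 p1)) normc_opp1 mul1r.
by apply/funext => x; rewrite mulN1r opprB.
Qed.

Lemma lp_norm_sub3 u v w z :
  lp (fun x => u x - z x) <= lp (fun x => u x - v x) + lp (fun x => v x - w x) + lp (fun x => w x - z x).
Proof.
rewrite (_ : (fun x => u x - z x) = (fun x => (u x - v x) + (v x - w x) + (w x - z x))).
  apply: le_trans (lp_norm_triangle p n X (fun x => (u x - v x) + (v x - w x)) _ p1 n0) _.
  by rewrite lerD2r; exact: (lp_norm_triangle p n X _ _ p1 n0).
by apply/funext => x; ring.
Qed.

End SampledNormFacts.

Section Errors.
Context {R : realType} (p : R).
Hypothesis p1 : 1 <= p.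
Implicit Types (f g h u v : R -> R[i]).

Lemma in_Lp_Lp f : in_Lp p f -> Lp p f.
Proof. by move=> [_ l1 l2 Lf]. Qed.

Lemma in_LpB f g : in_Lp p f -> in_Lp p g -> in_Lp p (fun x => f x - g x).
Proof.
move=> If Ig; have [[l1 l2] L] := LpB p f g p1 (in_Lp_Lp f If) (in_Lp_Lp g Ig).
split=> // x; have [-> _ _ _] := If; by have [-> _ _ _] := Ig.
Qed.

Lemma cnorm_subC u v : Lp p u -> Lp p v -> cnorm p (fun x => u x - v x) = cnorm p (fun x => v x - u x).
Proof.
move=> Lu Lv; rewrite -(cnormN p _ p1 (LpB p v u p1 Lv Lu)).
by congr (cnorm p _); apply/funext => x; rewrite opprB.
Qed.

Lemma cnorm_sub3 u v w z : Lp p u -> Lp p v -> Lp p w -> Lp p z ->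
  cnorm p (fun x => u x - z x) <= cnorm p (fun x => u x - v x) + cnorm p (fun x => v x - w x) + cnorm p (fun x => w x - z x).
Proof.
move=> Lu Lv Lw Lz.
have L1 := LpB p u v p1 Lu Lv; have L2 := LpB p v w p1 Lv Lw; have L3 := LpB p w z p1 Lw Lz.
rewrite (_ : (fun x => u x - z x) = (fun x => (u x - v x) + (v x - w x) + (w x - z x))).
  apply: le_trans (cnormD p _ _ p1 (LpD p _ _ p1 L1 L2) L3) _.
  by rewrite lerD2r; exact: (cnormD p _ _ p1 L1 L2).
by apply/funext => x; ring.
Qed.

Section Sampling.
Context (X : nat -> nat -> R) (phi : nat -> nat -> R -> R[i]).
Hypothesis hphi : forall n k : nat, (1 <= k <= n)%N -> in_Lp p (phi n k).

Lemma Lp_sampling n f : Lp p (sampling X phi n f).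
Proof.
rewrite (_ : sampling X phi n f = (fun x => \sum_(k <- index_iota 1 n.+1 | k \in index_iota 1 n.+1) (f (X n k) * phi n k x))).
  apply: (Lp_sum p _ _ _ (fun k x => f (X n k) * phi n k x) p1) => k.
  rewrite mem_index_iota ltnS => kn.
  exact: LpZ p _ _ p1 (in_Lp_Lp _ (hphi n k kn)).
by apply/funext => x; rewrite /sampling big_seq.
Qed.

Lemma samplingB n f g : sampling X phi n (fun x => f x - g x) =
  fun x => sampling X phi n f x - sampling X phi n g x.
Proof.
by apply/funext => x; rewrite /sampling -sumrB; apply: eq_bigr => k _; rewrite mulrBl.
Qed.

End Sampling.

Lemma modulus_aeq s f g d : aeq f g -> CLp p g -> modulus s p f d = modulus s p g d.
Proof.
move=> fg Bg; rewrite /modulus.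
have E (h : R) : Lp_norm p (finite_diff s h f) = Lp_norm p (finite_diff s h g).
  have [_ mr mi _] := CLp_iter_fdiff p p1 s h g Bg.
  by rewrite !finite_diffE; exact: aeq_Lp_norm (aeq_iter_fdiff s h f g fg) mr mi.
apply: (congr1 (@ereal_sup R)); apply: eq_imagel => h _; exact: E.
Qed.

Lemma borel_copy f : in_Lp p f -> exists2 g, CLp p g & aeq f g.
Proof.
move=> [Pf l1 l2 Lf]; have [g [Pg mr mi fg]] := periodize_version f Pf (conj l1 l2).
exists g; last exact: fg.
split; [exact: Pg|exact: mr|exact: mi|].
split; first by split; exact: lebesgue_measurableW.
by rewrite -(aeq_Lp_norm p f g fg mr mi).
Qed.

Lemma cnorm_aeq_sub f g u : aeq f g -> CLp p g -> CLp p u ->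
  cnorm p (fun x => f x - u x) = cnorm p (fun x => g x - u x).
Proof.
move=> fg Bg Bu; have [_ mr mi _] := CLpB p p1 g u Bg Bu.
rewrite -!cnorm_fine; congr fine; apply: aeq_Lp_norm mr mi.
exact: (aeq_comp2 (fun a b : R[i] => a - b) _ _ _ _ fg (aeq_refl u)).
Qed.

End Errors.

Theorem theorem4p2 (R : realType) (p : R) (r s : nat)
    (X : nat -> nat -> R) (phi : nat -> nat -> R -> R[i])
    (gamma K1 K2 K3 : R)
    (hp : 1 <= p) (hr : (0 < r)%N) (hs : (0 < s)%N) (hsr : (s <= 2 * r)%N)
    (hphi : forall n k : nat, (1 <= k <= n)%N -> in_Lp p (phi n k))
    (hX : forall n : nat, (0 < n)%N -> ordered_nodes n (X n))
    (hgamma : 0 < gamma <= 1)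
    (hsep : forall n : nat, (0 < n)%N -> separated_nodes gamma n (X n))
    (hK1 : 0 < K1) (hK2 : 0 < K2) (hK3 : 0 < K3)
    (hMZ : forall (g : R -> R[i]) (n : nat), in_Lp p g -> (0 < n)%N ->
       ((K2 * lp_norm p n (X n) g)%:E <= Lp_norm p (sampling X phi n g))%E /\
       (Lp_norm p (sampling X phi n g) <= (K1 * lp_norm p n (X n) g)%:E)%E)
    (hJ : forall (g : R -> R[i]) (n : nat), in_W s p g -> (0 < n)%N ->
       (Lp_norm p (fun x => g x - sampling X phi n g x)%R
          <= (K3 * n%:R ^- s)%:E * Lp_norm p (cderiven s g))%E) :
  forall K : R, 0 < K ->
  exists c1 c2 : R, [/\ 0 < c1, 0 < c2 &
    forall f : R -> R[i], in_Lp p f ->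
      (forall n : nat, (0 < n)%N -> trig_poly n (sampling X phi n f)) ->
      (forall h : R, 0 < h ->
         (modulus s p f h <= K%:E * modulus s.+1 p f h)%E) ->
      forall n : nat, (0 < n)%N ->
        let rhs := ((lp_norm p n (X n)
                       (fun x => steklov (gamma / n%:R) r f x - f x)%R)%:E
                    + modulus s p f n%:R^-1)%E in
        (c1%:E * rhs <= Lp_norm p (fun x => f x - sampling X phi n f x)%R)%E /\
        (Lp_norm p (fun x => f x - sampling X phi n f x)%R <= c2%:E * rhs)%E].
Proof.
move=> K K0; case/andP: (hgamma) => g0 g1.
pose Cs : R := steklov_const gamma r; pose Cj : R := sampled_jackson_const gamma r s.
pose A : R := K3 * (2 * (2 ^+ s * (gamma / s.+2%:R) ^- s)).
pose D : R := stechkin_const s K.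
have Cs0 : 0 <= Cs by exact: steklov_const_ge0.
have Cj0 : 0 <= Cj by exact: sampled_jackson_const_ge0.
have A0 : 0 <= A.
  rewrite /A !mulr_ge0 ?exprn_ge0 ?(ltW hK3)// invr_ge0 exprn_ge0// divr_ge0 ?(ltW g0)//.
have D0 : 0 < D.
  have pp := pi_gt0 R.
  rewrite /D /stechkin_const mulr_gt0 ?exprn_gt0 ?ltr0n// mulr_gt0 ?mulr_gt0//.
  by rewrite addr_gt0 ?mulr_gt0 ?exprn_gt0.
exists ((2 * Cs + 2 * Cj + 1 + (A + 2) / K2) * D + K2^-1)^-1, (2 + A + 2 * K1 * (Cj + Cs) + K1).
split.
- rewrite invr_gt0 ltr_wpDl ?invr_gt0// mulr_ge0 ?(ltW D0)//.
  by rewrite !addr_ge0 ?mulr_ge0// ?invr_ge0 ?addr_ge0// ltW.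
- by rewrite ltr_wpDl// !addr_ge0// !mulr_ge0 ?addr_ge0// ltW.
move=> f If tf HK n n0 /=.
have n0R : 0 < n%:R :> R by rewrite ltr0n.
have [g Bg fg] := borel_copy p f If.
have [_ mgr mgi _] := Bg.
pose h := smooth gamma s n g; pose w := rmodulus p s g n%:R^-1.
pose st := @steklov R (gamma / n%:R) r; pose G := sampling X phi n.
have Bh : CLp p h by exact: CLp_smooth.
have Wh : in_W s p h by exact: smooth_in_W.
have Ih := CLp_in_Lp p h Bh.
have Ihf := in_LpB p hp h f Ih If.
have Lf := in_Lp_Lp p f If; have Lh := in_Lp_Lp p h Ih.
have LG u : Lp p (G u) by exact: Lp_sampling.
have BG : CLp p (G f) by exact: trig_poly_CLp (tf n n0).
have stE : st f = st g.
  by apply/funext => x; exact: steklov_aeq fg mgr mgi.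
have w0 : 0 <= w by apply: rmodulus_ge0 => //; rewrite invr_gt0.
have mf t : modulus s p f t = modulus s p g t by exact: modulus_aeq.
have mf1 t : modulus s.+1 p f t = modulus s.+1 p g t by exact: modulus_aeq.
have HKg t : 0 < t -> (modulus s p g t <= K%:E * modulus s.+1 p g t)%E.
  by move=> t0; rewrite -mf -mf1; exact: HK.
have hw : w <= D * cnorm p (fun x => f x - G f x).
  rewrite (cnorm_aeq_sub p hp f g (G f) fg Bg BG).
  exact: (modulus_le_error p hp s K g (G f) n K0 n0 Bg (tf n n0) HKg).
have ha : cnorm p (fun x => f x - h x) <= 2 * w.
  rewrite (cnorm_aeq_sub p hp f g h fg Bg Bh).
  exact: cnorm_sub_smooth.
have hb : cnorm p (fun x => h x - G h x) <= A * w.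
  have [Bd hd] := cnorm_deriv_smooth p hp gamma s n hs n0 g0 g1 g Bg.
  have := hJ h n Wh n0; rewrite (cnormE p _ (CLp_Lp p _ Bd)) -EFinM => hh.
  apply: le_trans (cnorm_le _ _ _ hh) _.
  have e : n%:R ^- s * jackson_step gamma n s ^- s = (gamma / s.+2%:R) ^- s.
    by apply: scale_cancel; rewrite ?gt_eqF// ltr0n.
  rewrite /A -e; apply: le_rearrange hd.
  by rewrite mulr_ge0 ?(ltW hK3)// invr_ge0 exprn_ge0// ltW.
have hlj := sampled_smooth_sub p hp gamma r s n (X n) hr hs hsr n0 g0 g1 (hsep n n0) g Bg.
have hlst := sampled_steklov_sub p hp gamma r s n (X n) hs n0 g0 g1 (hsep n n0) g Bg.
rewrite -/h -/w -/Cs -/Cj -/st in hlj hlst.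
pose lp u := lp_norm p n (X n) u.
have [hc1 hc2] := hMZ _ n Ihf n0.
rewrite (samplingB X phi n h f) in hc1 hc2.
have LGh := LG h; have LGf := LG f.
have LGB := LpB p (G h) (G f) hp LGh LGf.
rewrite (cnormE p _ LGB) lee_fin in hc1.
rewrite (cnormE p _ LGB) lee_fin in hc2.
have hL : lp (fun x => st f x - f x) <= lp (fun x => st g x - st h x) + lp (fun x => h x - st h x) + lp (fun x => h x - f x).
  rewrite /lp stE (lp_norm_subC p n (X n) hp h (st h)).
  exact: (lp_norm_sub3 p n (X n) hp n0 (st g) (st h) h f).
have hc : lp (fun x => h x - f x) <= lp (fun x => h x - st h x) + lp (fun x => st g x - st h x) + lp (fun x => st f x - f x).
  rewrite /lp stE (lp_norm_subC p n (X n) hp (st g) (st h)).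
  exact: (lp_norm_sub3 p n (X n) hp n0 h (st h) (st g) f).
have hE1 : K2 * lp (fun x => h x - f x) <= cnorm p (fun x => h x - G h x) + cnorm p (fun x => f x - h x) + cnorm p (fun x => f x - G f x).
  apply: le_trans hc1 _; rewrite (cnorm_subC p hp h (G h) Lh LGh) (cnorm_subC p hp f h Lf Lh).
  exact: (cnorm_sub3 p hp (G h) h f (G f) LGh Lh Lf LGf).
have hE2 : cnorm p (fun x => f x - G f x) <= cnorm p (fun x => f x - h x) + cnorm p (fun x => h x - G h x) + K1 * lp (fun x => h x - f x).
  apply: le_trans (cnorm_sub3 p hp f h (G h) (G f) Lf Lh LGh LGf) _.
  exact: lerD (lexx _) hc2.
have L0 : 0 <= lp (fun x => st f x - f x) by exact: lp_norm_ge0.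
have [lo up] := two_sided_bound _ _ _ _ _ _ _ _ A D K1 K2 Cs Cj hK1 hK2 A0 D0 Cs0 Cj0 w0 L0 ha hb hlj hlst hc hL hE1 hE2 hw.
have n10 : 0 < n%:R^-1 :> R by rewrite invr_gt0.
rewrite mf (modulusE p hp s g _ n10 Bg) (cnormE p _ (LpB p f (G f) hp Lf LGf)) -EFinD -!EFinM !lee_fin.
by split.
Qed.
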